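(* Let $m\ge 1$. For $\varphi\in L^2(\mathbb{R}^m,d\underline{x})\otimes\mathbb{C}_m$ define, for $(x_0,\underline{x})\in\mathbb{R}\times\mathbb{R}^m$, $$V(\varphi)(x_0,\underline{x})=(2\pi)^{-m}\int_{\mathbb{R}^m}\left(\int_{\mathbb{R}^m}e^{-\frac{|p|^2}{2}}\,e^{i(\underline{p},\underline{x}-\underline{y})}\,e^{-ix_0\underline{p}}\,d\underline{p}\right)\varphi(\underline{y})\,d\underline{y},$$ abbreviated as $V(\varphi)=e^{-x_0\underline{D}}\circ e^{\frac{\Delta}{2}}\varphi$. Let $d\mu=\frac{1}{\sqrt{\pi}}e^{-x_0^2}\,dx_0\,d\underline{x}$ on $\mathbb{R}^{m+1}$, and let $\mathcal{M}L^2(\mathbb{R}^{m+1},d\mu)$ be the Hilbert space of $\mathbb{C}_m$-valued monogenic functions on $\mathbb{R}^{m+1}$ which are $L^2$ with respect to $d\mu$ (with the standard inner product on $\mathbb{C}_m$). Then $$V:L^2(\mathbb{R}^m,d\underline{x})\otimes\mathbb{C}_m\to\mathcal{M}L^2(\mathbb{R}^{m+1},d\mu)$$ is a unitary isomorphism of Hilbert spaces.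
   Context: $\mathbb{C}_m=\mathbb{R}_m\otimes\mathbb{C}$ is the complex Clifford algebra with generators $e_1,\dots,e_m$, $e_ie_j+e_je_i=-2\delta_{ij}$, with basis $e_A$, $A\subset\{1,\dots,m\}$ ($e_\emptyset=1$), and standard Hermitian inner product $(\sum_A u_Ae_A,\sum_B v_Be_B)=\sum_A u_A\overline{v_A}$. Points $x\in\mathbb{R}^m$ are identified with $1$-vectors $\underline{x}=\sum_{j=1}^m x_je_j$; $(\underline{p},\underline{x})=\sum_j p_jx_j$, $|\underline{p}|=|p|$ is the Euclidean norm, and $d\underline{x}$ is Lebesgue measure. For $\underline{p}\neq0$ set $\chi_\pm(\underline{p})=\frac12\left(1\pm\frac{i\underline{p}}{|\underline{p}|}\right)$ and $e^{-ix_0\underline{p}}=e^{-x_0|\underline{p}|}\chi_+(\underline{p})+e^{x_0|\underline{p}|}\chi_-(\underline{p})$ (equal to $1$ at $\underline{p}=0$). $\underline{D}=\sum_{j=1}^m e_j\partial_{x_j}$ acts by Clifford multiplication on the left. A continuously differentiable function $f:\mathbb{R}^{m+1}\to\mathbb{C}_m$ of $(x_0,\underline{x})$ is monogenic if $(\partial_{x_0}+\underline{D})f=0$. $\Delta$ is the Euclidean Laplacian on $\mathbb{R}^m$, $e^{\Delta/2}\varphi$ is the time-$1$ solution of $\partial_t h=\frac12\Delta h$, $h_0=\varphi$ (componentwise), i.e. convolution with $\rho_1(x)=(2\pi)^{-m/2}e^{-|x|^2/2}$, and $e^{-x_0\underline{D}}g=\sum_{k\ge0}(-1)^k\frac{x_0^k}{k!}\underline{D}^kg$.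 The inner product of $\mathbb{C}_m$-valued functions in an $L^2$ space is the integral of the pointwise inner product in $\mathbb{C}_m$. *)

(* Defs.v *)
From HB Require Import structures.
From mathcomp Require Import all_boot all_order all_algebra.
From mathcomp Require Import all_classical all_reals all_analysis.
From mathcomp Require Import measurable_realfun complex ring.

Set Implicit Arguments.
Unset Strict Implicit.
Unset Printing Implicit Defensive.
Import Order.TTheory GRing.Theory Num.Theory.
Import numFieldNormedType.Exports.

Local Open Scope ring_scope.

Section clifford_sign.
Variable m : nat.
Implicit Types A B C : {set 'I_m}.

Definition symdiff A B : {set 'I_m} := (A :\: B) :|: (B :\: A).

(* Moving e_B through e_A costs one sign for each pair b < a, and one more for
   each common index, since e_a e_a = -1: hence [<=] and not [<]. *)
Definition swaps A B : nat :=
  #|[set p : 'I_m * 'I_m | [&& p.1 \in A, p.2 \in B & (p.2 <= p.1)%N]]|.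

Lemma in_symdiff A B x : (x \in symdiff A B) = (x \in A) (+) (x \in B).
Proof. by rewrite !inE; case: (x \in A); case: (x \in B). Qed.

Lemma symdiffA A B C : symdiff A (symdiff B C) = symdiff (symdiff A B) C.
Proof. by apply/setP => x; rewrite !in_symdiff addbA. Qed.

Lemma symdiffK A : cancel (symdiff A) (symdiff A).
Proof. by move=> B; apply/setP => x; rewrite !in_symdiff addKb. Qed.

Lemma symdiff_eq A B C : (symdiff A B == C) = (B == symdiff A C).
Proof. by apply/eqP/eqP => [<-|->]; rewrite symdiffK. Qed.

Let odd_card (T : finType) (X Y Z : {set T}) :
  (forall x, (x \in Z) = (x \in X) (+) (x \in Y)) ->
  odd #|Z| = odd #|X| (+) odd #|Y|.
Proof.
move=> ZE; have -> : Z = (X :\: Y) :|: (Y :\: X).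
  by apply/setP => x; rewrite ZE !inE; case: (x \in X); case: (x \in Y).
rewrite cardsU (_ : _ :&: _ = finset.set0); last first.
  by apply/setP => x; rewrite !inE; case: (x \in X); case: (x \in Y).
rewrite cards0 subn0 oddD -(cardsID Y X) -(cardsID X Y) !oddD finset.setIC.
by case: (odd _); case: (odd _); case: (odd _).
Qed.

Lemma odd_swapsDl A B C :
  odd (swaps (symdiff A B) C) = odd (swaps A C) (+) odd (swaps B C).
Proof.
apply: odd_card => p; rewrite !inE.
by case: (p.1 \in A); case: (p.1 \in B); case: (p.2 \in C); case: (_ <= _)%N.
Qed.

Lemma odd_swapsDr A B C :
  odd (swaps A (symdiff B C)) = odd (swaps A B) (+) odd (swaps A C).
Proof.
apply: odd_card => p; rewrite !inE.
by case: (p.1 \in A); case: (p.2 \in B); case: (p.2 \in C); case: (_ <= _)%N.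
Qed.

Lemma swaps0l A : swaps finset.set0 A = 0%N.
Proof. by apply/eqP; rewrite cards_eq0; apply/eqP/setP => p; rewrite !inE. Qed.

Lemma swaps0r A : swaps A finset.set0 = 0%N.
Proof.
by apply/eqP; rewrite cards_eq0; apply/eqP/setP => p; rewrite !inE andbF.
Qed.

End clifford_sign.

(* An element is the family of its coordinates in the basis (e_A)_A. *)
Definition clifford (K : comNzRingType) (m : nat) := {ffun {set 'I_m} -> K}.

HB.instance Definition _ (K : comNzRingType) m :=
  Choice.copy (clifford K m) {ffun {set 'I_m} -> K}.
HB.instance Definition _ (K : comNzRingType) m :=
  GRing.Lmodule.copy (clifford K m) {ffun {set 'I_m} -> K^o}.

Section clifford_algebra.
Variables (K : comNzRingType) (m : nat).
Implicit Types (u v w : clifford K m) (A B C : {set 'I_m}).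

Definition blade A : clifford K m := [ffun B => (B == A)%:R].

Definition clifford_mul u v : clifford K m :=
  [ffun C => \sum_A \sum_(B | symdiff A B == C)
               (-1) ^+ swaps A B * (u A * v B)].

Let mulE u v C : clifford_mul u v C =
  \sum_A (-1) ^+ swaps A (symdiff A C) * (u A * v (symdiff A C)).
Proof.
rewrite ffunE; apply: eq_bigr => A _.
by rewrite (big_pred1 (symdiff A C)) // => B; rewrite symdiff_eq.
Qed.

Let bladeE A B : blade A B = (B == A)%:R. Proof. by rewrite ffunE. Qed.

Let mulA : associative clifford_mul.
Proof.
move=> u v w; apply/ffunP => D; rewrite !mulE.
under eq_bigr => A _ do rewrite mulE mulr_sumr mulr_sumr.
under [RHS]eq_bigr => E _ do rewrite mulE mulr_suml mulr_sumr.
rewrite [RHS]exchange_big /=; apply: eq_bigr => A _.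
rewrite [RHS](reindex_inj (can_inj (symdiffK A))) /=; apply: eq_bigr => B _.
rewrite symdiffK -!symdiffA.
have -> : symdiff B (symdiff A D) = symdiff A (symdiff B D).
  by apply/setP => x; rewrite !in_symdiff addbCA.
set C := symdiff A (symdiff B D).
have -> : symdiff A D = symdiff B C.
  by rewrite /C; apply/setP => x; rewrite !in_symdiff addbCA addKb.
have sgn (X Y : {set 'I_m}) : (-1) ^+ swaps X Y = (-1) ^+ odd (swaps X Y) :> K.
  by rewrite signr_odd.
rewrite !(sgn A) !(sgn B) !(sgn (symdiff _ _)) odd_swapsDl odd_swapsDr.
rewrite !signr_addb.
ring.
Qed.

Let mul1l : left_id (blade finset.set0) clifford_mul.
Proof.
move=> u; apply/ffunP => C; rewrite mulE (bigD1 finset.set0) //=.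
rewrite big1 => [|A A0]; last by rewrite bladeE (negPf A0) mul0r mulr0.
rewrite bladeE eqxx swaps0l expr0 !mul1r addr0; congr (u _).
by apply/setP => x; rewrite in_symdiff inE.
Qed.

Let cmul1r : right_id (blade finset.set0) clifford_mul.
Proof.
move=> u; apply/ffunP => C; rewrite mulE (bigD1 C) //=.
have sC A : (symdiff A C == finset.set0) = (A == C).
  apply/eqP/eqP => [eAC|->]; last first.
    by apply/setP => x; rewrite in_symdiff addbb inE.
  apply/setP => x; move/setP/(_ x): eAC; rewrite in_symdiff inE.
  by case: (x \in A); case: (x \in C).
rewrite big1 => [|A eAC]; last by rewrite bladeE sC (negPf eAC) !mulr0.
have /eqP -> : symdiff C C == finset.set0 by rewrite sC.
by rewrite bladeE eqxx swaps0r expr0 mul1r mulr1 addr0.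
Qed.

Let mulDl : left_distributive clifford_mul +%R.
Proof.
move=> u v w; apply/ffunP => C; rewrite [RHS]ffunE !mulE -big_split.
by apply: eq_bigr => A _; rewrite ffunE mulrDl mulrDr.
Qed.

Let mulDr : right_distributive clifford_mul +%R.
Proof.
move=> u v w; apply/ffunP => C; rewrite [RHS]ffunE !mulE -big_split.
by apply: eq_bigr => A _; rewrite ffunE !mulrDr.
Qed.

Let one_neq0 : blade finset.set0 != 0.
Proof.
apply/eqP => /ffunP/(_ finset.set0); rewrite !ffunE eqxx => /eqP.
by rewrite oner_eq0.
Qed.

HB.instance Definition _ := GRing.Zmodule_isNzRing.Build (clifford K m)
  mulA mul1l cmul1r mulDl mulDr one_neq0.

Lemma clifford_mulE u v C : (u * v) C =
  \sum_A (-1) ^+ swaps A (symdiff A C) * (u A * v (symdiff A C)).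
Proof. exact: mulE. Qed.

Lemma clifford_scaleE (k : K) u A : (k *: u) A = k * u A.
Proof. by rewrite ffunE. Qed.

Let scaleAl (k : K) u v : k *: (u * v) = (k *: u) * v.
Proof.
apply/ffunP => C; rewrite clifford_scaleE !clifford_mulE mulr_sumr.
by apply: eq_bigr => A _; rewrite clifford_scaleE; ring.
Qed.

HB.instance Definition _ :=
  GRing.Lmodule_isLalgebra.Build K (clifford K m) scaleAl.

Let scaleAr (k : K) u v : k *: (u * v) = u * (k *: v).
Proof.
apply/ffunP => C; rewrite clifford_scaleE !clifford_mulE mulr_sumr.
by apply: eq_bigr => A _; rewrite clifford_scaleE; ring.
Qed.

HB.instance Definition _ :=
  GRing.Lalgebra_isAlgebra.Build K (clifford K m) scaleAr.

Definition clifford_gen (i : 'I_m) : clifford K m := blade [set i]%SET.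

Lemma blade_mul A B :
  blade A * blade B = (-1) ^+ swaps A B *: blade (symdiff A B).
Proof.
apply/ffunP => C; rewrite clifford_scaleE clifford_mulE (bigD1 A) //=.
rewrite big1 => [|D DA]; last by rewrite bladeE (negPf DA) mul0r mulr0.
rewrite !bladeE eqxx mul1r addr0 symdiff_eq eq_sym symdiff_eq eq_sym.
case: eqP => [->|]; rewrite ?mulr0 // symdiffK //.
Qed.

Lemma clifford_gen_anticomm (i j : 'I_m) :
  clifford_gen i * clifford_gen j + clifford_gen j * clifford_gen i =
  (-2 * (i == j)%:R)%:A.
Proof.
rewrite /clifford_gen !blade_mul.
have sw (k l : 'I_m) : swaps [set k]%SET [set l]%SET = (l <= k)%N :> nat.
  rewrite /swaps; case: (leqP l k) => lk.
    rewrite -[RHS](cards1 (k, l)); congr #|pred_of_set _|.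
    by apply/setP => -[a b]; rewrite !inE xpair_eqE;
      case: eqP => // ->; case: eqP => // ->.
  apply/eqP; rewrite cards_eq0; apply/eqP/setP => -[a b]; rewrite !inE.
  by apply/and3P => -[/eqP-> /eqP->]; rewrite leqNgt lk.
rewrite !sw; have [->|ij] := eqVneq i j.
  have -> : symdiff [set j]%SET [set j]%SET = finset.set0.
    by apply/setP => x; rewrite in_symdiff addbb inE.
  rewrite leqnn -scalerDl expr1 mulr1 (_ : -1 - 1 = -2) //; ring.
have -> : symdiff [set j]%SET [set i]%SET = symdiff [set i]%SET [set j]%SET.
  by apply/setP => x; rewrite !in_symdiff addbC.
rewrite mulr0 scale0r -scalerDl; move: ij; rewrite -val_eqE neq_ltn.
by case/orP => ij;
  rewrite (ltnW ij) leqNgt ij ?expr0 ?expr1 ?subrr ?addNr ?scale0r.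
Qed.

(* Hence blade A is the product of the generators e_a, a in A, in increasing
   order of a. *)
Lemma blade_cons (i : 'I_m) A : (forall j, j \in A -> (i < j)%N) ->
  blade (i |: A)%SET = clifford_gen i * blade A.
Proof.
move=> iA; rewrite blade_mul (_ : swaps _ _ = 0%N).
  rewrite expr0 scale1r; congr blade; apply/setP => x; rewrite in_symdiff !inE.
  by case: eqVneq => [->|//]; case: (boolP (i \in A)) => // /iA; rewrite ltnn.
apply/eqP; rewrite cards_eq0; apply/eqP/setP => -[a b]; rewrite !inE.
by apply/and3P => -[/eqP-> /iA]; rewrite ltnNge => /negPf ->.
Qed.

Lemma clifford_bladeE u : u = \sum_A u A *: blade A.
Proof.
apply/ffunP => B; rewrite sum_ffunE (bigD1 B) //= clifford_scaleE bladeE eqxx.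
rewrite mulr1 big1 ?addr0 // => A AB.
by rewrite clifford_scaleE bladeE eq_sym (negPf AB) mulr0.
Qed.

End clifford_algebra.

Local Open Scope classical_set_scope.

Definition rV_display : measure_display.
Proof. exact: default_measure_display. Qed.

Section measurable_rV.
Variables (R : realType) (n : nat).

Let coord (i : 'I_n) (x : 'rV[R]_n) : measurableTypeR R := x ord0 i.

Let rV_set0 : g_sigma_preimage coord set0.
Proof. exact: sigma_algebra0. Qed.

Let rV_setC A : g_sigma_preimage coord A -> g_sigma_preimage coord (~` A).
Proof. exact: sigma_algebraC. Qed.

Let rV_bigcup (F : (set 'rV[R]_n)^nat) :
  (forall i, g_sigma_preimage coord (F i)) ->
  g_sigma_preimage coord (\bigcup_i F i).
Proof. exact: sigma_algebra_bigcup. Qed.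

(* The product sigma-algebra, i.e. the Borel sets of R^n, as for n.-tuple. *)
HB.instance Definition _ := @isMeasurable.Build rV_display 'rV[R]_n
  (g_sigma_preimage coord) rV_set0 rV_setC rV_bigcup.

Lemma measurable_rV_coord (i : 'I_n) :
  measurable_fun setT (fun x : 'rV[R]_n => x ord0 i : measurableTypeR R).
Proof.
move=> _ Y mY; rewrite setTI; apply: sub_sigma_algebra => /=.
rewrite -bigcup_seq/=; exists i => /=; first by rewrite mem_index_enum.
by exists Y => //; rewrite setTI.
Qed.

Lemma measurable_fun_rVP d (T : measurableType d) (f : T -> 'rV[R]_n) :
  measurable_fun setT f <->
  forall i, measurable_fun setT (fun x => f x ord0 i : measurableTypeR R).
Proof.
split=> [mf i|mf]; first exact: measurableT_comp (measurable_rV_coord i) mf.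
move=> _ Y mY; rewrite setTI.
pose G := [set A : set 'rV[R]_n | measurable (f @^-1` A)].
suff : g_sigma_preimage coord `<=` G by exact.
apply: smallest_sub.
  split; rewrite /G /=.
  - by rewrite preimage_set0.
  - by move=> A mA; rewrite setTD preimage_setC; exact: measurableC.
  - by move=> F mF; rewrite preimage_bigcup; exact: bigcup_measurable.
rewrite -bigcup_seq/= => A [i _] [B mB <-]; rewrite /G /= setTI.
by rewrite -comp_preimage -[X in measurable X]setTI; exact: mf.
Qed.

End measurable_rV.

Lemma product_sigma_finite d1 d2 (T1 : measurableType d1)
    (T2 : measurableType d2) (R : realType)
    (m1 : {sigma_finite_measure set T1 -> \bar R})
    (m2 : {sigma_finite_measure set T2 -> \bar R}) :
  sigma_finite setT (m1 \x m2)%E.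
Proof.
have /sigma_finiteP[F [TF ndF Foo]] := sigma_finiteT m1.
have /sigma_finiteP[G [TG ndG Goo]] := sigma_finiteT m2.
exists (fun n => F n `*` G n).
  rewrite -setXTT TF TG predeqE => -[x y]; split.
    move=> [/= [n _ Fnx] [k _ Gky]]; exists (maxn n k) => //; split.
    - by move: x Fnx; exact/subsetPset/ndF/leq_maxl.
    - by move: y Gky; exact/subsetPset/ndG/leq_maxr.
  by move=> [n _ []/= ? ?]; split; exists n.
move=> k; have [? ?] := Foo k; have [? ?] := Goo k.
split; first exact: measurableX.
by rewrite product_measure1E// lte_mul_pinfty// ge0_fin_numE.
Qed.

Section lebesgue_rV.
Variable R : realType.

Definition cons_rV n (z : measurableTypeR R * 'rV[R]_n) : 'rV[R]_n.+1 :=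
  \row_i (if unlift ord0 i is Some j then z.2 ord0 j else z.1).

Lemma cons_rV0 n z : @cons_rV n z ord0 ord0 = z.1.
Proof. by rewrite mxE unlift_none. Qed.

Lemma cons_rVS n z j : @cons_rV n z ord0 (lift ord0 j) = z.2 ord0 j.
Proof. by rewrite mxE liftK. Qed.

Lemma measurable_cons_rV n : measurable_fun setT (@cons_rV n).
Proof.
apply/measurable_fun_rVP => i; case: (unliftP ord0 i) => [j|] ->.
  rewrite (_ : (fun _ => _) =
      (fun z : measurableTypeR R * 'rV[R]_n => z.2 ord0 j)).
    exact: measurableT_comp (measurable_rV_coord j) measurable_snd.
  by apply/funext => z; rewrite cons_rVS.
rewrite (_ : (fun _ => _) = fst) //.
by apply/funext => z; rewrite cons_rV0.
Qed.

Section step.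
Variables (n : nat) (mu : {sigma_finite_measure set 'rV[R]_n -> \bar R}).

Definition cons_measure : set 'rV[R]_n.+1 -> \bar R :=
  pushforward ((@lebesgue_measure R) \x mu)%E (@cons_rV n).

Let cons_measure0 : cons_measure set0 = 0%E.
Proof. by rewrite /cons_measure /pushforward preimage_set0 measure0. Qed.

Let cons_measure_ge0 A : (0 <= cons_measure A)%E.
Proof. by rewrite /cons_measure /pushforward; exact: measure_ge0. Qed.

Let cons_measure_sigma_additive : semi_sigma_additive cons_measure.
Proof.
exact: (@measure_semi_sigma_additive _ _ _
  (@measure_function_pushforward__canonical__measure_function_Measure
     _ _ _ _ _ _ _ (@measurable_cons_rV n))).
Qed.

HB.instance Definition _ := isMeasure.Build _ _ _ cons_measure
  cons_measure0 cons_measure_ge0 cons_measure_sigma_additive.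

Lemma cons_measureE (A : set (measurableTypeR R)) (B : set 'rV[R]_n) :
  measurable A -> measurable B ->
  cons_measure [set x | A (x ord0 ord0) /\ B (\row_j x ord0 (lift ord0 j))] =
  (lebesgue_measure A * mu B)%E.
Proof.
move=> mA mB; rewrite -product_measure1E // /cons_measure /pushforward.
congr product_measure1; apply/seteqP.
have consE x y : \row_j @cons_rV n (x, y) ord0 (lift ord0 j) = y.
  by apply/rowP => j; rewrite mxE cons_rVS.
by split=> -[x y] /=; rewrite cons_rV0 consE.
Qed.

Let cons_measure_sigma_finite : sigma_finite setT cons_measure.
Proof.
have [F TF mF] := product_sigma_finite (@lebesgue_measure R) mu.
pose uncons (x : 'rV[R]_n.+1) : measurableTypeR R * 'rV[R]_n :=
  (x ord0 ord0, \row_j x ord0 (lift ord0 j)).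
have consK : cancel (@cons_rV n) uncons.
  move=> [x y]; rewrite /uncons cons_rV0; congr (_, _).
  by apply/rowP => j; rewrite mxE cons_rVS.
have unconsK : cancel uncons (@cons_rV n).
  move=> x; apply/rowP => i.
  by case: (unliftP ord0 i) => [j|] ->; rewrite ?cons_rVS ?cons_rV0 //= mxE.
have muncons : measurable_fun setT uncons.
  apply/measurable_fun_pair; first exact: measurable_rV_coord.
  apply/measurable_fun_rVP => j.
  rewrite (_ : (fun _ => _) = fun x : 'rV[R]_n.+1 => x ord0 (lift ord0 j)).
    exact: measurable_rV_coord.
  by apply/funext => x; rewrite mxE.
exists (fun k => uncons @^-1` F k).
  by rewrite -preimage_bigcup -TF preimage_setT.
move=> k; have [mFk Fk] := mF k; split.
  by rewrite -[X in measurable X]setTI; exact: muncons.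
rewrite /cons_measure /pushforward -comp_preimage.
by rewrite (_ : uncons \o _ = idfun) //; apply/funext => z; exact: consK.
Qed.

HB.instance Definition _ := Measure_isSigmaFinite.Build _ _ _ cons_measure
  cons_measure_sigma_finite.

End step.

(* lebesgue_rV_box below characterizes it. *)
Fixpoint lebesgue_rV n : {sigma_finite_measure set 'rV[R]_n -> \bar R} :=
  if n is n'.+1 then cons_measure (lebesgue_rV n')
  else \d_(0 : 'rV[R]_0).

Lemma measurable_rV_box n (A : 'I_n -> set (measurableTypeR R)) :
  (forall i, measurable (A i)) ->
  measurable [set x : 'rV[R]_n | forall i, A i (x ord0 i)].
Proof.
move=> mA; rewrite (_ : mkset _ =
    \bigcap_(i in [set: 'I_n]) ((fun x : 'rV[R]_n => x ord0 i) @^-1` A i)).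
  apply: fin_bigcap_measurable => [|i _]; first exact: finite_finset.
  rewrite -[X in measurable X]setTI.
  exact: (measurable_rV_coord i measurableT (mA i)).
by apply/seteqP; split=> x Ax i => [_|]; exact: Ax.
Qed.

Lemma lebesgue_rV_box n (A : 'I_n -> set (measurableTypeR R)) :
  (forall i, measurable (A i)) ->
  lebesgue_rV n [set x : 'rV[R]_n | forall i, A i (x ord0 i)] =
  (\prod_(i < n) lebesgue_measure (A i))%E.
Proof.
elim: n A => [|n IH] A mA /=.
  by rewrite big_ord0 diracE mem_set //= => -[].
have mAS j : measurable (A (lift ord0 j)) by exact: mA.
have mbox := measurable_rV_box mAS.
rewrite big_ord_recl -(IH _ mAS) -(cons_measureE _ (mA ord0) mbox).
congr cons_measure; apply/seteqP; split=> x /= Ax.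
  by split=> [|i]; rewrite ?mxE; exact: Ax.
case: Ax => A0 AS i; case: (unliftP ord0 i) => [j|] -> //.
by have := AS j; rewrite mxE.
Qed.

End lebesgue_rV.

Section clifford_L2.
Context d (T : measurableType d) (R : realType) (m : nat).
Variable mu : {measure set T -> \bar R}.
Implicit Types f g : T -> clifford R[i] m.

Definition cplx_integral (h : T -> R[i]) : R[i] :=
  ((\int[mu]_t complex.Re (h t)) +i* (\int[mu]_t complex.Im (h t)))%C.

Definition clifford_integrable f : Prop := forall A,
  mu.-integrable setT (fun t => (complex.Re (f t A))%:E) /\
  mu.-integrable setT (fun t => (complex.Im (f t A))%:E).

Definition clifford_integral f : clifford R[i] m :=
  [ffun A => cplx_integral (fun t => f t A)].

Definition clifford_inner (u v : clifford R[i] m) : R[i] :=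
  \sum_A u A * conjc (v A).

(* As C_m has finite dimension, L^2 (x) C_m consists of the functions with all
   real and imaginary coordinates in L^2, identified when almost everywhere
   equal. *)
Definition clifford_L2 : set (T -> clifford R[i] m) := [set f | forall A,
  ((fun t => complex.Re (f t A)) \in Lfun mu 2%:E) /\
  ((fun t => complex.Im (f t A)) \in Lfun mu 2%:E)].

Definition L2_eq f g : Prop := {ae mu, forall t, f t = g t}.

Definition L2_inner f g : R[i] :=
  cplx_integral (fun t => clifford_inner (f t) (g t)).

End clifford_L2.

Section monogenic.
Variables (R : realType) (m : nat).
Implicit Types (f : R * 'rV[R]_m -> clifford R[i] m).

Definition C1 (h : R * 'rV[R]_m -> R) : Prop :=
  (forall z, differentiable h z) /\ (forall v, continuous (fun z => 'D_v h z)).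

Definition clifford_C1 f : Prop := forall A,
  C1 (fun z => complex.Re (f z A)) /\ C1 (fun z => complex.Im (f z A)).

Definition clifford_derive (v : R * 'rV[R]_m) f z : clifford R[i] m :=
  [ffun A => ('D_v (fun w => complex.Re (f w A)) z +i*
              'D_v (fun w => complex.Im (f w A)) z)%C].

Definition partial0 := clifford_derive (1, 0).

Definition partial (j : 'I_m) := clifford_derive (0, delta_mx ord0 j).

Definition dirac_op f z : clifford R[i] m :=
  \sum_j clifford_gen R[i] j * partial j f z.

Definition monogenic f : Prop :=
  clifford_C1 f /\ forall z, partial0 f z + dirac_op f z = 0.

End monogenic.

Section gauss_weighted_measure.
Variables (R : realType) (m : nat).

Definition gauss_weight (x0 : R) : R := (Num.sqrt pi)^-1 * expR (- x0 ^+ 2).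

Definition gauss_measure (S : set (measurableTypeR R * 'rV[R]_m)) : \bar R :=
  (\int[(@lebesgue_measure R) \x lebesgue_rV R m]_(z in S)
     (gauss_weight z.1)%:E)%E.

Let gauss_measure0 : gauss_measure set0 = 0%E.
Proof. exact: integral_set0. Qed.

Let gauss_weight_ge0 x0 : 0 <= gauss_weight x0.
Proof. by rewrite mulr_ge0 ?invr_ge0 ?sqrtr_ge0 ?expR_ge0. Qed.

Let gauss_measure_ge0 S : (0 <= gauss_measure S)%E.
Proof. by apply: integral_ge0 => z _; rewrite lee_fin. Qed.

Let gauss_measure_sigma_additive : semi_sigma_additive gauss_measure.
Proof.
apply: semi_sigma_additive_nng_induced => [|z]; last by rewrite lee_fin.
apply/measurable_EFinP.
apply: (@measurableT_comp _ _ _ _ _ _ gauss_weight) => //.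
by apply: measurable_funM => //; exact: measurable_gauss_fun.
Qed.

HB.instance Definition _ := isMeasure.Build _ _ _ gauss_measure
  gauss_measure0 gauss_measure_ge0 gauss_measure_sigma_additive.

End gauss_weighted_measure.
Arguments gauss_measure : clear implicits.

Section transform.
Variables (R : realType) (m : nat).
Implicit Types (p x y : 'rV[R]_m) (t : R).

(* The library norm on row vectors is the sup norm. *)
Definition dotp p x : R := \sum_j p ord0 j * x ord0 j.
Definition enorm p : R := Num.sqrt (dotp p p).

Definition vect p : clifford R[i] m :=
  \sum_j ((p ord0 j)%:C)%C *: clifford_gen R[i] j.

Definition chi_plus p : clifford R[i] m :=
  2^-1 *: (1 + (0 +i* (enorm p)^-1)%C *: vect p).
Definition chi_minus p : clifford R[i] m :=
  2^-1 *: (1 - (0 +i* (enorm p)^-1)%C *: vect p).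

(* e^{-i t p} *)
Definition exp_vect t p : clifford R[i] m :=
  if p == 0 then 1 else
  (expR (- t * enorm p))%:C%C *: chi_plus p +
  (expR (t * enorm p))%:C%C *: chi_minus p.

(* e^{i t} *)
Definition cis t : R[i] := (cos t +i* sin t)%C.

Definition V_integrand (z : R * 'rV[R]_m) y p : clifford R[i] m :=
  ((expR (- (enorm p ^+ 2 / 2)))%:C%C * cis (dotp p (z.2 - y))) *:
  exp_vect z.1 p.

Definition V_kernel (z : R * 'rV[R]_m) y : clifford R[i] m :=
  clifford_integral (lebesgue_rV R m) (V_integrand z y).

Definition V_transform (phi : 'rV[R]_m -> clifford R[i] m)
    (z : R * 'rV[R]_m) : clifford R[i] m :=
  (((2 * pi) ^- m)%:C)%C *:
  clifford_integral (lebesgue_rV R m) (fun y => V_kernel z y * phi y).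

Definition monogenic_L2 : set (R * 'rV[R]_m -> clifford R[i] m) :=
  [set f | monogenic f /\ clifford_L2 (gauss_measure R m) f].

End transform.

(* Vectors of the source space E are identified along eqE; those of the target
   F (continuous functions, in our use) are not identified any further. *)
Definition unitary_iso (K : nzRingType) (U W : lmodType K)
    (E : set U) (eqE : U -> U -> Prop) (innerE : U -> U -> K)
    (F : set W) (innerF : W -> W -> K) (T : U -> W) : Prop :=
  [/\ forall u, E u -> F (T u),
      forall a u v, E u -> E v -> T (a *: u + v) = a *: T u + T v,
      forall u v, E u -> E v -> innerF (T u) (T v) = innerE u v,
      forall u v, E u -> E v -> (T u = T v <-> eqE u v) &
      forall w, F w -> exists2 u, E u & T u = w].

(* Main.v *)
(* The transform has a real kernel, so it acts separately on the real and
   imaginary parts and one can replace the complex exponential by Hartley's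
   cas u = cos u + sin u. The Hartley transform is real, (2 pi)^{m/2} times an
   isometry, and turns e^{-tD} into the one-parameter group
     hyp t g (p) = cosh (t|p|) g(p) + sinh (t|p|) / |p| p g(-p),
   so that V phi (t, .) is (2 pi)^{-m} times the Hartley transform of
   e^{-|p|^2/2} hyp t g, where g is the Hartley transform of phi.

   Isometry: integrating e^{-|p|^2} |hyp t g (p)|^2 against the weight in t gives
   (1 + e^{-|p|^2})/2 |g(p)|^2 + (1 - e^{-|p|^2})/2 |g(-p)|^2, whose integral over
   p is the square norm of g.

   Surjectivity: let f be monogenic and square integrable, and let h solve
   (d_0 - D) h = 0 with Gaussian-like data. By the divergence theorem the
   integral of <f(t, .), h(t, .)> does not depend on t, hence the Hartley
   transforms b_t of the slices of f satisfy b_s = hyp (s - a) b_a for almost all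
   a and s. The identity above, read backwards, shows that
   e^{|p|^2/2} hyp (-a) b_a is square integrable: it is the Hartley transform of
   the preimage of f. *)
From HB Require Import structures.
Require Import Defs.
From mathcomp Require Import all_boot all_order all_algebra.
From mathcomp Require Import all_classical all_reals all_analysis.
From mathcomp Require Import measurable_realfun complex ring lra.
Set Implicit Arguments.
Unset Strict Implicit.
Unset Printing Implicit Defensive.
Import Order.TTheory GRing.Theory Num.Theory.
Import numFieldNormedType.Exports.
Local Open Scope classical_set_scope.
Local Open Scope ring_scope.
(** * Integrable and square integrable real functions *)

(** The weight fits the transform because \int w(t) e^{2tq} dt = e^{q^2}, with w(t) = e^{-t^2} /
    sqrt(pi), exactly offsets the square e^{-q^2} of the heat multiplier e^{-q^2/2}.

    Since cas'(u) = cas(-u), every differentiation reflects the frequency. This is why [hyp] couples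
    p with -p, and why the energies agree only after integration over p, where the terms in
    e^{-|p|^2} cancel.

    The obstacle in surjectivity is that single slices of f are poorly controlled: they are square
    integrable for almost every t only, and [hyp s] is unbounded on L^2. The Hartley transform on
    L^2 is therefore defined by duality ([is_hartley]), and the b_t are only tested against data
    carrying a Gaussian factor, on which every [hyp s] acts. This loses nothing because Gaussian
    translates are total; the same totality gives uniqueness and inversion of the Hartley transform.

    The flux <e_j f, h> is integrable on each slab a <= t <= b, where the weight is bounded below;
    cutoffs with gradient O(1/k) then remove the boundary at infinity. Identities valid almost
    everywhere become pointwise at the end by continuity. *)

Section Lebesgue_spaces.
Context d (T : measurableType d) (R : realType).
Variable mu : {measure set T -> \bar R}.
Implicit Types (f g h : T -> R) (k : R).

Definition L1 f : Prop := mu.-integrable setT (EFin \o f).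
(** Measurability is demanded separately: that of the square says nothing about the sign of [f]. *)
Definition L2 f : Prop :=
  measurable_fun setT f /\ L1 (fun x => f x ^+ 2).
Local Notation Int f := (\int[mu]_x (f x)).

Lemma L1_measurable f : L1 f -> measurable_fun setT f.
Proof. by move=> /measurable_int/measurable_EFinP. Qed.

Lemma L1_le f g : measurable_fun setT f -> L1 g ->
  (forall x, `|f x| <= g x) -> L1 f.
Proof.
move=> mf ig fg; apply: le_integrable ig => //.
  exact/measurable_EFinP.
by move=> x _; rewrite lee_fin; apply: le_trans (ler_norm _); exact: fg.
Qed.

Lemma eq_L1 f g : f =1 g -> L1 f -> L1 g.
Proof. by move=> /funext ->. Qed.

Lemma L1D f g : L1 f -> L1 g -> L1 (fun x => f x + g x).
Proof.
move=> i1 i2; rewrite /L1.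
by rewrite (_ : _ \o _ = (EFin \o f) \+ (EFin \o g))%E //; exact: integrableD.
Qed.

Lemma L1Z k f : L1 f -> L1 (fun x => k * f x).
Proof.
move=> i1; rewrite /L1.
rewrite (_ : _ \o _ = fun x => (k%:E * (EFin \o f) x)%E) //.
exact: integrableZl.
Qed.

Lemma L1N f : L1 f -> L1 (fun x => - f x).
Proof.
by move=> /(L1Z (-1)); rewrite (_ : (fun x => - f x) = (fun x => -1 * f x)) //;
  apply/funext => x; rewrite mulN1r.
Qed.

Lemma L1B f g : L1 f -> L1 g -> L1 (fun x => f x - g x).
Proof. by move=> i1 i2; apply: L1D => //; exact: L1N. Qed.

Lemma L1_norm f : L1 f -> L1 (fun x => `|f x|).
Proof. exact: integrable_norm. Qed.

Lemma L10 : L1 (fun=> 0).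
Proof. exact: integrable0. Qed.

Lemma L1_sum (I : Type) (s : seq I) (P : pred I) (F : I -> T -> R) :
  (forall i, L1 (F i)) -> L1 (fun x => \sum_(i <- s | P i) F i x).
Proof.
move=> iF; elim: s => [|i s IH].
  by under eq_fun do rewrite big_nil; exact: L10.
under eq_fun do rewrite big_cons; case: (P i) => //.
exact: L1D.
Qed.

Lemma L1_bM k (c : T -> R) f : measurable_fun setT c ->
  (forall x, `|c x| <= k) -> L1 f -> L1 (fun x => c x * f x).
Proof.
move=> mc ck i1; apply: (@L1_le _ (fun x => k * `|f x|)).
- exact: measurable_funM (L1_measurable i1).
- exact/L1Z/L1_norm.
- by move=> x; rewrite normrM ler_wpM2r.
Qed.

Lemma IntE f : L1 f -> (\int[mu]_x (f x)%:E = (Int f)%:E)%E.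
Proof. by move=> i1; rewrite /Rintegral fineK// integrable_fin_num. Qed.

Lemma L1_lty f : measurable_fun setT f ->
  (\int[mu]_x (`|f x|)%:E < +oo)%E -> L1 f.
Proof.
by move=> mf h; apply/integrableP; split=> //; exact/measurable_EFinP.
Qed.

Lemma L1_lty0 f : measurable_fun setT f -> (forall x, 0 <= f x) ->
  (\int[mu]_x (f x)%:E < +oo)%E -> L1 f.
Proof.
move=> mf f0 h; apply: L1_lty => //.
by under eq_integral do rewrite ger0_norm //.
Qed.

Lemma eq_Int f g : f =1 g -> Int f = Int g.
Proof. by move=> fg; apply: eq_Rintegral => x _. Qed.

Lemma IntD f g : L1 f -> L1 g -> Int (fun x => f x + g x) = Int f + Int g.
Proof. exact: RintegralD. Qed.

Lemma IntB f g : L1 f -> L1 g -> Int (fun x => f x - g x) = Int f - Int g.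
Proof. exact: RintegralB. Qed.

Lemma IntZ k f : L1 f -> Int (fun x => k * f x) = k * Int f.
Proof. by move=> i1; rewrite RintegralZl. Qed.

Lemma IntN f : L1 f -> Int (fun x => - f x) = - Int f.
Proof.
by move=> /(IntZ (-1)); rewrite mulN1r => <-; apply: eq_Int => x; rewrite mulN1r.
Qed.

Lemma Int0 : Int (fun=> 0) = 0.
Proof. by rewrite /Rintegral integral0. Qed.

Lemma Int_sum (I : Type) (s : seq I) (P : pred I) (F : I -> T -> R) :
  (forall i, L1 (F i)) ->
  Int (fun x => \sum_(i <- s | P i) F i x) = \sum_(i <- s | P i) Int (F i).
Proof.
move=> iF; elim: s => [|i s IH].
  by rewrite big_nil -[RHS]Int0; apply: eq_Int => x; rewrite big_nil.
rewrite big_cons -IH; under eq_Int do rewrite big_cons.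
case: (P i) => //; rewrite IntD //; exact: L1_sum.
Qed.

Lemma Int_ge0 f : (forall x, 0 <= f x) -> 0 <= Int f.
Proof. by move=> f0; exact: Rintegral_ge0. Qed.

Lemma Int_le f g : L1 f -> L1 g -> (forall x, f x <= g x) -> Int f <= Int g.
Proof. by move=> i1 i2 fg; apply: le_Rintegral. Qed.

Lemma Int_norm f : L1 f -> `|Int f| <= Int (fun x => `|f x|).
Proof. by move=> i1; exact: le_normr_Rintegral. Qed.

Lemma Int_norm_le f g : L1 f -> L1 g -> (forall x, `|f x| <= g x) ->
  `|Int f| <= Int g.
Proof.
move=> i1 i2 fg; apply: le_trans (Int_norm i1) _.
by apply: Int_le => //; exact: L1_norm.
Qed.

Lemma ae_eq_Int f g : measurable_fun setT f -> measurable_fun setT g ->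
  {ae mu, forall x, f x = g x} -> Int f = Int g.
Proof.
move=> mf mg fg; rewrite /Rintegral; congr fine.
apply: ae_eq_integral => //; [exact/measurable_EFinP|exact/measurable_EFinP|].
by apply: filterS fg => x -> _.
Qed.

Lemma ae_eq_L1 f g : measurable_fun setT g -> {ae mu, forall x, f x = g x} ->
  L1 f -> L1 g.
Proof.
move=> mg fg i1; apply: L1_lty => //.
rewrite -(@ae_eq_integral _ _ _ mu setT (fun x => (`|g x|)%:E)
  (fun x => (`|f x|)%:E)) //.
- by case/integrableP: i1.
- apply/measurable_EFinP; apply: measurableT_comp => //; exact: L1_measurable.
- by apply/measurable_EFinP; apply: measurableT_comp.
- by apply: filterS fg => x /= -> _.
Qed.

Lemma L2_measurable f : L2 f -> measurable_fun setT f.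
Proof. by case. Qed.

Lemma L2_sqr f : L2 f -> L1 (fun x => f x ^+ 2).
Proof. by case. Qed.

Lemma L2_le f g : measurable_fun setT f -> L2 g ->
  (forall x, `|f x| <= `|g x|) -> L2 f.
Proof.
move=> mf [mg ig] fg; split=> //; apply: (@L1_le _ (fun x => g x ^+ 2)) => //.
  exact: measurable_funX.
by move=> x; rewrite normrX -[leRHS]real_normK ?num_real// lerXn2r ?nnegrE.
Qed.

Lemma L2Z k f : L2 f -> L2 (fun x => k * f x).
Proof.
move=> [mf i2]; split; first exact: measurable_funM.
by under eq_fun do rewrite exprMn; exact: L1Z.
Qed.

Lemma L2D f g : L2 f -> L2 g -> L2 (fun x => f x + g x).
Proof.
move=> [mf i1] [mg i2]; split; first exact: measurable_funD.
apply: (@L1_le _ (fun x => 2 * f x ^+ 2 + 2 * g x ^+ 2)).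
- by apply: measurable_funX; exact: measurable_funD.
- by apply: L1D; exact: L1Z.
- by move=> x; rewrite ger0_norm ?sqr_ge0//; have := sqr_ge0 (f x - g x); nra.
Qed.

Lemma L2N f : L2 f -> L2 (fun x => - f x).
Proof.
by move=> /(L2Z (-1)); rewrite (_ : (fun x => - f x) = (fun x => -1 * f x)) //;
  apply/funext => x; rewrite mulN1r.
Qed.

Lemma L2B f g : L2 f -> L2 g -> L2 (fun x => f x - g x).
Proof. by move=> i1 i2; apply: L2D => //; exact: L2N. Qed.

Lemma L20 : L2 (fun=> 0).
Proof.
by split=> //; rewrite (_ : (fun=> _) = (fun=> 0));
  [exact: L10|apply/funext => x; rewrite expr0n].
Qed.

Lemma L2_sum (I : Type) (s : seq I) (P : pred I) (F : I -> T -> R) :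
  (forall i, L2 (F i)) -> L2 (fun x => \sum_(i <- s | P i) F i x).
Proof.
move=> iF; elim: s => [|i s IH].
  by under eq_fun do rewrite big_nil; exact: L20.
under eq_fun do rewrite big_cons; case: (P i) => //.
exact: L2D.
Qed.

Lemma L2M f g : L2 f -> L2 g -> L1 (fun x => f x * g x).
Proof.
move=> [mf i1] [mg i2]; apply: (@L1_le _ (fun x => f x ^+ 2 + g x ^+ 2)).
- exact: measurable_funM.
- exact: L1D.
- move=> x; rewrite normrM -(real_normK (num_real (f x))).
  rewrite -(real_normK (num_real (g x))).
  by have := sqr_ge0 (`|f x| - `|g x|); have := normr_ge0 (f x);
     have := normr_ge0 (g x); nra.
Qed.

Lemma L2_bM k (c : T -> R) f : measurable_fun setT c ->
  (forall x, `|c x| <= k) -> L2 f -> L2 (fun x => c x * f x).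
Proof.
move=> mc ck i2; apply: (@L2_le _ (fun x => k * f x)).
- exact: measurable_funM (L2_measurable i2).
- exact: L2Z.
- move=> x; rewrite !normrM ler_wpM2r//; apply: le_trans (ler_norm _); exact: ck.
Qed.

Lemma ae_eq_L2 f g : measurable_fun setT g -> {ae mu, forall x, f x = g x} ->
  L2 f -> L2 g.
Proof.
move=> mg fg [mf i1]; split=> //; apply: ae_eq_L1 i1.
  exact: measurable_funX.
by apply: filterS fg => x ->.
Qed.

Lemma L2_Int0 f : L2 f -> Int (fun x => f x ^+ 2) = 0 ->
  {ae mu, forall x, f x = 0}.
Proof.
move=> [mf i1] f0.
have := IntE i1; rewrite f0 => H.
have : (\int[mu]_x `|(f x ^+ 2)%:E| = 0)%E.
  by rewrite -[RHS]H; apply: eq_integral => x _; rewrite gee0_abs// lee_fin sqr_ge0.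
move/(ae_eq_integral_abs mu measurableT _).1; case.
  by apply/measurable_EFinP; exact: measurable_funX.
move=> N [mN N0 NP]; exists N; split=> // x /= fx; apply: NP => /= H'.
by apply: fx; have := H' I; case=> /eqP; rewrite expf_eq0/= => /eqP.
Qed.

(** Bridge to the space that occurs in [clifford_L2]. *)
Lemma Lfun2P f : f \in Lfun mu 2%:E <-> L2 f.
Proof.
split=> [fL|[mf i2]].
  split; last exact: Lfun2_integrable_sqr.
  by have := sub_Lfun_mfun fL; rewrite inE.
apply/andP; split; first by rewrite inE /=.
rewrite inE/= /finite_norm unlock/=; apply: poweR_lty.
rewrite (eq_integral (fun x => (f x ^+ 2)%:E)) ?(IntE i2) ?ltry// => x _.
by rewrite /= powR_mulrn// real_normK// num_real.
Qed.

Lemma Int_dct (u : nat -> T -> R) f g : (forall n, measurable_fun setT (u n)) ->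
  measurable_fun setT f -> {ae mu, forall x, u n x @[n --> \oo] --> f x} ->
  L1 g -> (forall n x, `|u n x| <= g x) ->
  Int (u n) @[n --> \oo] --> Int f.
Proof.
move=> mu_ mf uf ig ug.
have [|||||i1 _ h] := @dominated_convergence _ _ _ mu setT measurableT
  (fun n x => (u n x)%:E) (EFin \o f) (EFin \o g).
- by move=> n; exact/measurable_EFinP.
- exact/measurable_EFinP.
- by apply: filterS uf => x ufx _; apply: cvg_EFin => //; exact: nearW.
- exact: ig.
- by apply: nearW => x n _; rewrite /= lee_fin.
rewrite /Rintegral; apply: fine_cvg; rewrite fineK //.
exact: integrable_fin_num.
Qed.

(** Fatou's lemma in a form where the uniform bound [C] also yields the integrability of the
    limit. *)
Lemma Int_fatou (u : nat -> T -> R) f (C : R) :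
  (forall n, measurable_fun setT (u n)) -> measurable_fun setT f ->
  (forall n x, 0 <= u n x) ->
  (forall x, u n x @[n --> \oo] --> f x) ->
  (forall n, (\int[mu]_x (u n x)%:E <= C%:E)%E) ->
  L1 f /\ Int f <= C.
Proof.
move=> mu_ mf u0 uf uC.
have f0 x : 0 <= f x.
  by apply: (cvgr_to_ge (uf x)); apply: nearW => n; exact: u0.
have key : (\int[mu]_x (f x)%:E <= C%:E)%E.
  rewrite (_ : (fun x => (f x)%:E) = (fun x => limn_einf (fun n => (u n x)%:E))).
    apply: le_trans (fatou mu measurableT _ _) _ => //.
    - by move=> n; exact/measurable_EFinP.
    - by move=> n x _; rewrite lee_fin.
    - rewrite limn_einf_lim; apply: lime_le; first exact: is_cvg_einfs.
      apply: nearW => n; apply: le_trans (uC n).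
      by rewrite /einfs; apply: ereal_inf_lbound; exists n => //=.
  apply/funext => x.
  have /cvg_limn_einf_sup[-> _] // : (fun n => (u n x)%:E) @ \oo --> (f x)%:E.
  by apply: cvg_EFin => //; [exact: nearW|exact: uf].
have i1 : L1 f by apply: L1_lty0 => //; exact: le_lt_trans key (ltry _).
by split=> //; rewrite -lee_fin -IntE.
Qed.

End Lebesgue_spaces.

(** * Completeness of L^2, with an explicit rate *)

Section sqr_summable.
Variable R : realType.
Implicit Types (a : nat -> R) (s : R).

(** Each use of (x + y)^2 <= 2 x^2 + 2 y^2 splits off one increment and doubles the weight of the
    remaining ones, hence the powers of two. *)
Lemma sqr_sum_incr a k j : (a (k + j)%N - a k) ^+ 2 <=
  \sum_(i < j) 2 ^+ i.+1 * (a (k + i).+1 - a (k + i)%N) ^+ 2.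
Proof.
elim: j k => [|j IH] k; first by rewrite addn0 subrr expr0n big_ord0.
rewrite big_ord_recl /= expr1 addn0 addnS -addSn.
have -> : \sum_(i < j) 2 ^+ (bump 0 i).+1 *
    (a (k + bump 0 i).+1 - a (k + bump 0 i)%N) ^+ 2 =
    2 * \sum_(i < j) 2 ^+ i.+1 * (a (k.+1 + i).+1 - a (k.+1 + i)%N) ^+ 2.
  rewrite mulr_sumr; apply: eq_bigr => i _.
  by rewrite /bump leq0n add1n addnS addSn exprS mulrA.
have := IH k.+1; set S := \sum_(i < j) _.
have := sqr_ge0 (a (k.+1 + j)%N - a k.+1 - (a k.+1 - a k)); nra.
Qed.

Lemma sqr_sum_incr_le a s k j :
  (forall n, \sum_(i < n) 2 ^+ i * (a i.+1 - a i) ^+ 2 <= s) ->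
  (a (k + j)%N - a k) ^+ 2 <= 2 * 2^-1 ^+ k * s.
Proof.
move=> h; apply: le_trans (sqr_sum_incr a k j) _.
have -> : \sum_(i < j) 2 ^+ i.+1 * (a (k + i).+1 - a (k + i)%N) ^+ 2 =
    2 * 2^-1 ^+ k *
    \sum_(i < j) 2 ^+ (k + i) * (a (k + i).+1 - a (k + i)%N) ^+ 2.
  rewrite mulr_sumr; apply: eq_bigr => i _.
  by rewrite exprS exprD exprVn; field; rewrite expf_neq0.
rewrite ler_pM2l ?mulr_gt0 ?exprn_gt0//; apply: le_trans (h (k + j)%N).
rewrite big_split_ord /= lerDr; apply: sumr_ge0 => i _.
by rewrite mulr_ge0 ?sqr_ge0 ?exprn_ge0.
Qed.

(** Pointwise half of the completeness proof: a bound on the weighted squared increments makes the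
    sequence Cauchy, with rate 2^{-k} for the squared distance to the limit. *)
Lemma sqr_sum_cvg a s :
  (forall n, \sum_(i < n) 2 ^+ i * (a i.+1 - a i) ^+ 2 <= s) ->
  cvg (a @ \oo) /\ (forall k, (a k - lim (a @ \oo)) ^+ 2 <= 2 * 2^-1 ^+ k * s).
Proof.
move=> h.
have ca : cvg (a @ \oo).
  apply: cauchy_cvg; apply/cauchyP => e e0.
  have : (2 * 2^-1 ^+ n * s) @[n --> \oo] --> (0 : R).
    rewrite -[0](mul0r s); apply: cvgMl; rewrite -[0](mulr0 2).
    by apply: cvgMr; apply: cvg_expr; rewrite ger0_norm ?invr_ge0// invf_lt1// ltr1n.
  move=> /cvgr0_norm_lt/(_ (e ^+ 2)).
  rewrite exprn_gt0// => /(_ isT)[k _ /(_ k (leqnn k))] /= hk.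
  exists (a k); exists k => // n /= kn; rewrite /ball/= distrC.
  rewrite -ltr_sqr ?nnegrE// ?ltW//; apply: le_lt_trans _ (le_lt_trans (ler_norm _) hk).
  by rewrite -normrX ger0_norm ?sqr_ge0// -{1}(subnKC kn) sqr_sum_incr_le.
split=> // k; apply: (@cvgr_to_le _ \oo _ _ (fun n => (a k - a n) ^+ 2)).
  rewrite expr2; under eq_fun do rewrite expr2.
  by apply: cvgM; apply: cvgB => //; exact: cvg_cst.
exists k => // n /= kn; rewrite -[leLHS]sqrrN opprB -{1}(subnKC kn).
exact: sqr_sum_incr_le.
Qed.

End sqr_summable.

Section completeness.
Context d (T : measurableType d) (R : realType).
Variable mu : {measure set T -> \bar R}.

(** The weights 2^n against increments of size 4^{-n} give [S] an integral of at most 2, so [S] is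
    finite almost everywhere and [sqr_sum_cvg] applies there. Integrating its rate 2 * 2^{-k} * [S]
    produces 4 * 2^{-k}. *)
Lemma L2_complete (u : nat -> T -> R) : (forall n, L2 mu (u n)) ->
  (forall n, \int[mu]_x ((u n.+1 x - u n x) ^+ 2) <= 4^-1 ^+ n) ->
  exists2 g, L2 mu g &
    forall k, \int[mu]_x ((u k x - g x) ^+ 2) <= 4 * 2^-1 ^+ k.
Proof.
move=> u2 hu.
pose D n x := 2 ^+ n * (u n.+1 x - u n x) ^+ 2.
have D0 n x : 0 <= D n x by rewrite mulr_ge0 ?sqr_ge0 ?exprn_ge0.
have mD n : measurable_fun setT (D n).
  apply: measurable_funM => //; apply: measurable_funX; apply: measurable_funB;
  exact: L2_measurable (u2 _).
pose S x := (\sum_(0 <= n <oo) (D n x)%:E)%E.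
have S0 x : (0 <= S x)%E by apply: nneseries_ge0 => n _ _; rewrite lee_fin.
have mS : measurable_fun setT S.
  apply: ge0_emeasurable_sum => n *; first by rewrite lee_fin.
  exact/measurable_EFinP.
have IS : (\int[mu]_x S x <= 2%:E)%E.
  rewrite integral_nneseries//; last 2 first.
  - by move=> n; exact/measurable_EFinP.
  - by move=> n x _; rewrite lee_fin.
  apply: lime_le.
    by apply: is_cvg_nneseries => n _ _; apply: integral_ge0 => x _; rewrite lee_fin.
  apply: nearW => n.
  have le1 k : (\int[mu]_x (D k x)%:E <= (2^-1 ^+ k)%:E)%E.
    have i2 : L1 mu (fun x => (u k.+1 x - u k x) ^+ 2).
      by apply: L2_sqr; exact: L2B.
    rewrite IntE; last exact: L1Z.
    rewrite lee_fin IntZ//; apply: le_trans (ler_wpM2l _ (hu k)) _.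
      by rewrite exprn_ge0.
    by rewrite -exprMn le_eqVlt; apply/orP; left; apply/eqP; congr (_ ^+ k); field.
  apply: (le_trans (lee_sum _ (fun k _ => le1 k))).
  rewrite sumEFin lee_fin big_mkord.
  have -> : \sum_(i < n) 2^-1 ^+ i = 2 - 2 * 2^-1 ^+ n :> R.
    elim: n {le1} => [|k IH]; first by rewrite big_ord0 expr0; ring.
    by rewrite big_ord_recr /= IH exprS; field.
  by rewrite lerBlDr lerDl mulr_ge0// exprn_ge0.
pose A := [set x | S x \is a fin_num].
have mA : measurable A.
  by rewrite -[A]setTI; exact: emeasurable_fin_num.
have aeA : {ae mu, forall x, A x}.
  have : mu.-integrable setT S.
    apply/integrableP; split=> //; under eq_integral do rewrite gee0_abs//.
    exact: le_lt_trans IS (ltry _).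
  by move=> /(integrable_ae measurableT); apply: filterS => x; exact.
pose s x := fine (S x).
have hs x n : A x -> \sum_(i < n) 2 ^+ i * (u i.+1 x - u i x) ^+ 2 <= s x.
  move=> Ax; rewrite -lee_fin /s fineK// -sumEFin -(big_mkord xpredT (fun i => (D i x)%:E)).
  by apply: nneseries_lim_ge => k _ _; rewrite lee_fin.
(* Replacing the sequence by 0 off [A] makes it converge at every point, so that the limit is
   measurable. *)
pose v n x := \1_A x * u n x.
pose g x := lim (v n x @[n --> \oo]).
have vg x : v n x @[n --> \oo] --> g x.
  rewrite /g; have [xA|xA] := pselect (A x).
    have -> : v^~ x = u^~ x.
      by apply/funext => n; rewrite /v indicE mem_set// mul1r.
    by have [] := @sqr_sum_cvg R (u^~ x) (s x) (fun n => hs x n xA).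
  have -> : v^~ x = cst 0.
    by apply/funext => n; rewrite /v indicE memNset// mul0r.
  exact: is_cvg_cst.
have mv n : measurable_fun setT (v n).
  by apply: measurable_funM => //; exact: L2_measurable (u2 _).
have mg : measurable_fun setT g.
  by apply: (measurable_fun_cvg mv) => x _; exact: vg.
have aeuv k : {ae mu, forall x, u k x = v k x}.
  by apply: filterS aeA => x Ax; rewrite /v indicE mem_set// mul1r.
have L1s : L1 mu s.
  apply: L1_lty0.
  - exact: measurableT_comp.
  - by move=> x; exact: fine_ge0.
  - rewrite (@ae_eq_integral _ _ _ mu setT S)//.
    + exact: le_lt_trans IS (ltry _).
    + by apply/measurable_EFinP; exact: measurableT_comp.
    + by apply: filterS aeA => x Ax _; rewrite /= fineK.
have Is : \int[mu]_x (s x) <= 2.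
  rewrite -lee_fin -IntE// (@ae_eq_integral _ _ _ mu setT S)//.
  - by apply/measurable_EFinP; exact: measurableT_comp.
  - by apply: filterS aeA => x Ax _; rewrite /= fineK.
have bnd k x : (v k x - g x) ^+ 2 <= 2 * 2^-1 ^+ k * s x.
  have [xA|xA] := pselect (A x).
    have vu n : v n x = u n x by rewrite /v indicE mem_set// mul1r.
    rewrite /g (_ : v^~ x = u^~ x); last by apply/funext => n; exact: vu.
    rewrite vu; have [_] := @sqr_sum_cvg R (u^~ x) (s x) (fun n => hs x n xA); apply.
  have v0 n : v n x = 0 by rewrite /v indicE memNset// mul0r.
  have -> : g x = 0.
    rewrite /g (_ : v^~ x = cst 0); last by apply/funext => n; exact: v0.
    by rewrite lim_cst.
  by rewrite v0 subrr expr0n /= mulr_ge0 ?mulr_ge0 ?exprn_ge0//; exact: fine_ge0.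
have L2vg k : L2 mu (fun x => v k x - g x).
  split; first exact: measurable_funB.
  apply: (@L1_le _ _ _ _ _ (fun x => 2 * 2^-1 ^+ k * s x)).
  - by apply: measurable_funX; exact: measurable_funB.
  - exact: L1Z.
  - by move=> x; rewrite ger0_norm ?sqr_ge0.
have L2v k : L2 mu (v k) by exact: ae_eq_L2 (aeuv k) (u2 k).
exists g.
  rewrite (_ : g = fun x => v 0%N x - (v 0%N x - g x)); first exact: L2B.
  by apply/funext => x; rewrite opprB addrC subrK.
move=> k; rewrite (@ae_eq_Int _ _ _ _ _ (fun x => (v k x - g x) ^+ 2)).
- apply: le_trans (Int_le (L2_sqr (L2vg k)) (L1Z _ L1s) (bnd k)) _.
  rewrite IntZ//; apply: le_trans (ler_wpM2l _ Is) _.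
    by rewrite mulr_ge0// exprn_ge0.
  by rewrite mulrAC -natrM.
- apply: measurable_funX; apply: measurable_funB => //; exact: L2_measurable (u2 _).
- by apply: measurable_funX; apply: measurable_funB.
- by apply: filterS (aeuv k) => x ->.
Qed.

End completeness.

(** * Fubini's theorem for real functions, in both orders *)

Section double_integrals.
Context d1 d2 (T1 : measurableType d1) (T2 : measurableType d2) (R : realType).
Variables (m1 : {sigma_finite_measure set T1 -> \bar R})
          (m2 : {sigma_finite_measure set T2 -> \bar R}).
Implicit Types (F : T1 * T2 -> R).

Lemma L1_prod F (G : T1 -> R) : measurable_fun setT F ->
  (forall x, L1 m2 (fun y => F (x, y))) ->
  L1 m1 G -> (forall x, \int[m2]_y `|F (x, y)| <= G x) ->
  L1 (m1 \x m2)%E F.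
Proof.
move=> mF iF iG FG; apply/integrable12ltyP; first exact/measurable_EFinP.
apply: (@le_lt_trans _ _ (\int[m1]_x (G x)%:E)%E); last by rewrite IntE ?ltry.
apply: ge0_le_integral => //.
- by move=> x _; exact: integral_ge0.
- apply: (measurable_fun_fubini_tonelli_F (fun z => (`|F z|)%:E)) => //.
  by apply/measurable_EFinP; exact: measurableT_comp.
- by apply/measurable_EFinP; exact: L1_measurable iG.
- move=> x _; rewrite /= IntE; last exact: L1_norm (iF x).
  by rewrite lee_fin.
Qed.

Lemma Fubini1 F : L1 (m1 \x m2)%E F -> (forall x, L1 m2 (fun y => F (x, y))) ->
  L1 m1 (fun x => \int[m2]_y F (x, y)) /\
  \int[(m1 \x m2)%E]_z F z = \int[m1]_x \int[m2]_y F (x, y).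
Proof.
move=> iF iFx.
have e x : ((\int[m2]_y F (x, y))%:E = \int[m2]_y (F (x, y))%:E)%E.
  by rewrite -IntE.
split.
  rewrite /L1 (_ : _ \o _ = fun x => \int[m2]_y (F (x, y))%:E)%E.
    exact: (integrable_fubini_F iF).
  by apply/funext => x; rewrite /= e.
rewrite [LHS]/Rintegral -(integral12_prod_meas1 iF) /Rintegral; congr fine.
by apply: eq_integral => x _; rewrite e.
Qed.

Lemma Fubini2 F : L1 (m1 \x m2)%E F -> (forall y, L1 m1 (fun x => F (x, y))) ->
  L1 m2 (fun y => \int[m1]_x F (x, y)) /\
  \int[(m1 \x m2)%E]_z F z = \int[m2]_y \int[m1]_x F (x, y).
Proof.
move=> iF iFx.
have e y : ((\int[m1]_x F (x, y))%:E = \int[m1]_x (F (x, y))%:E)%E.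
  by rewrite -IntE.
split.
  rewrite /L1 (_ : _ \o _ = fun y => \int[m1]_x (F (x, y))%:E)%E.
    apply/integrableP; split; first exact: (measurable_fubini_G iF).
    have mF := measurable_int _ iF.
    apply: le_lt_trans ((integrable21ltyP _ _ mF).1 iF).
    have mn : measurable_fun setT (fun z => `|(F z)%:E|)%E by exact: measurableT_comp.
    apply: ge0_le_integral => //.
    - by apply: measurableT_comp; last exact: (measurable_fubini_G iF).
    - exact: (measurable_fun_fubini_tonelli_G (fun z => `|(F z)%:E|)%E).
    - move=> y _; apply: le_abse_integral => //.
      exact: measurableT_comp mF (measurable_pair2 y).
  by apply/funext => x; rewrite /= e.
rewrite [LHS]/Rintegral -(integral21_prod_meas1 iF) /Rintegral; congr fine.
by apply: eq_integral => x _; rewrite e.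
Qed.

(** A bounded kernel is dominated by k |a(x)| |b(y)|, which is integrable on the product. *)
Lemma Int_swap (a : T1 -> R) (b : T2 -> R) (c : T1 -> T2 -> R) k :
  L1 m1 a -> L1 m2 b -> measurable_fun setT (fun z => c z.1 z.2) ->
  (forall x y, `|c x y| <= k) ->
  [/\ L1 m1 (fun x => a x * \int[m2]_y (c x y * b y)),
      L1 m2 (fun y => b y * \int[m1]_x (c x y * a x)) &
      \int[m1]_x (a x * \int[m2]_y (c x y * b y)) =
      \int[m2]_y (b y * \int[m1]_x (c x y * a x))].
Proof.
move=> ia ib mc ck.
have mc1 x : measurable_fun setT (c x).
  exact: (measurableT_comp mc (measurable_pair1 x)).
have mc2 y : measurable_fun setT (c^~ y).
  exact: (measurableT_comp mc (measurable_pair2 y)).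
pose F z := a z.1 * (c z.1 z.2 * b z.2).
have mF : measurable_fun setT F.
  apply: measurable_funM.
    exact: measurableT_comp (L1_measurable ia) measurable_fst.
  apply: measurable_funM => //.
  exact: measurableT_comp (L1_measurable ib) measurable_snd.
have icb x : L1 m2 (fun y => c x y * b y) by exact: (@L1_bM _ _ _ _ k).
have ica y : L1 m1 (fun x => c x y * a x) by exact: (@L1_bM _ _ _ _ k).
have i1 x : L1 m2 (fun y => F (x, y)) by apply: (L1Z (a x) (icb x)).
have i2 y : L1 m1 (fun x => F (x, y)).
  rewrite (_ : (fun x => _) = fun x => b y * (c x y * a x)); first exact: L1Z.
  by apply/funext => x; rewrite /F /=; ring.
have iF : L1 (m1 \x m2)%E F.
  apply: (@L1_prod _ (fun x => (k * \int[m2]_y `|b y|) * `|a x|)) => //.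
    by apply: L1Z; exact: L1_norm.
  move=> x; rewrite -IntZ; last exact: L1_norm.
  rewrite mulrC -IntZ; last by apply: L1Z; exact: L1_norm.
  apply: Int_le; [exact: L1_norm|by do 2 apply: L1Z; exact: L1_norm|move=> y].
  by rewrite /F /= !normrM ler_wpM2l// ler_wpM2r.
have [f1 f2] := Fubini1 iF i1; have [g1 g2] := Fubini2 iF i2.
have e1 : (fun x => \int[m2]_y F (x, y)) =
    fun x => a x * \int[m2]_y (c x y * b y).
  by apply/funext => x; rewrite /F /= IntZ.
have e2 : (fun y => \int[m1]_x F (x, y)) =
    fun y => b y * \int[m1]_x (c x y * a x).
  apply/funext => y; rewrite -IntZ//; apply: eq_Int => x.
  by rewrite /F /=; ring.
by split; [rewrite -e1|rewrite -e2|rewrite -e1 -e2 -f2 -g2].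
Qed.

Lemma L1_tensor (a : T1 -> R) (b : T2 -> R) : L1 m1 a -> L1 m2 b ->
  L1 (m1 \x m2)%E (fun z => a z.1 * b z.2) /\
  \int[(m1 \x m2)%E]_z (a z.1 * b z.2) = (\int[m1]_x a x) * \int[m2]_y b y.
Proof.
move=> ia ib.
have iF : L1 (m1 \x m2)%E (fun z => a z.1 * b z.2).
  apply: (@L1_prod _ (fun x => (\int[m2]_y `|b y|) * `|a x|)).
  - apply: measurable_funM.
      exact: measurableT_comp (L1_measurable ia) measurable_fst.
    exact: measurableT_comp (L1_measurable ib) measurable_snd.
  - by move=> x; exact: (L1Z (a x) ib).
  - by apply: L1Z; exact: L1_norm.
  - move=> x; rewrite mulrC -IntZ; last exact: L1_norm.
    by under eq_Int do rewrite normrM.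
split=> //; have [|_ ->] := Fubini1 iF; first by move=> x; exact: (L1Z (a x) ib).
rewrite mulrC -IntZ//; apply: eq_Int => x /=.
by rewrite IntZ// mulrC.
Qed.

End double_integrals.

(** * Lebesgue measure on R^n: translations, reflections, products *)

Notation leb R := (@lebesgue_measure R).

Section image_measure.
Context d1 d2 (X : measurableType d1) (Y : measurableType d2) (R : realType).
Variables (mu : {measure set X -> \bar R}) (nu : {measure set Y -> \bar R}).
Variables (phi : X -> Y) (k : R).
Hypothesis mphi : measurable_fun setT phi.
Hypothesis k_gt0 : 0 < k.
Hypothesis nuE : forall A, measurable A -> (nu A = k%:E * mu (phi @^-1` A))%E.

(** The factor [k] is a constant Jacobian: [|c|] for an affine map of the line, and 1 for the
    translations, reflections and splittings of R^n. *)
Lemma ge0_integral_image (F : Y -> \bar R) : measurable_fun setT F ->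
  (forall y, 0 <= F y)%E -> (\int[nu]_y F y = k%:E * \int[mu]_x F (phi x))%E.
Proof.
move=> mF F0.
pose P := @measure_function_pushforward__canonical__measure_function_Measure
     _ _ _ _ _ mu _ mphi.
rewrite (eq_measure_integral (mscale (NngNum (ltW k_gt0)) P)); last first.
  by move=> A mA _; rewrite nuE.
rewrite ge0_integral_mscale//=; congr (_ * _)%E.
by rewrite ge0_integral_pushforward.
Qed.

Lemma L1_image (f : Y -> R) : measurable_fun setT f ->
  L1 nu f <-> L1 mu (fun x => f (phi x)).
Proof.
move=> mf.
have mn : measurable_fun setT (fun y => (`|f y|)%:E).
  by apply/measurable_EFinP; exact: measurableT_comp.
have e := ge0_integral_image mn (fun y => normr_ge0 _).
split=> [/integrableP[_ h]|/integrableP[_ h]].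
  apply: L1_lty; first exact: measurableT_comp mf mphi.
  rewrite ltNge leye_eq; apply/eqP => Hy.
  by move: h; rewrite /= e Hy gt0_muley// lte_fin.
by apply: L1_lty => //; rewrite e; apply: lte_mul_pinfty => //; rewrite lee_fin ltW.
Qed.

Lemma Int_image (f : Y -> R) : L1 nu f ->
  \int[nu]_y f y = k * \int[mu]_x f (phi x).
Proof.
move=> i1; have mf := L1_measurable i1.
have i2 := (L1_image mf).1 i1.
have m1 := (measurable_EFinP _ _).2 mf.
pose F := fun y => (f y)%:E; pose G := fun x => (f (phi x))%:E.
have p : (\int[nu]_y F^\+ y = k%:E * \int[mu]_x G^\+ x)%E.
  rewrite ge0_integral_image//; last exact: measurable_funepos.
  by congr (_ * _)%E; apply: eq_integral => x _; rewrite !funeposE.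
have n : (\int[nu]_y F^\- y = k%:E * \int[mu]_x G^\- x)%E.
  rewrite ge0_integral_image//; last exact: measurable_funeneg.
  by congr (_ * _)%E; apply: eq_integral => x _; rewrite !funenegE.
apply: EFin_inj; rewrite EFinM -!IntE// -/F -/G.
rewrite [LHS]integralE p n (integralE mu setT G) [RHS]muleBr//.
rewrite fin_num_adde_defl// fin_numN.
exact: (integrable_neg_fin_num measurableT i2).
Qed.

End image_measure.

Section affine_line.
Variable R : realType.
Implicit Types (b c : R).

Lemma measurable_aff b c :
  measurable_fun setT (fun t : measurableTypeR R => b + c * t : measurableTypeR R).
Proof. by apply: measurable_funD => //; exact: measurable_funM. Qed.

(** By uniqueness of Lebesgue measure it suffices to compare half-open intervals. A negative [c]
    exchanges the open and the closed end, which does not change the length. *)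
Lemma lebesgue_measure_affine b c (A : set (measurableTypeR R)) : c != 0 ->
  measurable A ->
  lebesgue_measure A =
  (`|c|%:E * lebesgue_measure ((fun t => b + c * t)%R @^-1` A))%E.
Proof.
move=> c0 mA.
pose nu := mscale (NngNum (normr_ge0 c))
  (@measure_function_pushforward__canonical__measure_function_Measure
     _ _ _ _ _ (leb R) _ (measurable_aff b c)).
suff -> : leb R A = nu A by [].
apply: lebesgue_measure_unique => // _ [[u v] _ <-] /=.
rewrite /nu /mscale /= /pushforward.
have [c_gt0|c_lt0] : 0 < c \/ c < 0.
  by move: c0; rewrite neq_lt => /orP[]; [right|left].
- have -> : (fun t => b + c * t) @^-1` `]u, v] = `](u - b) / c, (v - b) / c]%classic.
    apply/seteqP; split=> t; rewrite /= !in_itv/= ltr_pdivrMr// ler_pdivlMr//;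
    by rewrite ltrBlDr lerBrDr (mulrC t) (addrC (c * t)).
  rewrite !lebesgue_measure_itv/= !lte_fin ltr_pM2r ?invr_gt0// ltrD2r.
  case: ifPn => _; last by rewrite mule0.
  by rewrite -!EFinD -EFinM gtr0_norm//; congr EFin; field; rewrite gt_eqF.
- have -> : (fun t => b + c * t) @^-1` `]u, v] = `[(v - b) / c, (u - b) / c[%classic.
    apply/seteqP; split=> t; rewrite /= !in_itv/= ltr_ndivlMr// ler_ndivrMr//;
    by rewrite ltrBlDr lerBrDr (mulrC t) (addrC (c * t)) andbC.
  rewrite !lebesgue_measure_itv/= !lte_fin ltr_nM2r ?invr_lt0// ltrD2r.
  case: ifPn => _; last by rewrite mule0.
  by rewrite -!EFinD -EFinM ltr0_norm//; congr EFin; field; rewrite lt_eqF.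
Qed.

Lemma L1_affine b c (f : R -> R) : c != 0 -> L1 (leb R) f ->
  L1 (leb R) (fun t => f (b + c * t)).
Proof.
move=> c0 i1; have k0 : 0 < `|c| by rewrite normr_gt0.
exact: (L1_image (measurable_aff b c) k0
  (fun A mA => lebesgue_measure_affine b c0 mA) (L1_measurable i1)).1.
Qed.

Lemma Int_affine b c (f : R -> R) : c != 0 -> L1 (leb R) f ->
  \int[leb R]_t f t = `|c| * \int[leb R]_t f (b + c * t).
Proof.
move=> c0 i1; have k0 : 0 < `|c| by rewrite normr_gt0.
exact: (Int_image (measurable_aff b c) k0
  (fun A mA => lebesgue_measure_affine b c0 mA)).
Qed.

End affine_line.

Section lebesgue_rV_theory.
Variable R : realType.
Implicit Types n : nat.
Local Notation lam n := (lebesgue_rV R n).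

Definition rV_box n (ab : 'I_n -> R * R) : set 'rV[R]_n :=
  [set x | forall i, `](ab i).1, (ab i).2]%classic (x ord0 i)].

Lemma measurable_rV_boxoc n (ab : 'I_n -> R * R) : measurable (rV_box ab).
Proof.
by apply: (@measurable_rV_box _ _ (fun i => `](ab i).1, (ab i).2]%classic)).
Qed.

Lemma rV_box_lty n (ab : 'I_n -> R * R) : (lam n (rV_box ab) < +oo)%E.
Proof.
rewrite (@lebesgue_rV_box _ _ (fun i => `](ab i).1, (ab i).2]%classic))//.
rewrite -ge0_fin_numE; last by apply: prode_ge0 => i _; exact: measure_ge0.
apply: prode_fin_num => i _; rewrite ge0_fin_numE ?measure_ge0// lebesgue_measure_itv/=.
by case: ifP => _; rewrite ?ltry// -EFinD ltry.
Qed.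

Lemma rV_measurableE n : @measurable _ 'rV[R]_n = <<s range (@rV_box n) >>.
Proof.
apply/seteqP; split; last first.
  apply: smallest_sub; first exact: sigma_algebra_measurable.
  by move=> _ [ab _ <-]; exact: measurable_rV_boxoc.
apply: smallest_sub; first exact: smallest_sigma_algebra.
rewrite -bigcup_seq/= => _ [i _] [B mB <-]; rewrite setTI.
pose G := [set B : set (measurableTypeR R) |
  <<s range (@rV_box n) >> ((fun x : 'rV[R]_n => x ord0 i) @^-1` B)].
suff : <<s @ocitv R >> `<=` G by apply.
apply: smallest_sub.
  split; rewrite /G /=.
  - by rewrite preimage_set0; exact: sigma_algebra0.
  - by move=> A mA; rewrite setTD preimage_setC -setTD; exact: sigma_algebraCD.
  - by move=> F mF; rewrite preimage_bigcup; exact: sigma_algebra_bigcup.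
move=> _ [[u v] _ <-]; rewrite /G /=.
(* The preimage of ]u, v] under the coordinate [i] is a slab; it is the union of the boxes whose
   other sides are ]-k, k]. *)
pose ab (k : nat) (j : 'I_n) : R * R :=
  if j == i then (u, v) else (- k%:R, k%:R).
rewrite (_ : _ @^-1` _ = \bigcup_k rV_box (ab k)).
  by apply: sigma_algebra_bigcup => k; apply: sub_sigma_algebra; exists (ab k).
apply/seteqP; split=> x /=; last first.
  by move=> [k _ /(_ i)]; rewrite /ab eqxx.
move=> xi; pose M := \sum_j `|x ord0 j|.
have [k Mk] : exists k, M < k%:R by exists (Num.truncn M).+1; exact: truncnS_gt.
exists k => // j; rewrite /ab; case: eqP => [-> //|_].
have xM : `|x ord0 j| <= M by rewrite /M (bigD1 j)//= lerDl sumr_ge0.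
rewrite /= in_itv/=.
move: (le_lt_trans xM Mk); rewrite ltr_norml => /andP[-> /ltW //].
Qed.

(** Half-open boxes are stable under intersection, generate the measurable sets, and the cubes ]-k,
    k]^n exhaust the space with finite measure. *)
Lemma rV_measure_unique n (m1 m2 : {measure set 'rV[R]_n -> \bar R}) :
  (forall ab, m1 (rV_box ab) = m2 (rV_box ab)) ->
  (forall ab, m1 (rV_box ab) < +oo)%E ->
  forall A, measurable A -> m1 A = m2 A.
Proof.
move=> m12 m1fin.
apply: (@measure_unique _ _ _ _ (fun k => rV_box (fun=> (- k%:R, k%:R))) (rV_measurableE n)).
- move=> _ _ [ab _ <-] [ab' _ <-].
  exists (fun i => (Num.max (ab i).1 (ab' i).1, Num.min (ab i).2 (ab' i).2)) => //.
  apply/seteqP; split=> x /=.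
    by move=> h; split=> i; move: (h i); rewrite /= !in_itv/= gt_max le_min;
      move=> /andP[/andP[l1 l2] /andP[l3 l4]]; rewrite ?l1 ?l2 ?l3 ?l4.
  move=> [h h'] i; move: (h i) (h' i); rewrite /= !in_itv/= gt_max le_min.
  by move=> /andP[-> ->] /andP[-> ->].
- by move=> k; exists (fun=> (- k%:R, k%:R)).
- rewrite -subTset => x _; pose M := \sum_j `|x ord0 j|.
  have [k Mk] : exists k, M < k%:R by exists (Num.truncn M).+1; exact: truncnS_gt.
  exists k => // j; rewrite /= in_itv/=.
  have xM : `|x ord0 j| <= M by rewrite /M (bigD1 j)//= lerDl sumr_ge0.
  by move: (le_lt_trans xM Mk); rewrite ltr_norml => /andP[-> /ltW ->].
- by move=> _ [ab _ <-]; exact: m12.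
- by move=> k; exact: m1fin.
Qed.

Lemma measurable_rV_affine n (b : 'rV[R]_n) (c : R) :
  measurable_fun setT (fun x : 'rV[R]_n => b + c *: x).
Proof.
apply/measurable_fun_rVP => i; under eq_fun do rewrite !mxE.
by apply: measurable_funD => //; apply: measurable_funM => //;
  exact: measurable_rV_coord.
Qed.

(** Covers translations (c = 1) and the reflection (c = -1) at once; the explicit factor 1 gives it
    the shape expected by [L1_image] and [Int_image]. *)
Lemma lebesgue_rV_affine n (b : 'rV[R]_n) (c : R) A : `|c| = 1 ->
  measurable A ->
  lam n A = (1%:E * lam n ((fun x => b + c *: x)%R @^-1` A))%E.
Proof.
move=> c1 mA; rewrite mul1e.
pose nu := (@measure_function_pushforward__canonical__measure_function_Measure
     _ _ _ _ _ (lam n) _ (measurable_rV_affine b c)).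
suff -> : lam n A = nu A by [].
apply: rV_measure_unique => // [ab|ab]; last exact: rV_box_lty.
rewrite /nu /= /pushforward.
have -> : (fun x => b + c *: x) @^-1` rV_box ab =
  [set x : 'rV[R]_n | forall i, ((fun t => b ord0 i + c * t) @^-1`
     `](ab i).1, (ab i).2]) (x ord0 i)].
  by apply/seteqP; split=> x /= h i; move: (h i); rewrite /= !mxE.
rewrite (@lebesgue_rV_box _ _ (fun i => `](ab i).1, (ab i).2]%classic))//.
rewrite (@lebesgue_rV_box _ _ (fun i => (fun t => b ord0 i + c * t) @^-1`
     `](ab i).1, (ab i).2])) => [|i]; last first.
  by rewrite -[X in measurable X]setTI; exact: measurable_aff.
apply: eq_bigr => i _.
rewrite (@lebesgue_measure_affine _ (b ord0 i) c)//; last first.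
  by rewrite -normr_gt0 c1.
by rewrite c1 mul1e.
Qed.

Lemma L1_rV_affine n (b : 'rV[R]_n) c (f : 'rV[R]_n -> R) : `|c| = 1 ->
  L1 (lam n) f -> L1 (lam n) (fun x => f (b + c *: x)).
Proof.
move=> c1 i1; exact: (L1_image (measurable_rV_affine b c) ltr01
  (fun A => @lebesgue_rV_affine n b c A c1) (L1_measurable i1)).1.
Qed.

Lemma Int_rV_affine n (b : 'rV[R]_n) c (f : 'rV[R]_n -> R) : `|c| = 1 ->
  L1 (lam n) f -> \int[lam n]_x f (b + c *: x) = \int[lam n]_x f x.
Proof.
move=> c1 i1; rewrite (Int_image (measurable_rV_affine b c) ltr01
  (fun A => @lebesgue_rV_affine n b c A c1) i1).
by rewrite mul1r.
Qed.

Lemma L1_rVN n (f : 'rV[R]_n -> R) : L1 (lam n) f -> L1 (lam n) (fun x => f (- x)).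
Proof.
move=> /(@L1_rV_affine _ 0 (-1)); rewrite normrN1 => /(_ erefl).
by under eq_fun do rewrite scaleN1r add0r.
Qed.

Lemma Int_rVN n (f : 'rV[R]_n -> R) : L1 (lam n) f ->
  \int[lam n]_x f (- x) = \int[lam n]_x f x.
Proof.
move=> /(@Int_rV_affine _ 0 (-1)); rewrite normrN1 => <- //.
by apply: eq_Int => x; rewrite scaleN1r add0r.
Qed.

Lemma Int_rV_odd n (f : 'rV[R]_n -> R) : L1 (lam n) f ->
  (forall x, f (- x) = - f x) -> \int[lam n]_x f x = 0.
Proof.
move=> i1 fN; have := Int_rVN i1; rewrite (eq_Int _ fN) IntN// => h; lra.
Qed.

Lemma L1_rV_shift n (b : 'rV[R]_n) (f : 'rV[R]_n -> R) :
  L1 (lam n) f -> L1 (lam n) (fun x => f (b + x)).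
Proof.
move=> /(@L1_rV_affine _ b 1); rewrite normr1 => /(_ erefl).
by under eq_fun do rewrite scale1r.
Qed.

Lemma Int_rV_shift n (b : 'rV[R]_n) (f : 'rV[R]_n -> R) : L1 (lam n) f ->
  \int[lam n]_x f (b + x) = \int[lam n]_x f x.
Proof.
move=> /(@Int_rV_affine _ b 1); rewrite normr1 => <- //.
by apply: eq_Int => x; rewrite scale1r.
Qed.

Lemma lebesgue_rV_cons n A : measurable A ->
  (lam n.+1 A = 1%:E * (leb R \x lam n)%E (@cons_rV R n @^-1` A))%E.
Proof. by rewrite mul1e. Qed.

Lemma L1_cons n (f : 'rV[R]_n.+1 -> R) : measurable_fun setT f ->
  L1 (lam n.+1) f <-> L1 (leb R \x lam n)%E (fun z => f (cons_rV z)).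
Proof.
exact: (L1_image (@measurable_cons_rV R n) ltr01 (@lebesgue_rV_cons n)).
Qed.

Lemma Int_cons n (f : 'rV[R]_n.+1 -> R) : L1 (lam n.+1) f ->
  \int[lam n.+1]_x f x = \int[(leb R \x lam n)%E]_z f (cons_rV z).
Proof.
move=> i1; rewrite (Int_image (@measurable_cons_rV R n) ltr01
  (@lebesgue_rV_cons n) i1).
by rewrite mul1r.
Qed.

Lemma L1_rV_prod n (g : 'I_n -> R -> R) : (forall i, L1 (leb R) (g i)) ->
  L1 (lam n) (fun x => \prod_i g i (x ord0 i)) /\
  \int[lam n]_x (\prod_i g i (x ord0 i)) = \prod_i \int[leb R]_t g i t.
Proof.
elim: n g => [|n IH] g ig.
  (* In dimension 0 the measure is a Dirac mass, so the empty product has integral 1. *)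
  rewrite big_ord0.
  have e : (fun x : 'rV[R]_0 => \prod_(i < 0) g i (x ord0 i)) = cst 1.
    by apply/funext => x; rewrite big_ord0.
  rewrite e; have i1 : L1 (lam 0) (cst 1).
    apply: L1_lty => //.
    by rewrite integral_dirac//= /dirac indicT mul1e ltry.
  split=> //; apply: EFin_inj; rewrite -IntE// integral_dirac//.
  by rewrite /= /dirac indicT mul1e.
have [iS eS] := IH (fun i => g (lift ord0 i)) (fun i => ig _).
have mg : measurable_fun setT (fun x : 'rV[R]_n.+1 => \prod_i g i (x ord0 i)).
  apply: measurable_prod => i _.
  exact: measurableT_comp (L1_measurable (ig i)) (measurable_rV_coord i).
have e : (fun z : R * 'rV[R]_n => \prod_i g i (cons_rV z ord0 i)) =
    fun z => g ord0 z.1 * \prod_i g (lift ord0 i) (z.2 ord0 i).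
  apply/funext => z; rewrite big_ord_recl cons_rV0; congr (_ * _).
  by apply: eq_bigr => i _; rewrite cons_rVS.
have [i1 e1] := L1_tensor (m1 := leb R) (m2 := lam n) (ig ord0) iS.
have iF : L1 (lam n.+1) (fun x : 'rV[R]_n.+1 => \prod_i g i (x ord0 i)).
  by apply/L1_cons => //; rewrite e.
split=> //; rewrite Int_cons// big_ord_recl -eS -e1.
by apply: eq_Int => z; rewrite -[LHS]/((fun z => \prod_i g i (cons_rV z ord0 i)) z) e.
Qed.

End lebesgue_rV_theory.

(** * Gaussian integrals *)

Section integral_of_derivative.
Variable R : realType.

Lemma is_derive1_continuous (F : R -> R) (s df : R) :
  is_derive s 1 F df -> {for s, continuous F}.
Proof.
by move=> Fs; apply: differentiable_continuous; apply/derivable1_diffP; case: Fs.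
Qed.

Lemma Rintegral_FTC (F f : R -> R) (a b : R) : a < b ->
  (forall s : R, is_derive s 1 F (f s)) -> continuous f ->
  \int[leb R]_(x in `[a, b]) f x = F b - F a.
Proof.
move=> ab dF cf; rewrite /Rintegral (@continuous_FTC2 _ _ F)//.
- exact: continuous_subspaceT.
- split=> [x _||].
  + by case: (dF x).
  + by apply: cvg_at_right_filter; exact: is_derive1_continuous (dF a).
  + by apply: cvg_at_left_filter; exact: is_derive1_continuous (dF b).
- by move=> x _; rewrite derive1E; exact: derive_val.
Qed.

Lemma cvg_expR_comp T (F : set_system T) {FF : Filter F} (f : T -> R) (l : R) :
  f @ F --> l -> (fun x => expR (f x)) @ F --> expR l.
Proof. by move=> fl; apply: cvg_comp fl _; exact: continuous_expR. Qed.

Lemma cvg_cos_comp T (F : set_system T) {FF : Filter F} (f : T -> R) (l : R) :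
  f @ F --> l -> (fun x => cos (f x)) @ F --> cos l.
Proof. by move=> fl; apply: cvg_comp fl _; exact: continuous_cos. Qed.

Lemma cvg_sin_comp T (F : set_system T) {FF : Filter F} (f : T -> R) (l : R) :
  f @ F --> l -> (fun x => sin (f x)) @ F --> sin l.
Proof. by move=> fl; apply: cvg_comp fl _; exact: continuous_sin. Qed.

Lemma cvg_sqr_comp T (F : set_system T) {FF : Filter F} (f : T -> R) (l : R) :
  f @ F --> l -> (fun x => f x ^+ 2) @ F --> l ^+ 2.
Proof.
by move=> fl; rewrite expr2; under eq_fun do rewrite expr2; exact: cvgM.
Qed.

Lemma is_derive_mulr (c s : R) : is_derive s 1 (fun t : R => t * c) c.
Proof.
rewrite (_ : (fun t => t * c) = c *: (@id R)).
  by apply: is_derive_eq; rewrite /GRing.scale /= mulr1.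
by apply/funext => t; rewrite mulrC.
Qed.

Lemma is_derive_mull (c s : R) : is_derive s 1 (fun t : R => c * t) c.
Proof. by under eq_fun do rewrite mulrC; exact: is_derive_mulr. Qed.

Lemma is_derive_addl (c s : R) : is_derive s 1 (fun t : R => c + t) 1.
Proof.
rewrite (_ : (fun t => c + t) = cst c + (@id R)) //.
by apply: is_derive_eq; rewrite add0r.
Qed.

Lemma is_derive_sqr (s : R) : is_derive s 1 (fun t : R => t ^+ 2) (2 * s).
Proof.
rewrite (_ : (fun t => t ^+ 2) = (@id R) * (@id R)).
  by apply: is_derive_eq; rewrite /GRing.scale /=; ring.
by apply/funext => t; rewrite expr2.
Qed.

Lemma is_derive_expR_comp (g : R -> R) (s dg : R) : is_derive s 1 g dg ->
  is_derive s 1 (fun t => expR (g t)) (expR (g s) * dg).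
Proof. by move=> h; apply: (@is_derive1_comp _ expR g). Qed.

Lemma is_derive_cos_comp (g : R -> R) (s dg : R) : is_derive s 1 g dg ->
  is_derive s 1 (fun t => cos (g t)) (- sin (g s) * dg).
Proof. by move=> h; apply: (@is_derive1_comp _ cos g). Qed.

Lemma is_derive_sin_comp (g : R -> R) (s dg : R) : is_derive s 1 g dg ->
  is_derive s 1 (fun t => sin (g t)) (cos (g s) * dg).
Proof. by move=> h; apply: (@is_derive1_comp _ sin g). Qed.

(* Integrate G (tau 1 x) - G x = \int_0^1 g (tau s x) ds in x: invariance of mu
   under tau turns this into 0 = \int g. *)
Lemma Int_deriv0 d (T : measurableType d)
    (mu : {sigma_finite_measure set T -> \bar R}) (tau : R -> T -> T)
    (G g : T -> R) :
  measurable_fun setT (fun z => tau z.1 z.2) ->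
  (forall s f, L1 mu f -> L1 mu (fun x => f (tau s x)) /\
     \int[mu]_x f (tau s x) = \int[mu]_x f x) ->
  (forall x, tau 0 x = x) -> L1 mu G -> L1 mu g ->
  (forall x (s : R), is_derive s 1 (fun s => G (tau s x)) (g (tau s x))) ->
  (forall x, continuous (fun s => g (tau s x))) ->
  \int[mu]_x g x = 0.
Proof.
move=> mtau tauI tau0 iG ig dG cg.
pose I1 : R -> R := \1_`[0, 1].
have iI : L1 (leb R) I1 by apply: integrable_indic_itv.
pose F (z : R * T) := I1 z.1 * g (tau z.1 z.2).
have mF : measurable_fun setT F.
  apply: measurable_funM.
    exact: measurableT_comp (L1_measurable iI) measurable_fst.
  exact: measurableT_comp (L1_measurable ig) mtau.
have i1 s : L1 mu (fun x => F (s, x)) by apply: (L1Z (I1 s) (tauI s _ ig).1).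
have iF : L1 (leb R \x mu)%E F.
  apply: (L1_prod (m1 := leb R) (m2 := mu) (G := fun s => (\int[mu]_x `|g x|) * I1 s)) => //.
    exact: L1Z.
  move=> s; rewrite mulrC -(tauI s _ (L1_norm ig)).2 -IntZ; last first.
    by have [] := tauI s _ (L1_norm ig).
  rewrite le_eqVlt; apply/orP; left; apply/eqP; apply: eq_Int => x.
  by rewrite /F normrM ger0_norm// /I1 indicE.
have IFE x : (fun s => F (s, x)) = (fun s => g (tau s x)) \_ `[0, 1].
  apply/funext => s; rewrite /F /I1 /patch indicE.
  by case: (_ \in _); rewrite ?mul1r ?mul0r.
have i2 x : L1 (leb R) (fun s => F (s, x)).
  rewrite /L1 IFE.
  have := @integrable_mkcond _ _ _ (leb R) `[0%R, 1%R]%classic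
    (EFin \o (fun s => g (tau s x))) (measurable_itv _).
  rewrite restrict_EFin; move=> [+ _]; apply.
  apply: continuous_compact_integrable; first exact: segment_compact.
  exact: continuous_subspaceT.
have [_ e1] := Fubini1 iF i1; have [_ e2] := Fubini2 iF i2.
have I1E : \int[leb R]_s I1 s = 1.
  have l01 : leb R `[0, 1]%classic = 1%E.
    by rewrite lebesgue_measure_itv/= lte_fin ltr01 -EFinB subr0.
  by rewrite /Rintegral integral_indic// setIT; exact: (congr1 fine l01).
have e1' : \int[leb R]_s \int[mu]_x F (s, x) = \int[mu]_x g x.
  rewrite -[RHS]mulr1 -I1E -IntZ//; apply: eq_Int => s.
  rewrite [LHS](_ : _ = I1 s * \int[mu]_x g (tau s x)); last first.
    by rewrite -IntZ//; have [] := tauI s _ ig.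
  by rewrite (tauI s _ ig).2 mulrC.
rewrite -e1' -e1 e2.
have [i3 e3] := tauI 1 _ iG.
rewrite -[RHS](subrr (\int[mu]_x G x)) -[in X in X - _]e3 -IntB//.
apply: eq_Int => x.
rewrite IFE -Rintegral_mkcond (@Rintegral_FTC (fun s => G (tau s x)))// ?tau0//.
Qed.

End integral_of_derivative.

Section gauss_line.
Variable R : realType.
Implicit Types (a s t x : R).

Lemma L1_gauss a : 0 < a -> L1 (leb R) (fun t => expR (- (a * t ^+ 2))) /\
  \int[leb R]_t expR (- (a * t ^+ 2)) = Num.sqrt (pi / a).
Proof.
move=> a0; have s0 : 0 < Num.sqrt a by rewrite sqrtr_gt0.
have e : (fun t => gauss_fun (0 + Num.sqrt a * t)) =
    (fun t => expR (- (a * t ^+ 2))).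
  by apply/funext => t; rewrite /gauss_fun add0r exprMn sqr_sqrtr// ltW.
have ig : L1 (leb R) gauss_fun by exact: integrableT_gauss.
split; first by rewrite -e; apply: L1_affine => //; rewrite gt_eqF.
have := Int_affine 0 (lt0r_neq0 s0) ig; rewrite e.
rewrite /Rintegral integralT_gauss/= -/(Rintegral _ _ _) ger0_norm ?ltW// => H.
rewrite sqrtrM ?pi_ge0// sqrtrV ?ltW//.
by rewrite H mulrAC mulfV ?mul1r// gt_eqF.
Qed.

Lemma measurable_gauss a : measurable_fun setT (fun t : R => expR (- (a * t ^+ 2))).
Proof.
by apply: measurableT_comp => //; apply: measurable_funN; apply: measurable_funM.
Qed.

Lemma measurable_cos : measurable_fun setT (@cos R).
Proof. by apply: continuous_measurable_fun; exact: continuous_cos. Qed.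

Lemma measurable_sin : measurable_fun setT (@sin R).
Proof. by apply: continuous_measurable_fun; exact: continuous_sin. Qed.

(** Half of the Gaussian absorbs the linear factor. The constant 1 + 2/a is chosen so that |t| <= 1
    + t^2 <= (1 + 2/a) (1 + a t^2 / 2), and e^s >= 1 + s concludes. *)
Lemma L1_gaussX a : 0 < a -> L1 (leb R) (fun t => `|t| * expR (- (a * t ^+ 2))).
Proof.
move=> a0; have a20 : 0 < a / 2 by rewrite divr_gt0.
apply: (@L1_le _ _ _ (leb R) _
  (fun t => (1 + 2 / a) * expR (- ((a / 2) * t ^+ 2)))).
- by apply: measurable_funM; [exact: normr_measurable|exact: measurable_gauss].
- exact: (L1Z _ (L1_gauss a20).1).
move=> t; rewrite ger0_norm ?mulr_ge0 ?expR_ge0//.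
have -> : - (a * t ^+ 2) = - (a / 2 * t ^+ 2) + - (a / 2 * t ^+ 2) by field.
rewrite expRD mulrA ler_pM2r ?expR_gt0//.
rewrite expRN ler_pdivrMr ?expR_gt0//.
apply: (@le_trans _ _ (1 + t ^+ 2)).
  by have := sqr_ge0 (`|t| - 1); rewrite -(real_normK (num_real t)); nra.
have h := expR_ge1Dx (a / 2 * t ^+ 2).
apply: le_trans (ler_wpM2l _ h); last by rewrite addr_ge0// divr_ge0// ltW.
have -> : (1 + 2 / a) * (1 + a / 2 * t ^+ 2) =
  1 + t ^+ 2 + (2 / a + a / 2 * t ^+ 2) by field; exact: lt0r_neq0.
rewrite lerDl addr_ge0//; first by rewrite divr_ge0// ltW.
by rewrite mulr_ge0 ?sqr_ge0// divr_ge0// ltW.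
Qed.

Lemma L1_gauss_cos a x : 0 < a ->
  L1 (leb R) (fun t => expR (- (a * t ^+ 2)) * cos (t * x)).
Proof.
move=> a0; under eq_fun do rewrite mulrC.
apply: (@L1_bM _ _ _ (leb R) 1).
- by apply: measurableT_comp measurable_cos _; apply: measurable_funM.
- by move=> t; exact: cos_max.
- exact: (L1_gauss a0).1.
Qed.

Lemma L1_gauss_sin a x : 0 < a ->
  L1 (leb R) (fun t => expR (- (a * t ^+ 2)) * sin (t * x)).
Proof.
move=> a0; under eq_fun do rewrite mulrC.
apply: (@L1_bM _ _ _ (leb R) 1).
- by apply: measurableT_comp measurable_sin _; apply: measurable_funM.
- by move=> t; exact: sin_max.
- exact: (L1_gauss a0).1.
Qed.

Lemma L1_gaussX_sin a x : 0 < a ->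
  L1 (leb R) (fun t => t * expR (- (a * t ^+ 2)) * sin (t * x)).
Proof.
move=> a0; apply: (@L1_le _ _ _ (leb R) _ (fun t => `|t| * expR (- (a * t ^+ 2)))).
- apply: measurable_funM; last first.
    by apply: measurableT_comp measurable_sin _; apply: measurable_funM.
  by apply: measurable_funM => //; exact: measurable_gauss.
- exact: L1_gaussX.
- by move=> t; rewrite !normrM (ger0_norm (expR_ge0 _)) ler_piMr ?sin_max//
    mulr_ge0 ?expR_ge0.
Qed.

(** Integration by parts: [g] is the derivative of [G], and its integral vanishes by [Int_deriv0]
    applied to translations of the line. *)
Lemma gauss_ibp a x : 0 < a ->
  x * \int[leb R]_t (expR (- (a * t ^+ 2)) * cos (t * x)) =
  2 * a * \int[leb R]_t (t * expR (- (a * t ^+ 2)) * sin (t * x)).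
Proof.
move=> a0.
pose G t := expR (- (a * t ^+ 2)) * sin (t * x).
pose g t := x * (expR (- (a * t ^+ 2)) * cos (t * x)) -
  2 * a * (t * expR (- (a * t ^+ 2)) * sin (t * x)).
have dG t : is_derive t 1 G (g t).
  have d1 : is_derive t 1 (fun t => expR (- (a * t ^+ 2)))
      (expR (- (a * t ^+ 2)) * (- (a * (2 * t)))).
    have -> : - (a * (2 * t)) = - a * (2 * t) by rewrite mulNr.
    have -> : (fun t => expR (- (a * t ^+ 2))) = (fun t => expR (- a * t ^+ 2)).
      by apply/funext => u; rewrite mulNr.
    rewrite -mulNr; apply: is_derive_expR_comp.
    exact: (@is_derive1_comp _ (fun u => - a * u) _ _ _ _
      (is_derive_mull _ _) (is_derive_sqr _)).
  have d2 : is_derive t 1 (fun t => sin (t * x)) (cos (t * x) * x).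
    by apply: is_derive_sin_comp; exact: is_derive_mulr.
  have := is_deriveM d1 d2.
  have -> : (fun t => expR (- (a * t ^+ 2))) * (fun t => sin (t * x)) = G by [].
  by move=> h; apply: is_derive_eq h _; rewrite /g /GRing.scale /=; ring.
have ig : L1 (leb R) g.
  by apply: L1B; apply: L1Z; [exact: L1_gauss_cos|exact: L1_gaussX_sin].
have : \int[leb R]_t g t = 0.
  apply: (@Int_deriv0 R _ _ (leb R) (fun s t => t + s) G g) => //.
  - by apply: measurable_funD; [exact: measurable_snd|exact: measurable_fst].
  - move=> s f i1; have e : (fun t => f (t + s)) = fun t => f (s + 1 * t).
      by apply/funext => t; rewrite mul1r addrC.
    split; first by rewrite e; apply: L1_affine.
    by rewrite e [RHS](@Int_affine R s 1 _ (oner_neq0 R) i1) normr1 mul1r.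
  - by move=> t; rewrite addr0.
  - exact: L1_gauss_sin.
  - move=> t s; have := @is_derive1_comp R G (fun s => t + s) s (g (t + s)) 1 (dG _).
    by rewrite mulr1; apply; exact: is_derive_addl.
  - move=> t s.
    have cg : continuous g.
      have ce (u : R) : (fun t => expR (- (a * t ^+ 2))) @ u --> expR (- (a * u ^+ 2)).
        apply: cvg_expR_comp; apply: cvgN; apply: cvgM; first exact: cvg_cst.
        by apply: cvg_sqr_comp; exact: cvg_id.
      have cx (u : R) : (fun t => t * x) @ u --> u * x.
        by apply: cvgM; [exact: cvg_id|exact: cvg_cst].
      move=> u; apply: cvgB; (apply: cvgM; first exact: cvg_cst).
        by apply: cvgM; [exact: ce|exact: cvg_cos_comp (cx u)].
      apply: cvgM; last exact: cvg_sin_comp (cx u).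
      by apply: cvgM; [exact: cvg_id|exact: ce].
    apply: (@continuous_comp _ _ _ (fun s => t + s) g); last exact: cg.
    by apply: cvgD; [exact: cvg_cst|exact: cvg_id].
rewrite IntB ?IntZ//; [by move/eqP; rewrite subr_eq0 => /eqP| | | |];
  by [exact: L1_gauss_cos|exact: L1_gaussX_sin|apply: L1Z; exact: L1_gauss_cos
     |apply: L1Z; exact: L1_gaussX_sin].
Qed.

(** Differentiation under the integral and [gauss_ibp] give J' = - y / (2a) J. Hence J(y)
    e^{y^2/(4a)} is constant, and its value at 0 is the Gaussian integral. *)
Lemma Int_gauss_cos a x : 0 < a ->
  \int[leb R]_t (expR (- (a * t ^+ 2)) * cos (t * x)) =
  Num.sqrt (pi / a) * expR (- (x ^+ 2 / (4 * a))).
Proof.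
move=> a0.
pose f x t := expR (- (a * t ^+ 2)) * cos (t * x).
pose J x := \int[leb R]_t f x t.
have df (y t : R) : is_derive y 1 (f^~ t) (- (t * expR (- (a * t ^+ 2)) * sin (t * y))).
  have d : is_derive y 1 (fun y => cos (t * y)) (- sin (t * y) * t).
    by apply: is_derive_cos_comp; exact: is_derive_mull.
  have -> : f^~ t = expR (- (a * t ^+ 2)) *: (fun y => cos (t * y)) by [].
  by apply: is_derive_eq (is_deriveZ _ d) _; rewrite /GRing.scale /=; ring.
have p1 y t : partial1of2 f y t = - (t * expR (- (a * t ^+ 2)) * sin (t * y)).
  by rewrite partial1of2E; exact: derive_val.
have dJ (y : R) : is_derive y 1 J (- (y / (2 * a)) * J y).
  have Iy : `](y - 1), (y + 1)[%classic y by rewrite /= in_itv/= ltrBlDr !ltrDl ltr01.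
  have H1 : forall x, `]y - 1, y + 1[%classic x -> (leb R).-integrable setT (EFin \o f x).
    by move=> u _; exact: L1_gauss_cos.
  have H2 : forall u t, `]y - 1, y + 1[%classic u -> setT t -> derivable (f^~ t) u 1.
    by move=> u t _ _; case: (df u t).
  have H3 t : 0 <= `|t| * expR (- (a * t ^+ 2)) by rewrite mulr_ge0 ?expR_ge0.
  have H4 : forall u t, `]y - 1, y + 1[%classic u -> setT t ->
      `|partial1of2 f u t| <= `|t| * expR (- (a * t ^+ 2)).
    move=> u t _ _; rewrite p1 normrN !normrM (ger0_norm (expR_ge0 _)).
    by rewrite ler_piMr ?sin_max// mulr_ge0 ?expR_ge0.
  apply: DeriveDef.
    exact: (derivable_under_integral measurableT Iy H1 H2 H3 (L1_gaussX a0) H4).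
  rewrite -derive1E.
  rewrite (differentiation_under_integral measurableT Iy H1 H2 H3 (L1_gaussX a0) H4).
  under eq_Int do rewrite p1.
  rewrite IntN; last exact: L1_gaussX_sin.
  have := gauss_ibp y a0; rewrite -/(J y) => h.
  rewrite mulNr; congr (- _).
  apply: (@mulfI _ (2 * a)); first by rewrite mulf_neq0// gt_eqF.
  by rewrite -h; field; rewrite gt_eqF.
pose E y := expR (y ^+ 2 / (4 * a)).
have dE (y : R) : is_derive y 1 E (E y * (y / (2 * a))).
  apply: is_derive_expR_comp.
  have h := @is_derive1_comp _ (fun u => u * (4 * a)^-1) _ _ _ _
      (is_derive_mulr (4 * a)^-1 _) (is_derive_sqr y).
  by apply: is_derive_eq h _; field; exact: lt0r_neq0.
have dK (y : R) : is_derive y 1 (J * E) 0.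
  apply: is_derive_eq (is_deriveM (dJ y) (dE y)) _.
  by rewrite /GRing.scale /=; ring.
have := @is_derive_0_is_cst R (J * E) x 0 dK.
rewrite -[(J * E) x]/(J x * E x) -[(J * E) 0]/(J 0 * E 0).
have -> : J 0 * E 0 = Num.sqrt (pi / a).
  rewrite /E expr0n /= mul0r expR0 mulr1 -(L1_gauss a0).2 /J.
  by apply: eq_Int => t; rewrite /f mulr0 cos0 mulr1.
by move=> <-; rewrite expRN mulfK// gt_eqF ?expR_gt0.
Qed.

End gauss_line.

Section euclidean.
Variables (R : realType) (n : nat).
Implicit Types (p x y : 'rV[R]_n) (a : R).

Lemma dotpC p x : dotp p x = dotp x p.
Proof. by apply: eq_bigr => i _; rewrite mulrC. Qed.

Lemma dotpDr p x y : dotp p (x + y) = dotp p x + dotp p y.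
Proof. by rewrite /dotp -big_split; apply: eq_bigr => i _; rewrite !mxE mulrDr. Qed.

Lemma dotpNr p x : dotp p (- x) = - dotp p x.
Proof. by rewrite /dotp -sumrN; apply: eq_bigr => i _; rewrite !mxE mulrN. Qed.

Lemma dotpZr p a x : dotp p (a *: x) = a * dotp p x.
Proof. by rewrite /dotp mulr_sumr; apply: eq_bigr => i _; rewrite !mxE mulrCA. Qed.

Lemma dotpDl p x y : dotp (x + y) p = dotp x p + dotp y p.
Proof. by rewrite !(dotpC _ p) dotpDr. Qed.

Lemma dotpNl p x : dotp (- x) p = - dotp x p.
Proof. by rewrite !(dotpC _ p) dotpNr. Qed.

Lemma dotpBr p x y : dotp p (x - y) = dotp p x - dotp p y.
Proof. by rewrite dotpDr dotpNr. Qed.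

Lemma dotpBl p x y : dotp (x - y) p = dotp x p - dotp y p.
Proof. by rewrite !(dotpC _ p) dotpBr. Qed.

Lemma dotp_ge0 p : 0 <= dotp p p.
Proof. by apply: sumr_ge0 => i _; rewrite -expr2 sqr_ge0. Qed.

Lemma enorm_sqr p : enorm p ^+ 2 = dotp p p.
Proof. by rewrite sqr_sqrtr// dotp_ge0. Qed.

Lemma enorm_ge0 p : 0 <= enorm p.
Proof. exact: sqrtr_ge0. Qed.

Lemma enormN p : enorm (- p) = enorm p.
Proof. by rewrite /enorm dotpNl dotpNr opprK. Qed.

Lemma ler_coord_enorm p i : `|p ord0 i| <= enorm p.
Proof.
rewrite -sqrtr_sqr ler_wsqrtr// expr2 /dotp (bigD1 i)//= lerDl.
by apply: sumr_ge0 => j _; rewrite -expr2 sqr_ge0.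
Qed.

Lemma enorm_eq0 p : (enorm p == 0) = (p == 0).
Proof.
apply/eqP/eqP => [p0|->]; last first.
  by rewrite /enorm /dotp big1 ?sqrtr0// => i _; rewrite mxE mul0r.
apply/rowP => i; rewrite mxE; apply/eqP; rewrite -normr_le0 -p0.
exact: ler_coord_enorm.
Qed.

Lemma measurable_dotp d (T : measurableType d) (f g : T -> 'rV[R]_n) :
  measurable_fun setT f -> measurable_fun setT g ->
  measurable_fun setT (fun t => dotp (f t) (g t)).
Proof.
move=> /measurable_fun_rVP mf /measurable_fun_rVP mg.
apply: measurable_sum => i; apply: measurable_funM; [exact: mf|exact: mg].
Qed.

Lemma measurable_enorm : measurable_fun setT (@enorm R n).
Proof.
apply: measurableT_comp; first by apply: continuous_measurable_fun; exact: sqrt_continuous.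
by apply: measurable_dotp => //; exact: measurable_id.
Qed.

Lemma measurable_oppV : measurable_fun setT (fun x : 'rV[R]_n => - x).
Proof.
apply/measurable_fun_rVP => i; under eq_fun do rewrite mxE.
exact: measurable_funN (measurable_rV_coord i).
Qed.

Lemma measurable_comp_oppV (f : 'rV[R]_n -> R) : measurable_fun setT f ->
  measurable_fun setT (fun x => f (- x)).
Proof. by move=> mf; exact: measurableT_comp mf measurable_oppV. Qed.

End euclidean.

Section gauss_rV.
Variable R : realType.
Local Notation lam n := (lebesgue_rV R n).
Implicit Types (a : R) (n : nat).

Definition gaussV n a (x : 'rV[R]_n) : R := expR (- (a * dotp x x)).

Lemma gaussV_prod n a (x : 'rV[R]_n) :
  gaussV a x = \prod_i expR (- (a * x ord0 i ^+ 2)).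
Proof.
rewrite -expR_sum /gaussV /dotp mulr_sumr -sumrN.
by congr expR.
Qed.

Lemma gaussV_ge0 n a (x : 'rV[R]_n) : 0 <= gaussV a x.
Proof. exact: expR_ge0. Qed.

Lemma gaussV_le1 n a (x : 'rV[R]_n) : 0 < a -> gaussV a x <= 1.
Proof. by move=> a0; rewrite -expR0 ler_expR oppr_le0 mulr_ge0 ?dotp_ge0// ltW. Qed.

Lemma gaussVN n a (x : 'rV[R]_n) : gaussV a (- x) = gaussV a x.
Proof. by rewrite /gaussV dotpNl dotpNr opprK. Qed.

Lemma gaussVD n a b (x : 'rV[R]_n) : gaussV (a + b) x = gaussV a x * gaussV b x.
Proof. by rewrite /gaussV -expRD mulrDl opprD. Qed.

Lemma measurable_gaussV n a : measurable_fun setT (@gaussV n a).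
Proof.
apply: measurableT_comp => //; apply: measurable_funN.
by apply: measurable_funM => //; apply: measurable_dotp; exact: measurable_id.
Qed.

Lemma L1_gaussV n a : 0 < a -> L1 (lam n) (gaussV a).
Proof.
move=> a0; have [i1 _] := L1_rV_prod (fun _ : 'I_n => (L1_gauss a0).1).
by rewrite (funext (@gaussV_prod n a)).
Qed.

Lemma Int_gaussV n a : 0 < a ->
  \int[lam n]_x gaussV a x = Num.sqrt (pi / a) ^+ n.
Proof.
move=> a0; have [_ e] := L1_rV_prod (fun _ : 'I_n => (L1_gauss a0).1).
rewrite (eq_Int _ (@gaussV_prod n a)) e (L1_gauss a0).2.
by rewrite prodr_const card_ord.
Qed.

Lemma L1_gaussV_cos n a (x : 'rV[R]_n) : 0 < a ->
  L1 (lam n) (fun p => gaussV a p * cos (dotp p x)).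
Proof.
move=> a0; under eq_fun do rewrite mulrC.
apply: (@L1_bM _ _ _ (lam n) 1); last exact: L1_gaussV.
- apply: measurableT_comp; first exact: measurable_cos.
  by apply: measurable_dotp => //; exact: measurable_id.
- by move=> t; exact: cos_max.
Qed.

Lemma L1_gaussV_sin n a (x : 'rV[R]_n) : 0 < a ->
  L1 (lam n) (fun p => gaussV a p * sin (dotp p x)).
Proof.
move=> a0; under eq_fun do rewrite mulrC.
apply: (@L1_bM _ _ _ (lam n) 1); last exact: L1_gaussV.
- apply: measurableT_comp; first exact: measurable_sin.
  by apply: measurable_dotp => //; exact: measurable_id.
- by move=> t; exact: sin_max.
Qed.

Lemma Int_gaussV_sin n a (x : 'rV[R]_n) : 0 < a ->
  \int[lam n]_p (gaussV a p * sin (dotp p x)) = 0.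
Proof.
move=> a0; apply: Int_rV_odd; first exact: L1_gaussV_sin.
by move=> p; rewrite gaussVN dotpNl sinN mulrN.
Qed.

(** Induction on the dimension: the cosine of the sum is expanded, and the product of sines drops
    out because its factor in dimension [n] is odd. *)
Lemma Int_gaussV_cos n a (x : 'rV[R]_n) : 0 < a ->
  \int[lam n]_p (gaussV a p * cos (dotp p x)) =
  Num.sqrt (pi / a) ^+ n * gaussV (4 * a)^-1 x.
Proof.
move=> a0; elim: n x => [|n IH] x.
  rewrite expr0 mul1r -[RHS]mulr1 -[X in _ * X](expr0 (Num.sqrt (pi / a))).
  rewrite -(@Int_gaussV 0 a a0) -IntZ; last exact: L1_gaussV.
  apply: eq_Int => p; rewrite /gaussV /dotp !big_ord0 cos0 mulr0 oppr0 expR0.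
  by rewrite mulr0 oppr0 expR0 mulr1.
pose x' := \row_j x ord0 (lift ord0 j).
have dE z : dotp (cons_rV z) x = z.1 * x ord0 ord0 + dotp z.2 x'.
  rewrite /dotp big_ord_recl cons_rV0; congr (_ + _).
  by apply: eq_bigr => i _; rewrite cons_rVS mxE.
have gE b (z : R * 'rV[R]_n) : gaussV b (cons_rV z) =
    expR (- (b * z.1 ^+ 2)) * gaussV b z.2.
  rewrite !gaussV_prod big_ord_recl cons_rV0; congr (_ * _).
  by apply: eq_bigr => i _; rewrite cons_rVS.
have [i1 e1] := L1_tensor (m1 := leb R) (m2 := lam n)
  (L1_gauss_cos (x ord0 ord0) a0) (@L1_gaussV_cos n a x' a0).
have [i2 e2] := L1_tensor (m1 := leb R) (m2 := lam n)
  (L1_gauss_sin (x ord0 ord0) a0) (@L1_gaussV_sin n a x' a0).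
rewrite Int_cons; last exact: L1_gaussV_cos.
transitivity (\int[(leb R \x lam n)%E]_z
   (expR (- (a * z.1 ^+ 2)) * cos (z.1 * x ord0 ord0) *
      (gaussV a z.2 * cos (dotp z.2 x')) -
    expR (- (a * z.1 ^+ 2)) * sin (z.1 * x ord0 ord0) *
      (gaussV a z.2 * sin (dotp z.2 x')))).
  by apply: eq_Int => z; rewrite gE dE cosD; ring.
rewrite IntB// e1 e2 Int_gaussV_sin// mulr0 subr0 IH Int_gauss_cos//.
have -> : gaussV (4 * a)^-1 x =
    expR (- (x ord0 ord0 ^+ 2 / (4 * a))) * gaussV (4 * a)^-1 x'.
  rewrite !gaussV_prod big_ord_recl; congr (expR (- _) * _); first by rewrite mulrC.
  by apply: eq_bigr => i _; rewrite mxE.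
by rewrite [_ ^+ n.+1]exprS; ring.
Qed.

End gauss_rV.

Section density.
Context d (T : measurableType d) (R : realType) (mu : {measure set T -> \bar R}).
Variable w : T -> R.
Hypothesis w0 : forall x, 0 <= w x.
Hypothesis mw : measurable_fun setT w.

(** Serves to turn the positive and negative parts of an integrable function into two measures, to
    be compared on boxes. *)
Definition density_measure (A : set T) : \bar R := (\int[mu]_(x in A) (w x)%:E)%E.

Let density0 : density_measure set0 = 0%E.
Proof. exact: integral_set0. Qed.

Let density_ge0 A : (0 <= density_measure A)%E.
Proof. by apply: integral_ge0 => x _; rewrite lee_fin. Qed.

Let density_additive : semi_sigma_additive density_measure.
Proof.
apply: semi_sigma_additive_nng_induced => [|x]; last by rewrite lee_fin.
exact/measurable_EFinP.
Qed.

HB.instance Definition _ := isMeasure.Build _ _ _ density_measure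
  density0 density_ge0 density_additive.

Definition density : {measure set T -> \bar R} := density_measure.

End density.

Lemma cvg_bigprod (R : realType) (T I : Type) (s : seq I) (F : set_system T)
    {FF : Filter F} (f : I -> T -> R) (l : I -> R) :
  (forall i, f i @ F --> l i) ->
  (fun x => \prod_(i <- s) f i x) @ F --> \prod_(i <- s) l i.
Proof.
move=> fl; elim: s => [|i s IH].
  by rewrite big_nil; under eq_fun do rewrite big_nil; exact: cvg_cst.
by rewrite big_cons; under eq_fun do rewrite big_cons; exact: cvgM.
Qed.

(** * Totality of Gaussian translates *)

Section totality.
Variable R : realType.
Local Notation lam n := (lebesgue_rV R n).

Let osc (a b : R) : R -> R := \1_(`]a, b]%classic).

Let measurable_osc a b : measurable_fun setT (osc a b : measurableTypeR R -> R).
Proof. by apply: measurable_indic. Qed.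

Let osc_bound a b t : `|osc a b t| <= 1.
Proof. by rewrite /osc indicE; case: (_ \in _); rewrite ?normr1 ?normr0. Qed.

Lemma gauss_osc_cvg (a b x : R) : x != a -> x != b ->
  (n.+1%:R * \int[leb R]_t (osc a b t * expR (- (n.+1%:R ^+ 2 * (x - t) ^+ 2))))
    @[n --> \oo] --> Num.sqrt pi * osc a b x.
Proof.
move=> xa xb.
have k0 (n : nat) : n.+1%:R != 0 :> R by rewrite pnatr_eq0.
have ig : L1 (leb R) (fun u => expR (- (1 * u ^+ 2))) by exact: (L1_gauss ltr01).1.
have mk n : measurable_fun setT (fun u : R => osc a b (x + n.+1%:R^-1 * u)).
  exact: (measurableT_comp (measurable_osc a b) (measurable_aff x n.+1%:R^-1)).
have ik n : L1 (leb R) (fun u => osc a b (x + n.+1%:R^-1 * u) * expR (- (1 * u ^+ 2))).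
  exact: (@L1_bM _ _ _ (leb R) 1 _ _ (mk n)).
have E n : n.+1%:R * \int[leb R]_t
    (osc a b t * expR (- (n.+1%:R ^+ 2 * (x - t) ^+ 2))) =
  \int[leb R]_u (osc a b (x + n.+1%:R^-1 * u) * expR (- (1 * u ^+ 2))).
  have i1 : L1 (leb R) (fun t => osc a b t * expR (- (n.+1%:R ^+ 2 * (x - t) ^+ 2))).
    apply: (@L1_bM _ _ _ (leb R) 1 _ _ (measurable_osc _ _)) => //.
    have n0 : 0 < n.+1%:R ^+ 2 :> R by rewrite exprn_gt0.
    apply: eq_L1 _ (@L1_affine R (- x) 1 _ (oner_neq0 R) (L1_gauss n0).1) => t.
    rewrite mul1r; congr (expR (- (_ * _))).
    by rewrite -sqrrN; congr (_ ^+ 2); ring.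
  rewrite (Int_affine x (invr_neq0 (k0 n)) i1) ger0_norm ?invr_ge0//.
  rewrite mulrA divff// mul1r; apply: eq_Int => u; congr (_ * expR (- _)).
  by field; rewrite nat1r (k0 n).
under eq_cvg do rewrite E.
rewrite (_ : Num.sqrt pi * osc a b x =
    \int[leb R]_u (osc a b x * expR (- (1 * u ^+ 2)))); last first.
  by rewrite IntZ// (L1_gauss ltr01).2 divr1 mulrC.
apply: (@Int_dct _ _ _ (leb R) _ _ (fun u => expR (- (1 * u ^+ 2)))) => //.
- by move=> n; exact: L1_measurable (ik n).
- exact: L1_measurable (L1Z _ ig).
- apply: nearW => u; apply: cvgMl.
  have cx : (x + n.+1%:R^-1 * u) @[n --> \oo] --> x.
    rewrite -[X in _ --> X]addr0; apply: cvgD; first exact: cvg_cst.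
    rewrite -[0](mul0r u); apply: cvgMl; exact: cvg_harmonic.
  apply: cvg_near_cst; rewrite /osc.
  have [xI|xI] := boolP (a < x <= b).
    have {}xI : a < x < b by case/andP: xI => -> /=; rewrite lt_neqAle xb.
    case/andP: xI => ax xb'.
    near=> n; rewrite !indicE !mem_set//=.
      by rewrite in_itv/= ax ltW.
    rewrite in_itv/=; apply/andP; split; [|apply: ltW]; near: n.
      exact: (cvgr_gt x cx).
    exact: (cvgr_lt x cx).
  have {xI} : x < a \/ b < x.
    move: xI; rewrite negb_and -leNgt -ltNge => /orP[xa'|]; last by right.
    by left; rewrite lt_neqAle xa.
  case=> xI.
    near=> n; rewrite !indicE !memNset//= in_itv/= => /andP[].
      by rewrite ltNge ltW.
    rewrite ltNge => /negP nx _; apply: nx; apply: ltW; near: n.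
    exact: (cvgr_lt x cx).
  near=> n; rewrite !indicE !memNset//= in_itv/= => /andP[_].
    by rewrite leNgt xI.
  rewrite leNgt => /negP; apply; near: n.
  exact: (cvgr_gt x cx).
- by move=> n u; rewrite normrM (ger0_norm (expR_ge0 _)) ler_piMl ?expR_ge0.
Unshelve. all: by end_near. Qed.

(** Discards the faces of a box, where [gauss_osc_cvg] says nothing. *)
Lemma lebesgue_rV_hyperplane n (i : 'I_n) (t : R) :
  {ae lam n, forall x : 'rV[R]_n, x ord0 i != t}.
Proof.
pose A j : set (measurableTypeR R) := if j == i then [set t] else setT.
have mA j : measurable (A j) by rewrite /A; case: ifP.
exists [set x : 'rV[R]_n | forall j, A j (x ord0 j)]; split.
- exact: measurable_rV_box.
- rewrite lebesgue_rV_box// (bigD1 i)//= {1}/A eqxx.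
  by rewrite lebesgue_measure_set1 mul0e.
- move=> x /= /negP; rewrite negbK => /eqP xi j; rewrite /A.
  by case: eqP => // ->.
Qed.

(** Averaging the hypothesis over all [y] in a box, with narrower and narrower Gaussians, recovers
    the indicator of the box. So [psi] has integral 0 over every box, hence over every measurable
    set. *)
Lemma gaussV_total n (psi : 'rV[R]_n -> R) : L1 (lam n) psi ->
  (forall a y, 0 < a -> \int[lam n]_x (psi x * gaussV a (x - y)) = 0) ->
  {ae lam n, forall x, psi x = 0}.
Proof.
move=> ipsi hpsi; have mpsi := L1_measurable ipsi.
have box0 ab : \int[lam n]_x (psi x * \1_(rV_box ab) x) = 0.
  have indE x : \1_(rV_box ab) x = \prod_i osc (ab i).1 (ab i).2 (x ord0 i) :> R.
    rewrite indicE; have [xB|xB] := pselect (rV_box ab x).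
      by rewrite mem_set// big1// => i _; rewrite /osc indicE mem_set//; exact: xB.
    rewrite memNset//; move/existsNP: xB => [i xi].
    by rewrite (bigD1 i)//= /osc indicE memNset// mul0r.
  have iB : L1 (lam n) (\1_(rV_box ab) : _ -> R).
    have mB := @measurable_rV_boxoc R n ab.
    apply: L1_lty0 => //.
    by rewrite integral_indic// setIT; exact: rV_box_lty.
  (* The mollified indicator of the box, up to the factor sqrt(pi)^n; Gaussians and boxes both
     factor over the coordinates, so its limit is found on the line. *)
  pose q (k : nat) (x : 'rV[R]_n) := \prod_i (k.+1%:R * \int[leb R]_t (osc (ab i).1 (ab i).2 t *
     expR (- (k.+1%:R ^+ 2 * (x ord0 i - t) ^+ 2)))) : R.
  pose c k (x y : 'rV[R]_n) := gaussV (k.+1%:R ^+ 2) (x - y).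
  have k0 (k : nat) : 0 < k.+1%:R ^+ 2 :> R by rewrite exprn_gt0.
  have mc k : measurable_fun setT (fun z => c k z.1 z.2).
    apply: measurableT_comp; first exact: measurable_gaussV.
    apply/measurable_fun_rVP => i; under eq_fun do rewrite !mxE.
    apply: measurable_funD; last apply: measurable_funN.
      exact: measurableT_comp (measurable_rV_coord i) measurable_fst.
    exact: measurableT_comp (measurable_rV_coord i) measurable_snd.
  have cb k x y : `|c k x y| <= 1 by rewrite ger0_norm ?gaussV_ge0 ?gaussV_le1.
  have i1 k (i : 'I_n) (x : 'rV[R]_n) : L1 (leb R) (fun t => osc (ab i).1 (ab i).2 t *
     expR (- (k.+1%:R ^+ 2 * (x ord0 i - t) ^+ 2))).
    apply: (@L1_bM _ _ _ (leb R) 1 _ _ (measurable_osc _ _)) => //.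
    apply: eq_L1 _ (@L1_affine R (- x ord0 i) 1 _ (oner_neq0 R) (L1_gauss (k0 k)).1) => t.
    rewrite mul1r; congr (expR (- (_ * _))).
    by rewrite -sqrrN; congr (_ ^+ 2); ring.
  have qE k x : k.+1%:R ^+ n * \int[lam n]_y (c k x y * \1_(rV_box ab) y) = q k x.
    rewrite /q big_split /= prodr_const card_ord; congr (_ * _).
    have [_ <-] := L1_rV_prod (fun i => i1 k i x).
    apply: eq_Int => y; rewrite indE /c gaussV_prod -big_split /=.
    by apply: eq_bigr => i _; rewrite !mxE mulrC.
  have psiq k : \int[lam n]_x (psi x * q k x) = 0.
    have [j1 j2 j3] := Int_swap ipsi iB (mc k) (cb k).
    rewrite -(mulr0 (k.+1%:R ^+ n)) -[X in _ = _ * X](_ : \int[lam n]_x (psi x *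
      \int[lam n]_y (c k x y * \1_(rV_box ab) y)) = 0).
      rewrite -IntZ//; apply: eq_Int => x; rewrite -qE; ring.
    rewrite j3 -[RHS](Int0 (lam n)); apply: eq_Int => y.
    rewrite (_ : Rintegral _ _ _ = 0) ?mulr0// -(hpsi _ y (k0 k)).
    by apply: eq_Int => x; rewrite /c mulrC.
  have osc_gauss k i x : `|k.+1%:R * \int[leb R]_t (osc (ab i).1 (ab i).2 t *
     expR (- (k.+1%:R ^+ 2 * (x - t) ^+ 2)))| <= Num.sqrt pi.
    have ii : L1 (leb R) (fun t => expR (- (k.+1%:R ^+ 2 * (- x + 1 * t) ^+ 2))).
      exact: @L1_affine R (- x) 1 _ (oner_neq0 R) (L1_gauss (k0 k)).1.
    rewrite normrM ger0_norm//.
    have -> : Num.sqrt pi = k.+1%:R *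
        \int[leb R]_t expR (- (k.+1%:R ^+ 2 * (- x + 1 * t) ^+ 2)).
      have := @Int_affine R (- x) 1 _ (oner_neq0 R) (L1_gauss (k0 k)).1.
      rewrite normr1 mul1r => <-; rewrite (L1_gauss (k0 k)).2.
      rewrite sqrtrM ?pi_ge0// sqrtrV ?sqr_ge0// sqrtr_sqr ger0_norm//.
      by rewrite mulrCA mulfV ?mulr1.
    rewrite ler_pM2l//; apply: Int_norm_le => //.
      by have := i1 k i (const_mx x); under eq_fun do rewrite mxE.
    move=> t; rewrite normrM (ger0_norm (expR_ge0 _)).
    rewrite (_ : (x - t) ^+ 2 = (- x + 1 * t) ^+ 2); last by ring.
    by rewrite ler_piMl ?expR_ge0.
  have qb k x : `|q k x| <= Num.sqrt pi ^+ n.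
    rewrite normr_prod -[in leRHS](card_ord n) -prodr_const.
    by apply: ler_prod => i _; rewrite normr_ge0 /=; exact: osc_gauss.
  have mq k : measurable_fun setT (q k).
    have mck : measurable_fun setT (fun z : 'rV[R]_n * 'rV[R]_n =>
        (c k z.1 z.2 * \1_(rV_box ab) z.2)%:E).
      apply/measurable_EFinP; apply: measurable_funM => //.
      exact: measurableT_comp (L1_measurable iB) measurable_snd.
    rewrite (_ : q k = fun x => k.+1%:R ^+ n *
      fine (\int[lam n]_y (c k x y * \1_(rV_box ab) y)%:E)); last first.
      by apply/funext => x; rewrite -qE.
    apply: measurable_funM => //; apply: measurableT_comp => //.
    apply: (measurable_fun_fubini_tonelli_F (fun z => (c k z.1 z.2 * \1_(rV_box ab) z.2)%:E)) => //.
    by move=> z; rewrite lee_fin mulr_ge0 ?gaussV_ge0.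
  have lim : \int[lam n]_x (psi x * q k x) @[k --> \oo] -->
     \int[lam n]_x (psi x * (Num.sqrt pi ^+ n * \1_(rV_box ab) x)).
    apply: (@Int_dct _ _ _ (lam n) _ _ (fun x => Num.sqrt pi ^+ n * `|psi x|)).
    - by move=> k; apply: measurable_funM.
    - by apply: measurable_funM => //; apply: measurable_funM => //; exact: L1_measurable iB.
    - have ae1 : {ae lam n, forall (x : 'rV[R]_n) (i : 'I_n),
          x ord0 i != (ab i).1 /\ x ord0 i != (ab i).2}.
        apply: filter_forall => i.
        by apply: filterI; exact: lebesgue_rV_hyperplane.
      apply: filterS ae1 => x hx; apply: cvgMr.
      have -> : Num.sqrt pi ^+ n * \1_(rV_box ab) x =
          \prod_i (Num.sqrt pi * osc (ab i).1 (ab i).2 (x ord0 i)).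
        by rewrite big_split /= prodr_const card_ord indE.
      apply: cvg_bigprod => i; have [h1 h2] := hx i.
      exact: gauss_osc_cvg.
    - by apply: L1Z; exact: L1_norm.
    - by move=> k x; rewrite normrM mulrC ler_wpM2r.
  have {lim} : \int[lam n]_x (psi x * (Num.sqrt pi ^+ n * \1_(rV_box ab) x)) = 0.
    apply: cvg_unique lim _ => //.
    by rewrite (_ : (fun k => _) = cst 0); [exact: cvg_cst|apply/funext => k].
  have ip : L1 (lam n) (fun x => psi x * \1_(rV_box ab) x).
    under eq_fun do rewrite mulrC.
    apply: (@L1_bM _ _ _ _ 1) => //; first exact: L1_measurable iB.
    by move=> x; rewrite indicE; case: (_ \in _); rewrite ?normr1 ?normr0.
  rewrite (eq_Int _ (g := fun x => Num.sqrt pi ^+ n * (psi x * \1_(rV_box ab) x))).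
    rewrite IntZ// => /eqP; rewrite mulf_eq0 expf_eq0 sqrtr_eq0 leNgt pi_gt0.
    by rewrite andbF /= => /eqP.
  by move=> x; rewrite mulrCA.
(* The vanishing over boxes says that the two densities give measures that agree on boxes, and these
   determine a measure. *)
pose nu1 := density (lam n) (funrpos_ge0 psi) (measurable_funrpos mpsi).
pose nu2 := density (lam n) (funrneg_ge0 psi) (measurable_funrneg mpsi).
have ip : L1 (lam n) psi^\+ by exact: integrable_funrpos.
have im : L1 (lam n) psi^\- by exact: integrable_funrneg.
have psiE x : psi x = psi^\+ x - psi^\- x.
  by rewrite -[LHS]/(psi x) -[in LHS](funrposBneg psi).
have nuA (f : 'rV[R]_n -> R) A : L1 (lam n) f -> measurable A ->
   (\int[lam n]_(x in A) (f x)%:E = (\int[lam n]_x (f x * \1_A x))%:E)%E.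
  move=> i1 mA; rewrite -IntE; last first.
    under eq_fun do rewrite mulrC.
    by apply: (@L1_bM _ _ _ _ 1) => // x; rewrite indicE; case: (_ \in _);
       rewrite ?normr1 ?normr0.
  rewrite [LHS]integral_mkcond; apply: eq_integral => x _.
  by rewrite /patch indicE; case: (_ \in _); rewrite ?mulr1 ?mulr0.
have iA (f : 'rV[R]_n -> R) A : L1 (lam n) f -> measurable A ->
    L1 (lam n) (fun x => f x * \1_A x).
  move=> i1 mA; under eq_fun do rewrite mulrC.
  by apply: (@L1_bM _ _ _ _ 1) => // x; rewrite indicE; case: (_ \in _);
       rewrite ?normr1 ?normr0.
have nu12 A : measurable A -> nu1 A = nu2 A.
  apply: rV_measure_unique => ab.
    have mB := @measurable_rV_boxoc R n ab.
    rewrite /nu1 /nu2 /density /= /density_measure !nuA//; congr EFin.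
    apply/eqP; rewrite -subr_eq0 -IntB//; [|exact: iA|exact: iA].
    apply/eqP; rewrite -(box0 ab); apply: eq_Int => x.
    by rewrite [in RHS]psiE mulrBl.
  rewrite /nu1 /density /= /density_measure nuA ?ltry//; exact: measurable_rV_boxoc.
have : ae_eq (lam n) setT (EFin \o psi) (cst 0%E).
  apply: integral_ae_eq => // E _ mE.
  rewrite integral0 nuA// (eq_Int _ (g := fun x => psi^\+ x * \1_E x - psi^\- x * \1_E x)); last first.
    by move=> x; rewrite -mulrBl -psiE.
  rewrite IntB; [|exact: iA|exact: iA].
  have := nu12 E mE; rewrite /nu1 /nu2 /density /= /density_measure !nuA//.
  by move=> [->]; rewrite subrr.
by apply: filterS => x /(_ I)[].
Qed.

End totality.

(** * The Hartley transform *)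

Section parameter_integral.
Context d1 d2 (T1 : measurableType d1) (T2 : measurableType d2) (R : realType).
Variable m2 : {sigma_finite_measure set T2 -> \bar R}.

(** The extended integrals of the positive and negative parts are measurable by Tonelli; [fine]
    covers the points where their difference is infinite. *)
Lemma measurable_Int (F : T1 * T2 -> R) : measurable_fun setT F ->
  measurable_fun setT (fun x => \int[m2]_y F (x, y)).
Proof.
move=> mF.
rewrite (_ : (fun x => _) = fun x => fine (
  (\int[m2]_y (F^\+ (x, y))%:E)%E - (\int[m2]_y (F^\- (x, y))%:E)%E)).
  apply: measurableT_comp => //; apply: emeasurable_funB.
    apply: (measurable_fun_fubini_tonelli_F (fun z => (F^\+ z)%:E)) => //.
      by apply/measurable_EFinP; exact: measurable_funrpos.
    by move=> z; rewrite lee_fin funrpos_ge0.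
  apply: (measurable_fun_fubini_tonelli_F (fun z => (F^\- z)%:E)) => //.
    by apply/measurable_EFinP; exact: measurable_funrneg.
  by move=> z; rewrite lee_fin funrneg_ge0.
apply/funext => x; rewrite /Rintegral; congr fine; rewrite [LHS]integralE.
congr (_ - _)%E; apply: eq_integral => y _.
  by rewrite funeposE /funrpos -EFin_max.
by rewrite funenegE /funrneg -EFin_max.
Qed.

End parameter_integral.

Section cauchy_schwarz.
Context d (T : measurableType d) (R : realType) (mu : {measure set T -> \bar R}).
Implicit Types f g : T -> R.

(** The quadratic \int (f + t g)^2 is nonnegative for all [t]; its minimum is at t = - C / B. *)
Lemma Int_CS f g : L2 mu f -> L2 mu g ->
  (\int[mu]_x (f x * g x)) ^+ 2 <=
  (\int[mu]_x (f x ^+ 2)) * \int[mu]_x (g x ^+ 2).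
Proof.
move=> f2 g2; set A := \int[mu]_x (f x ^+ 2); set B := \int[mu]_x (g x ^+ 2).
set C := \int[mu]_x (f x * g x).
have iA := L2_sqr f2; have iB := L2_sqr g2; have iC := L2M f2 g2.
have H (t : R) : 0 <= A + 2 * t * C + t ^+ 2 * B.
  have -> : A + 2 * t * C + t ^+ 2 * B = \int[mu]_x ((f x + t * g x) ^+ 2).
    have iTC := L1Z (2 * t) iC; have iTB := L1Z (t ^+ 2) iB.
    rewrite [RHS](eq_Int _ (g := fun x => f x ^+ 2 +
      (2 * t * (f x * g x) + t ^+ 2 * g x ^+ 2))); last by move=> x; ring.
    by rewrite IntD//; [rewrite IntD// !IntZ// addrA|exact: L1D].
  by apply: Int_ge0 => x; rewrite sqr_ge0.
have B0 : 0 <= B by apply: Int_ge0 => x; rewrite sqr_ge0.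
have [B_eq0|Bn0] := eqVneq B 0.
  rewrite B_eq0 mulr0; have [->|C0] := eqVneq C 0; first by rewrite expr0n.
  (* With B = 0 the quadratic is affine in [t]; this [t] would give it the value -1. *)
  have := H (- (A + 1) / (2 * C)).
  rewrite B_eq0 mulr0 addr0 (_ : 2 * _ * C = - (A + 1)); last by field.
  by rewrite opprD addrA subrr add0r leNgt oppr_lt0 ltr01.
have Bp : 0 < B by rewrite lt_neqAle eq_sym Bn0.
have := H (- C / B).
rewrite (_ : A + 2 * _ * C + _ = A - C ^+ 2 / B); last by field.
by rewrite subr_ge0 ler_pdivrMr.
Qed.

(** Cauchy-Schwarz; the rate in the hypothesis is the one delivered by [L2_complete]. *)
Lemma Int_L2_cvg (a b : T -> R) (u : nat -> T -> R) : L2 mu a -> L2 mu b ->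
  (forall k, L2 mu (u k)) ->
  (forall k, \int[mu]_x ((u k x - b x) ^+ 2) <= 4 * 2^-1 ^+ k) ->
  \int[mu]_x (a x * u k x) @[k --> \oo] --> \int[mu]_x (a x * b x).
Proof.
move=> a2 b2 u2 ub; apply/subr_cvg0.
pose A := \int[mu]_x (a x ^+ 2).
have A0 : 0 <= A by apply: Int_ge0 => x; exact: sqr_ge0.
have ineq k : `|\int[mu]_x (a x * u k x) - \int[mu]_x (a x * b x)| <=
    Num.sqrt (A * (4 * 2^-1 ^+ k)).
  rewrite -sqrtr_sqr ler_wsqrtr// -IntB; [|exact: L2M|exact: L2M].
  rewrite (eq_Int _ (g := fun x => a x * (u k x - b x))); last by move=> x; ring.
  apply: le_trans (Int_CS a2 (L2B (u2 k) b2)) _.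
  by rewrite ler_wpM2l.
apply/norm_cvg0P; apply: (@squeeze_cvgr _ _ _ _ (cst 0) (fun k => Num.sqrt (A * (4 * 2^-1 ^+ k)))).
- by apply: nearW => k; rewrite normr_ge0 /=; exact: ineq.
- exact: cvg_cst.
- rewrite -[0](sqrtr0 R).
  apply: cvg_comp; last exact: sqrt_continuous.
  rewrite -[0](mulr0 A); apply: cvgMr; rewrite -[0](mulr0 4); apply: cvgMr.
  by apply: cvg_expr; rewrite ger0_norm ?invr_ge0// invf_lt1// ltr1n.
Qed.

End cauchy_schwarz.

Section hartley.
Variables (R : realType) (n : nat).
Local Notation lam := (lebesgue_rV R n).
Implicit Types (f g : 'rV[R]_n -> R) (p x y : 'rV[R]_n) (a u v : R).

Definition cas u : R := cos u + sin u.

Lemma casN u : cas (- u) = cos u - sin u.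
Proof. by rewrite /cas cosN sinN. Qed.

Lemma cas_mul u v : cas u * cas v = cos (u - v) + sin (u + v).
Proof. by rewrite /cas cosB sinD; ring. Qed.

Lemma cas_le u : `|cas u| <= 2.
Proof.
apply: le_trans (ler_normD _ _) _; rewrite (_ : 2 = 1 + 1)//.
by apply: lerD; [exact: cos_max|exact: sin_max].
Qed.

Lemma measurable_cas : measurable_fun setT cas.
Proof. by apply: measurable_funD; [exact: measurable_cos|exact: measurable_sin]. Qed.

Lemma measurable_cas_dotp (c : R) :
  measurable_fun setT (fun z : 'rV[R]_n * 'rV[R]_n => cas (c * dotp z.1 z.2)).
Proof.
apply: measurableT_comp; first exact: measurable_cas.
apply: measurable_funM => //.
by apply: measurable_dotp; [exact: measurable_fst|exact: measurable_snd].
Qed.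

Lemma measurable_cas_dotp1 x : measurable_fun setT (fun p => cas (dotp p x)).
Proof.
apply: measurableT_comp; first exact: measurable_cas.
by apply: measurable_dotp => //; exact: measurable_id.
Qed.

Definition hartley f p : R := \int[lam]_x (cas (dotp p x) * f x).

Lemma L1_cas f p : L1 lam f -> L1 lam (fun x => cas (dotp p x) * f x).
Proof.
move=> i1; apply: (@L1_bM _ _ _ _ 2) => //; last by move=> x; exact: cas_le.
by under eq_fun do rewrite dotpC; exact: measurable_cas_dotp1.
Qed.

Lemma hartley_le f p : L1 lam f -> `|hartley f p| <= 2 * \int[lam]_x `|f x|.
Proof.
move=> i1; rewrite -IntZ; last exact: L1_norm.
apply: Int_norm_le; [exact: L1_cas|by apply: L1Z; exact: L1_norm|].
by move=> x; rewrite normrM ler_wpM2r// cas_le.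
Qed.

Lemma measurable_hartley f : measurable_fun setT f ->
  measurable_fun setT (hartley f).
Proof.
move=> mf; apply: (measurable_Int lam (F := fun z => cas (dotp z.1 z.2) * f z.2)).
apply: measurable_funM; last exact: measurableT_comp mf measurable_snd.
by have := measurable_cas_dotp 1; under eq_fun do rewrite mul1r.
Qed.

Lemma cas_swap f g : L1 lam f -> L1 lam g ->
  \int[lam]_x (f x * \int[lam]_y (cas (dotp x y) * g y)) =
  \int[lam]_y (g y * \int[lam]_x (cas (dotp x y) * f x)).
Proof.
move=> f1 g1; have mc : measurable_fun setT
  (fun z : 'rV[R]_n * 'rV[R]_n => cas (dotp z.1 z.2)).
  by have := measurable_cas_dotp 1; under eq_fun do rewrite mul1r.
by have [] := Int_swap (c := fun x y => cas (dotp x y)) f1 g1 mc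
  (fun x y => cas_le (dotp x y)).
Qed.

Lemma hartley_mul f g : L1 lam f -> L1 lam g ->
  \int[lam]_x (hartley f x * g x) = \int[lam]_x (f x * hartley g x).
Proof.
move=> f1 g1; rewrite [RHS]cas_swap//; apply: eq_Int => x.
rewrite mulrC /hartley; congr (_ * _); apply: eq_Int => y.
by rewrite dotpC.
Qed.

(* The sine part vanishes by oddness, and the cosine part is the Fourier
   transform of a Gaussian. *)
Lemma Int_gaussV_cas2 a x y : 0 < a ->
  \int[lam]_p (cas (dotp p y) * (cas (dotp p x) * gaussV a p)) =
  Num.sqrt (pi / a) ^+ n * gaussV (4 * a)^-1 (x - y).
Proof.
move=> a0; transitivity (\int[lam]_p (gaussV a p * cos (dotp p (x - y)) +
   gaussV a p * sin (dotp p (x + y)))).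
  apply: eq_Int => p; rewrite mulrA [cas _ * cas _]mulrC cas_mul -dotpBr -dotpDr.
  by ring.
rewrite IntD; [|exact: L1_gaussV_cos|exact: L1_gaussV_sin].
by rewrite Int_gaussV_sin// addr0 Int_gaussV_cos.
Qed.

(** The masses of a Gaussian and of its dual multiply to a constant that does not depend on [a]:
    this is the Plancherel constant. *)
Lemma gauss_const a : 0 < a ->
  Num.sqrt (pi / a) ^+ n * Num.sqrt (pi / (4 * a)^-1) ^+ n = (2 * pi) ^+ n.
Proof.
move=> a0; rewrite -exprMn -sqrtrM ?divr_ge0 ?pi_ge0 ?ltW//.
rewrite (_ : pi / a * _ = (2 * pi) ^+ 2); last first.
  by rewrite invrK; field; exact: lt0r_neq0.
by rewrite sqrtr_sqr ger0_norm// mulr_ge0 ?pi_ge0.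
Qed.

Lemma Int_gauss_conv a (h : 'rV[R]_n -> R) : 0 < a -> L1 lam h ->
  L1 lam (fun x => \int[lam]_y (gaussV a (x - y) * h y)) /\
  \int[lam]_x \int[lam]_y (gaussV a (x - y) * h y) =
  Num.sqrt (pi / a) ^+ n * \int[lam]_y h y.
Proof.
move=> a0 ih.
pose F (z : 'rV[R]_n * 'rV[R]_n) := gaussV a (z.2 - z.1) * h z.1.
have mg : measurable_fun setT (fun z : 'rV[R]_n * 'rV[R]_n => gaussV a (z.2 - z.1)).
  apply: measurableT_comp; first exact: measurable_gaussV.
  apply/measurable_fun_rVP => i; under eq_fun do rewrite !mxE.
  apply: measurable_funD; last apply: measurable_funN.
    exact: measurableT_comp (measurable_rV_coord i) measurable_snd.
  exact: measurableT_comp (measurable_rV_coord i) measurable_fst.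
have mF : measurable_fun setT F.
  apply: measurable_funM => //.
  exact: measurableT_comp (L1_measurable ih) measurable_fst.
have igs y : L1 lam (fun x => gaussV a (x - y)).
  by apply: eq_L1 _ (L1_rV_shift (- y) (L1_gaussV n a0)) => x; rewrite addrC.
have Igs y : \int[lam]_x gaussV a (x - y) = Num.sqrt (pi / a) ^+ n.
  rewrite -(Int_gaussV n a0) -(Int_rV_shift (- y) (L1_gaussV n a0)).
  by apply: eq_Int => x; rewrite addrC.
have i1 y : L1 lam (fun x => F (y, x)).
  by apply: eq_L1 _ (L1Z (h y) (igs y)) => x; rewrite mulrC.
have i2 x : L1 lam (fun y => F (y, x)).
  apply: (@L1_bM _ _ _ _ 1) => //.
    exact: measurableT_comp mg (measurable_pair2 x).
  by move=> y; rewrite ger0_norm ?gaussV_ge0 ?gaussV_le1.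
have iF : L1 (lam \x lam)%E F.
  apply: (L1_prod (m1 := lam) (m2 := lam)
    (G := fun y => Num.sqrt (pi / a) ^+ n * `|h y|)) => //.
    by apply: L1Z; exact: L1_norm.
  move=> y; rewrite -(Igs y) mulrC -IntZ//.
  rewrite le_eqVlt; apply/orP; left; apply/eqP; apply: eq_Int => x.
  by rewrite /F /= normrM (ger0_norm (gaussV_ge0 _ _)) mulrC.
have [_ e1] := Fubini1 iF i1; have [j2 e2] := Fubini2 iF i2.
split; first exact: j2.
transitivity (\int[lam]_y \int[lam]_x F (y, x)); first by rewrite -e1 e2.
rewrite -IntZ//; apply: eq_Int => y.
by rewrite -(Igs y) mulrC -IntZ//; apply: eq_Int => x; rewrite mulrC.
Qed.

Lemma gaussV_cvg1 x : gaussV k.+1%:R^-1 x @[k --> \oo] --> (1 : R).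
Proof.
rewrite [X in _ --> X](_ : 1 = expR (- (0 * dotp x x))); last first.
  by rewrite mul0r oppr0 expR0.
apply: cvg_expR_comp; apply: cvgN; apply: cvgMl; exact: cvg_harmonic.
Qed.

(** One inequality of Plancherel's theorem. After regularization by a wide Gaussian, Fubini turns
    the square norm into \int\int f(x) G(x - y) f(y) with an explicit Gaussian G; its total mass
    bounds the form by (2 pi)^n times the square norm of [f], uniformly in [k]. Fatou's lemma
    removes the regularization. *)
Lemma hartley_L2 f : L1 lam f -> L2 lam f ->
  L2 lam (hartley f) /\
  \int[lam]_p (hartley f p ^+ 2) <= (2 * pi) ^+ n * \int[lam]_x (f x ^+ 2).
Proof.
move=> f1 f2; have mH := measurable_hartley (L1_measurable f1).
have mc : measurable_fun setT (fun z : 'rV[R]_n * 'rV[R]_n => cas (dotp z.1 z.2)).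
  by have := measurable_cas_dotp 1; under eq_fun do rewrite mul1r.
pose e k : R := k.+1%:R^-1.
have e0 k : 0 < e k by rewrite invr_gt0.
pose u k p := gaussV (e k) p * hartley f p ^+ 2.
have ie k : 0 < (4 * e k)^-1 by rewrite invr_gt0 mulr_gt0.
have iH k : L1 lam (fun p => gaussV (e k) p * hartley f p).
  under eq_fun do rewrite mulrC.
  apply: (@L1_bM _ _ _ _ (2 * \int[lam]_x `|f x|)) => //; last exact: L1_gaussV.
  by move=> p; exact: hartley_le.
have iu k : L1 lam (u k).
  apply: (@eq_L1 _ _ _ _ (fun p => hartley f p * (gaussV (e k) p * hartley f p))).
    by move=> p; rewrite /u; ring.
  apply: (@L1_bM _ _ _ _ (2 * \int[lam]_x `|f x|)) => //.
  by move=> p; exact: hartley_le.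
have uk k : \int[lam]_p u k p <= (2 * pi) ^+ n * \int[lam]_x (f x ^+ 2).
  have -> : \int[lam]_p u k p = \int[lam]_x (f x *
     \int[lam]_p (cas (dotp p x) * (gaussV (e k) p * hartley f p))).
    rewrite -cas_swap//; apply: eq_Int => p; rewrite /u /hartley; ring.
  pose K := Num.sqrt (pi / e k) ^+ n.
  have K0 : 0 <= K by rewrite exprn_ge0// sqrtr_ge0.
  have inner x : \int[lam]_p (cas (dotp p x) * (gaussV (e k) p * hartley f p)) =
      K * \int[lam]_y (gaussV (4 * e k)^-1 (x - y) * f y).
    have ia : L1 lam (fun p => cas (dotp p x) * gaussV (e k) p).
      apply: (@L1_bM _ _ _ _ 2); last exact: L1_gaussV.
        exact: measurable_cas_dotp1.
      by move=> p; exact: cas_le.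
    have ig : L1 lam (fun y => gaussV (4 * e k)^-1 (x - y) * f y).
      apply: (@L1_bM _ _ _ _ 1) => //; last first.
        by move=> y; rewrite ger0_norm ?gaussV_ge0 ?gaussV_le1.
      apply: measurableT_comp; first exact: measurable_gaussV.
      have := measurable_rV_affine x (-1).
      by under eq_fun do rewrite scaleN1r.
    transitivity (\int[lam]_p (cas (dotp p x) * gaussV (e k) p *
       \int[lam]_y (cas (dotp p y) * f y))).
      by apply: eq_Int => p; rewrite /hartley mulrA.
    rewrite cas_swap// -IntZ//; apply: eq_Int => y.
    by rewrite Int_gaussV_cas2// -/K mulrC mulrA.
  under eq_Int do rewrite inner.
  have [c1 c2] := Int_gauss_conv (ie k) (L2_sqr f2).
  have igf x : L1 lam (fun y => gaussV (4 * e k)^-1 (x - y)).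
    apply: eq_L1 _ (L1_rV_affine x (normrN1 R) (L1_gaussV n (ie k))) => y.
    by rewrite scaleN1r.
  have Igf x : \int[lam]_y gaussV (4 * e k)^-1 (x - y) =
      Num.sqrt (pi / (4 * e k)^-1) ^+ n.
    rewrite -(Int_gaussV n (ie k)).
    rewrite -(Int_rV_affine x (normrN1 R) (L1_gaussV n (ie k))).
    by apply: eq_Int => y; rewrite scaleN1r.
  set K' := Num.sqrt (pi / (4 * e k)^-1) ^+ n in c2 Igf.
  have mgf x : measurable_fun setT (fun y : 'rV[R]_n => gaussV (4 * e k)^-1 (x - y)).
    exact: L1_measurable (igf x).
  have gb x y : `|gaussV (4 * e k)^-1 (x - y : 'rV[R]_n)| <= 1.
    by rewrite ger0_norm ?gaussV_ge0 ?gaussV_le1.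
  have ig x : L1 lam (fun y => gaussV (4 * e k)^-1 (x - y) * f y).
    exact: (@L1_bM _ _ _ _ 1).
  have ig2 x : L1 lam (fun y => gaussV (4 * e k)^-1 (x - y) * f y ^+ 2).
    by apply: (@L1_bM _ _ _ _ 1) => //; exact: L2_sqr.
  (* From f(x) f(y) <= (f(x)^2 + f(y)^2) / 2 under the Gaussian integral over [y]; the two halves
     have the same integral. *)
  pose Q x := 2^-1 * (K * K') * f x ^+ 2 +
    2^-1 * K * \int[lam]_y (gaussV (4 * e k)^-1 (x - y) * f y ^+ 2).
  have iQ : L1 lam Q.
    by apply: L1D; [apply: L1Z; exact: L2_sqr|exact: L1Z].
  have -> : (2 * pi) ^+ n * \int[lam]_x (f x ^+ 2) = \int[lam]_x Q x.
    rewrite IntD; [|by apply: L1Z; exact: L2_sqr|exact: L1Z].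
    rewrite IntZ; last exact: L2_sqr.
    by rewrite IntZ// c2 -(gauss_const (e0 k)) -/K -/K'; field.
  apply: Int_le => //.
    have [_ j _] := Int_swap (c := fun p y => cas (dotp p y)) (iH k) f1 mc
      (fun p y => cas_le (dotp p y)).
    by apply: eq_L1 _ j => x; rewrite inner.
  move=> x; have fx : f x * (K * \int[lam]_y (gaussV (4 * e k)^-1 (x - y) * f y)) =
      \int[lam]_y (K * f x * (gaussV (4 * e k)^-1 (x - y) * f y)).
    by rewrite IntZ//; ring.
  rewrite fx /Q -(Igf x).
  have -> : 2^-1 * (K * \int[lam]_y gaussV (4 * e k)^-1 (x - y)) * f x ^+ 2 =
      \int[lam]_y (2^-1 * K * f x ^+ 2 * gaussV (4 * e k)^-1 (x - y)).
    by rewrite IntZ//; ring.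
  rewrite -IntZ// -IntD; [|exact: L1Z|exact: L1Z].
  apply: Int_le; [exact: L1Z|by apply: L1D; exact: L1Z|move=> y].
  have := gaussV_ge0 (4 * e k)^-1 (x - y); set G := gaussV _ _ => G0.
  rewrite -subr_ge0.
  have -> : 2^-1 * K * f x ^+ 2 * G + 2^-1 * K * (G * f y ^+ 2) -
     K * f x * (G * f y) = 2^-1 * (K * G) * (f x - f y) ^+ 2 by field.
  rewrite mulr_ge0 ?sqr_ge0//; apply: mulr_ge0; first by rewrite invr_ge0.
  exact: mulr_ge0.
have [h1 h2] : L1 lam (fun p => hartley f p ^+ 2) /\
    \int[lam]_p (hartley f p ^+ 2) <= (2 * pi) ^+ n * \int[lam]_x (f x ^+ 2).
  apply: (@Int_fatou _ _ _ lam u).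
  - by move=> k; exact: L1_measurable (iu k).
  - exact: measurable_funX.
  - by move=> k p; rewrite mulr_ge0 ?sqr_ge0 ?gaussV_ge0.
  - move=> p; rewrite -[X in _ --> X]mul1r; apply: cvgMl.
    exact: gaussV_cvg1.
  - by move=> k; rewrite IntE// lee_fin.
by split.
Qed.

(** Completing the square: the product is a multiple of a Gaussian centred between 0 and [y]. The
    disjunct lets the caller discharge the nonvanishing of the denominator under a binder. *)
Lemma gaussV_shift_mul a y x : gaussV 1 x * gaussV a (x - y) =
  expR (- (a * dotp y y - a ^+ 2 / (1 + a) * dotp y y)) *
  gaussV (1 + a) (x - (a / (1 + a)) *: y) \/ 1 + a = 0.
Proof.
have [->|a0] := eqVneq (1 + a) 0; [by right|left].
rewrite /gaussV -!expRD; congr expR.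
rewrite !dotpBl !dotpBr !dotpZr !(dotpC (_ *: _)) !dotpZr (dotpC y x).
by field.
Qed.

Lemma L2_gaussV_shift a y : 0 < a ->
  L1 lam (fun x => gaussV a (x - y)) /\ L2 lam (fun x => gaussV a (x - y)).
Proof.
move=> a0.
have i1 b : 0 < b -> L1 lam (fun x => gaussV b (x - y)).
  by move=> b0; apply: eq_L1 _ (L1_rV_shift (- y) (L1_gaussV n b0)) => x; rewrite addrC.
split; first exact: i1.
split; first exact: L1_measurable (i1 _ a0).
by apply: eq_L1 _ (i1 (a + a) (addr_gt0 a0 a0)) => x; rewrite gaussVD expr2.
Qed.

(** Multiplication by a fixed Gaussian makes [psi] integrable, and by completing the square it maps
    the test family into multiples of itself; [gaussV_total] then applies. *)
Lemma gaussV_total_L2 (psi : 'rV[R]_n -> R) : L2 lam psi ->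
  (forall a y, 0 < a -> \int[lam]_x (psi x * gaussV a (x - y)) = 0) ->
  {ae lam, forall x, psi x = 0}.
Proof.
move=> psi2 h.
have i1 a y : 0 < a -> L1 lam (fun x => psi x * gaussV a (x - y)).
  by move=> a0; apply: L2M => //; case: (L2_gaussV_shift y a0).
have : {ae lam, forall x, psi x * gaussV 1 x = 0}.
  apply: gaussV_total => [|a y a0].
    by apply: eq_L1 _ (i1 1 0 ltr01) => x; rewrite subr0.
  have a1 : 0 < 1 + a by rewrite addr_gt0.
  under eq_Int => x.
    case: (gaussV_shift_mul a y x) => [e|/eqP]; last by rewrite (gt_eqF a1).
    rewrite -mulrA e mulrCA; over.
  by rewrite IntZ ?h ?mulr0//; exact: i1.
apply: filterS => x /eqP; rewrite mulf_eq0 => /orP[/eqP//|].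
by rewrite gt_eqF// expR_gt0.
Qed.

(** The Hartley transform on L^2, where the integral in [hartley] may diverge: [g] is characterized
    by the symmetry [hartley_mul] against integrable and square integrable functions. It is
    determined up to null sets only. *)
Definition is_hartley f g : Prop := [/\ L2 lam f, L2 lam g &
  forall psi, L1 lam psi -> L2 lam psi ->
    \int[lam]_x (hartley psi x * f x) = \int[lam]_x (psi x * g x)].

Lemma is_hartley_L1 f : L1 lam f -> L2 lam f -> is_hartley f (hartley f).
Proof.
move=> f1 f2; split=> //; first by case: (hartley_L2 f1 f2).
by move=> psi p1 _; exact: hartley_mul.
Qed.

Lemma is_hartley_uniq f g g' : is_hartley f g -> is_hartley f g' ->
  {ae lam, forall x, g x = g' x}.
Proof.
move=> [_ g2 h] [_ g2' h'].
have : {ae lam, forall x, g x - g' x = 0}.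
  apply: gaussV_total_L2 => [|a y a0]; first exact: L2B.
  have [p1 p2] := L2_gaussV_shift y a0.
  rewrite (eq_Int _ (g := fun x => gaussV a (x - y) * g x - gaussV a (x - y) * g' x)).
    by rewrite IntB; [|exact: L2M|exact: L2M]; rewrite -h// -h'// subrr.
  by move=> x; ring.
by apply: filterS => x /eqP; rewrite subr_eq0 => /eqP.
Qed.

Lemma L2_approx f : L2 lam f -> forall e : R, 0 < e ->
  exists v : 'rV[R]_n -> R, [/\ L1 lam v, L2 lam v & \int[lam]_x ((v x - f x) ^+ 2) <= e].
Proof.
move=> f2 e e0; have mf := L2_measurable f2.
pose v k x := gaussV k.+1%:R^-1 x * f x.
have k0 (k : nat) : 0 < k.+1%:R^-1 :> R by rewrite invr_gt0.
have v2 k : L2 lam (v k).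
  apply: (@L2_bM _ _ _ _ 1) => //; first exact: measurable_gaussV.
  by move=> x; rewrite ger0_norm ?gaussV_ge0 ?gaussV_le1.
have v1 k : L1 lam (v k).
  apply: L2M => //; have [_] := L2_gaussV_shift 0 (k0 k).
  by under eq_fun do rewrite subr0.
have lim : \int[lam]_x ((v k x - f x) ^+ 2) @[k --> \oo] --> \int[lam]_x (0 : R).
  apply: (@Int_dct _ _ _ lam _ _ (fun x => f x ^+ 2)) => //.
  - move=> k; apply: measurable_funX; apply: measurable_funB => //.
    exact: L2_measurable (v2 k).
  - apply: nearW => x; rewrite -[0](expr0n R 2); apply: cvg_sqr_comp.
    rewrite -[0](subrr (f x)); apply: cvgB; last exact: cvg_cst.
    rewrite -[X in _ --> X]mul1r; apply: cvgMl; exact: gaussV_cvg1.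
  - exact: L2_sqr.
  - move=> k x; rewrite ger0_norm ?sqr_ge0// /v.
    rewrite -{2}[f x]mul1r -mulrBl exprMn ler_piMl ?sqr_ge0//.
    rewrite -sqrrN opprB; have g0 := gaussV_ge0 k.+1%:R^-1 x.
    have g1 := gaussV_le1 x (k0 k).
    by rewrite exprn_ile1// ?subr_ge0// lerBlDr lerDl.
move: lim; rewrite Int0 => /cvgr0_norm_lt/(_ e e0)[k _ /(_ k (leqnn k)) /= h].
exists (v k); split=> //; apply: ltW; exact: le_lt_trans (ler_norm _) h.
Qed.

(** Extension by continuity: integrable approximants of [f] have, by [hartley_L2], transforms that
    form a Cauchy sequence. The approximants are part of the conclusion because [is_hartley_sym]
    passes to the limit along them. *)
Lemma is_hartley_ex f : L2 lam f -> exists g (v : nat -> 'rV[R]_n -> R),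
  [/\ is_hartley f g,
      forall k, L1 lam (v k) /\ L2 lam (v k),
      forall k, \int[lam]_x ((v k x - f x) ^+ 2) <= 4 * 2^-1 ^+ k &
      forall k, \int[lam]_x ((hartley (v k) x - g x) ^+ 2) <= 4 * 2^-1 ^+ k].
Proof.
move=> f2.
pose C : R := (2 * pi) ^+ n.
have C0 : 0 < C by rewrite exprn_gt0// mulr_gt0// pi_gt0.
(* Consecutive approximants differ by at most 4 [dl k] in square norm and transforms cost a factor
   [C]; C / (C + 1) <= 1 then leaves the 4^{-k} that [L2_complete] demands. *)
pose dl k : R := 4^-1 ^+ k / (4 * (C + 1)).
have dl0 k : 0 < dl k.
  by rewrite divr_gt0 ?exprn_gt0 ?invr_gt0// mulr_gt0// addr_gt0.
have /choice[v hv] k : exists v : 'rV[R]_n -> R, [/\ L1 lam v, L2 lam v &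
    \int[lam]_x ((v x - f x) ^+ 2) <= dl k] by exact: L2_approx.
have v1 k : L1 lam (v k) by case: (hv k).
have v2 k : L2 lam (v k) by case: (hv k).
have vf k : \int[lam]_x ((v k x - f x) ^+ 2) <= dl k by case: (hv k).
have le4 k : 4^-1 ^+ k <= 2^-1 ^+ k :> R.
  by rewrite lerXn2r ?nnegrE// lef_pV2 ?posrE// ler_nat.
have dlS k : dl k.+1 <= dl k.
  rewrite /dl ler_pM2r ?invr_gt0 ?mulr_gt0 ?addr_gt0// exprS.
  by rewrite ler_piMl ?exprn_ge0// invf_le1// ler1n.
have hvB k : hartley (v k.+1) = fun x => hartley (fun y => v k.+1 y - v k y) x + hartley (v k) x.
  apply/funext => x; rewrite /hartley -IntD; [|exact: L1_cas (L1B _ _)|exact: L1_cas].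
  by apply: eq_Int => y; ring.
have u2 k : L2 lam (hartley (v k)) by case: (hartley_L2 (v1 k) (v2 k)).
have ub k : \int[lam]_x ((hartley (v k.+1) x - hartley (v k) x) ^+ 2) <= 4^-1 ^+ k.
  have [_ h] := hartley_L2 (L1B (v1 k.+1) (v1 k)) (L2B (v2 k.+1) (v2 k)).
  rewrite hvB; under eq_Int do rewrite addrK.
  apply: le_trans h _.
  have h2 : \int[lam]_x ((v k.+1 x - v k x) ^+ 2) <= 4 * dl k.
    have i1 := L2_sqr (L2B (v2 k.+1) f2); have i2 := L2_sqr (L2B (v2 k) f2).
    apply: (@le_trans _ _ (\int[lam]_x (2 * (v k.+1 x - f x) ^+ 2 +
        2 * (v k x - f x) ^+ 2))).
      apply: Int_le; [exact: L2_sqr (L2B _ _)|by apply: L1D; exact: L1Z|move=> x].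
      have := sqr_ge0 (v k.+1 x - f x + (v k x - f x)); nra.
    rewrite IntD; [|exact: L1Z|exact: L1Z]; rewrite !IntZ//.
    have := vf k; have := vf k.+1; have := dlS k; lra.
  apply: le_trans (ler_wpM2l (ltW C0) h2) _.
  have -> : C * (4 * dl k) = 4^-1 ^+ k * (C / (C + 1)).
    rewrite /dl; set q := 4^-1 ^+ k; have C1 : C + 1 != 0 by rewrite gt_eqF// addr_gt0.
    by field.
  by rewrite ler_piMr ?exprn_ge0// ler_pdivrMr ?addr_gt0// mul1r lerDl.
have [g g2 hg] := L2_complete u2 ub.
have vf' k : \int[lam]_x ((v k x - f x) ^+ 2) <= 4 * 2^-1 ^+ k.
  apply: le_trans (vf k) _; apply: (@le_trans _ _ (4^-1 ^+ k)).
    rewrite /dl ler_piMr ?exprn_ge0// invf_le1 ?mulr_gt0 ?addr_gt0//.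
    by have := C0; lra.
  by apply: le_trans (le4 k) _; rewrite ler_peMl ?exprn_ge0// ler1n.
exists g, v; split=> //; split=> // psi p1 p2.
have [hp2 _] := hartley_L2 p1 p2.
have c1 := Int_L2_cvg hp2 f2 v2 vf'.
have c2 := Int_L2_cvg p2 g2 u2 hg.
move: c1; rewrite (funext (fun k => hartley_mul p1 (v1 k))) => c1.
exact: (cvg_unique _ c1 c2).
Qed.

(** Duality for test functions that are merely square integrable: the identity holds for the
    approximants of f', and the limit of their transforms agrees with g' almost everywhere. *)
Lemma is_hartley_sym f g f' g' : is_hartley f g -> is_hartley f' g' ->
  \int[lam]_x (f' x * g x) = \int[lam]_x (g' x * f x).
Proof.
move=> [f2 g2 h] H'; have [f2' g2' _] := H'.
have [g'' [v [H'' vv vf vg]]] := is_hartley_ex f2'.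
have [_ g2'' _] := H''.
have hv2 k : L2 lam (hartley (v k)) by have [a b] := vv k; case: (hartley_L2 a b).
have c1 := Int_L2_cvg g2 f2' (fun k => (vv k).2) vf.
have c2 := Int_L2_cvg f2 g2'' hv2 vg.
have -> : \int[lam]_x (g' x * f x) = \int[lam]_x (g'' x * f x).
  apply: ae_eq_Int.
  - exact: measurable_funM (L2_measurable g2') (L2_measurable f2).
  - exact: measurable_funM (L2_measurable g2'') (L2_measurable f2).
  - by apply: filterS (is_hartley_uniq H' H'') => x ->.
under eq_Int do rewrite mulrC; under [RHS]eq_Int do rewrite mulrC.
have e : (fun k => \int[lam]_x (g x * v k x)) =
    fun k => \int[lam]_x (f x * hartley (v k) x).
  apply/funext => k; under eq_Int do rewrite mulrC.
  under [RHS]eq_Int do rewrite mulrC.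
  by have [a b] := vv k; rewrite h.
move: c1; rewrite e => c1; exact: (cvg_unique _ c1 c2).
Qed.

(** After recentring at [y], the sine part is odd and disappears; the translation survives as the
    factor [cas (dotp p y)]. *)
Lemma hartley_gaussV a y p : 0 < a ->
  hartley (fun x => gaussV a (x - y)) p =
  Num.sqrt (pi / a) ^+ n * (cas (dotp p y) * gaussV (4 * a)^-1 p).
Proof.
move=> a0; rewrite /hartley.
have [g1 _] := L2_gaussV_shift y a0.
rewrite -(Int_rV_shift y (L1_cas p g1)).
transitivity (\int[lam]_x (cas (dotp p y) * (gaussV a x * cos (dotp x p)) +
  cas (- dotp p y) * (gaussV a x * sin (dotp x p)))).
  apply: eq_Int => x; rewrite addrC addrK dotpDr (dotpC p x).
  by rewrite casN /cas cosD sinD; ring.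
rewrite IntD; [|by apply: L1Z; exact: L1_gaussV_cos|by apply: L1Z; exact: L1_gaussV_sin].
rewrite !IntZ; [|exact: L1_gaussV_sin|exact: L1_gaussV_cos].
by rewrite Int_gaussV_sin// mulr0 addr0 Int_gaussV_cos// mulrCA.
Qed.

Lemma hartley_hartley_gaussV a y p : 0 < a ->
  hartley (hartley (fun x => gaussV a (x - y))) p =
  (2 * pi) ^+ n * gaussV a (p - y).
Proof.
move=> a0; rewrite (funext (fun p => hartley_gaussV y p a0)) /hartley.
have a0' : 0 < (4 * a)^-1 by rewrite invr_gt0 mulr_gt0.
transitivity (\int[lam]_x (Num.sqrt (pi / a) ^+ n *
    (cas (dotp x y) * (cas (dotp x p) * gaussV (4 * a)^-1 x)))).
  by apply: eq_Int => x; rewrite (dotpC p); ring.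
rewrite IntZ; last first.
  apply: (@L1_bM _ _ _ _ 2); [exact: measurable_cas_dotp1|by move=> x; exact: cas_le|].
  apply: (@L1_bM _ _ _ _ 2); [exact: measurable_cas_dotp1|by move=> x; exact: cas_le|].
  exact: L1_gaussV.
have e : (4 * (4 * a)^-1)^-1 = a by field; exact: lt0r_neq0.
by rewrite (Int_gaussV_cas2 _ _ a0') mulrA (gauss_const a0) e.
Qed.

(** On shifted Gaussians the double transform is explicit, by [hartley_hartley_gaussV]; duality and
    totality carry the inversion over to L^2. *)
Lemma is_hartley_inv f g : is_hartley f g ->
  is_hartley g (fun x => (2 * pi) ^+ n * f x).
Proof.
move=> [f2 g2 h].
have [g' [_ [H _ _ _]]] := is_hartley_ex g2; have [_ g2' h'] := H.
have cf2 : L2 lam (fun x => (2 * pi) ^+ n * f x) by exact: L2Z.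
have e : {ae lam, forall x, g' x - (2 * pi) ^+ n * f x = 0}.
  apply: gaussV_total_L2 => [|a y a0]; first exact: L2B.
  have [p1 p2] := L2_gaussV_shift y a0.
  rewrite (eq_Int _ (g := fun x => gaussV a (x - y) * g' x -
     (2 * pi) ^+ n * (gaussV a (x - y) * f x))); last by move=> x; ring.
  rewrite IntB; [|exact: L2M|by apply: L1Z; exact: L2M].
  rewrite -h'// IntZ; last exact: L2M.
  have hp1 : L1 lam (hartley (fun x => gaussV a (x - y))).
    rewrite (funext (fun p => hartley_gaussV y p a0)); apply: L1Z.
    apply: (@L1_bM _ _ _ _ 2); [exact: measurable_cas_dotp1|by move=> x; exact: cas_le|].
    by apply: L1_gaussV; rewrite invr_gt0 mulr_gt0.
  have [hp2 _] := hartley_L2 p1 p2.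
  rewrite -h// -IntZ; last exact: L2M.
  apply/eqP; rewrite subr_eq0; apply/eqP; apply: eq_Int => x.
  by rewrite hartley_hartley_gaussV//; ring.
split=> // psi q1 q2; rewrite h'//; apply: ae_eq_Int.
- exact: measurable_funM (L2_measurable q2) (L2_measurable g2').
- exact: measurable_funM (L2_measurable q2) (L2_measurable cf2).
- by apply: filterS e => x /eqP; rewrite subr_eq0 => /eqP ->.
Qed.

(** Plancherel's identity: [is_hartley_sym] between the pair (f, g) and the inverse pair (g, (2
    pi)^n f). *)
Lemma is_hartley_norm f g : is_hartley f g ->
  \int[lam]_x (g x ^+ 2) = (2 * pi) ^+ n * \int[lam]_x (f x ^+ 2).
Proof.
move=> H; have [f2 _ _] := H.
have := is_hartley_sym H (is_hartley_inv H).
under eq_Int do rewrite -expr2; move=> ->.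
by rewrite -IntZ; [apply: eq_Int => x; rewrite expr2 mulrA|exact: L2_sqr].
Qed.

End hartley.

(** * Differentiation under the integral sign *)

Section quadratic_remainder.
Variables (R : realType) (V : normedModType R).

Lemma quadratic_is_diff (f : V -> R) (L : {linear V -> R}) (z : V) (C : R) :
  continuous L ->
  (forall h, `|h| <= 1 -> `|f (h + z) - f z - L h| <= C * `|h| ^+ 2) ->
  differentiable f z /\ 'd f z = L :> (V -> R).
Proof.
move=> cL H.
have e : f \o shift z = cst (f z) + L +o_ 0 id.
  apply/eqaddoP => _/posnumP[e].
  (* Within this radius C |h|^2 <= e |h|; adding 1 to [|C|] keeps the denominator positive. *)
  have d0 : 0 < Num.min 1 (e%:num / (`|C| + 1)).
    by rewrite lt_min ltr01/= divr_gt0// ltr_pwDr.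
  near=> h.
  have : `|h| <= Num.min 1 (e%:num / (`|C| + 1)) by near: h; exact: nbhs0_le.
  rewrite le_min => /andP[h1 h2].
  rewrite /= opprD -![(_ + _ : _ -> _) _]/(_ + _) -![(- _ : _ -> _) _]/(- _) /=.
  rewrite /cst /= addrA; apply: le_trans (H _ h1) _.
  rewrite expr2 mulrA ler_wpM2r//.
  apply: (@le_trans _ _ ((`|C| + 1) * `|h|)).
    by rewrite ler_wpM2r// (le_trans (ler_norm C))// lerDl.
  by rewrite mulrC -ler_pdivlMr// ltr_pwDr.
have d := diff_unique cL e.
split; last exact: d.
by apply/diff_locallyP; rewrite d.
Unshelve. all: by end_near. Qed.

End quadratic_remainder.

Section space_time.
Variables (R : realType) (m : nat).
Local Notation Z := (R * 'rV[R]_m)%type.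

Lemma coord_le_norm (x : 'rV[R]_m) j : `|x ord0 j| <= `|x|.
Proof.
rewrite [leRHS]mx_normrE.
exact: (le_bigmax _ (fun i : 'I_1 * 'I_m => `|x i.1 i.2|) (ord0, j)).
Qed.

Lemma fst_le_norm (h : Z) : `|h.1| <= `|h|.
Proof. by rewrite [leRHS]/Num.norm/= le_max lexx. Qed.

Lemma snd_le_norm (h : Z) : `|h.2| <= `|h|.
Proof. by rewrite [leRHS]/Num.norm/= le_max lexx orbT. Qed.

(** The linear form with partial derivatives [a] and [b], bundled as a linear map to serve as a
    candidate in [quadratic_is_diff]. *)
Definition covector (a : R) (b : 'I_m -> R) (h : Z) : R :=
  h.1 * a + \sum_j h.2 ord0 j * b j.

Let covector_linear a b : linear (covector a b).
Proof.
move=> k u v; rewrite /covector /= scalerDr [k *: (\sum_j _)]scaler_sumr addrACA.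
rewrite -big_split /= mulrDl -mulrA; congr (_ + _).
by apply: eq_bigr => j _; rewrite !mxE mulrDl -mulrA.
Qed.

HB.instance Definition _ a b :=
  GRing.isLinear.Build R Z R _ (covector a b) (covector_linear a b).

Lemma continuous_fst : continuous (fun z : Z => z.1).
Proof. by move=> z; exact: cvg_fst. Qed.

Lemma continuous_coord j : continuous (fun z : Z => z.2 ord0 j).
Proof.
move=> z; apply: (@cvg_comp _ _ _ snd (fun x : 'rV[R]_m => x ord0 j) _ (nbhs z.2)).
  exact: cvg_snd.
exact: coord_continuous.
Qed.

Lemma cvg_sum T (F : set_system T) {FF : Filter F} (I : Type) (s : seq I)
    (f : I -> T -> R) (l : I -> R) :
  (forall i, f i @ F --> l i) ->
  (fun x => \sum_(i <- s) f i x) @ F --> \sum_(i <- s) l i.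
Proof.
move=> fl; elim: s => [|i s IH].
  by rewrite big_nil; under eq_fun do rewrite big_nil; exact: cvg_cst.
by rewrite big_cons; under eq_fun do rewrite big_cons; exact: cvgD.
Qed.

Lemma covector_continuous a b : continuous (covector a b).
Proof.
move=> h; apply: cvgD; first by apply: cvgMl; exact: continuous_fst.
by apply: cvg_sum => j; apply: cvgMl; exact: continuous_coord.
Qed.

(** The norm of [x] is the sup norm of the topology on row vectors, hence the factor [m]. *)
Lemma norm_dotp_le (p x : 'rV[R]_m) : `|dotp p x| <= m%:R * enorm p * `|x|.
Proof.
apply: le_trans (ler_norm_sum _ _ _) _.
apply: (@le_trans _ _ (\sum_(j < m) enorm p * `|x|)).
  apply: ler_sum => j _; rewrite normrM ler_pM//; first exact: ler_coord_enorm.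
  exact: coord_le_norm.
by rewrite sumr_const card_ord -[leLHS]mulr_natl mulrA.
Qed.

End space_time.

Section taylor.
Variable R : realType.
Implicit Types u v e d : R.

Lemma mvt_two_sided (f df : R -> R) (a b : R) :
  (forall x : R, is_derive x 1 f (df x)) ->
  exists2 c, `|c - a| <= `|b - a| & f b - f a = df c * (b - a).
Proof.
move=> dfx.
have cf : continuous f by move=> x; exact: is_derive1_continuous (dfx x).
have [ab|/ltW ba] := leP a b.
  have [c] := @MVT_segment R f df a b ab (fun x _ => dfx x) (continuous_subspaceT cf).
  rewrite in_itv/= => /andP[ac cb] e; exists c => //.
  by rewrite !ger0_norm ?subr_ge0// lerB.
have [c] := @MVT_segment R f df b a ba (fun x _ => dfx x) (continuous_subspaceT cf).
rewrite in_itv/= => /andP[bc ca] e; exists c.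
  by rewrite ler0_norm ?subr_le0// ler0_norm ?subr_le0// lerN2 lerB.
by rewrite -opprB e -mulrN opprB.
Qed.

(** The reflected argument is the real trace of multiplication by i, and the origin of the
    reflection p -> -p in [hyp]. *)
Lemma is_derive_cas u : is_derive u 1 (@cas R) (cas (- u)).
Proof.
rewrite casN (_ : @cas R = (@cos R) + (@sin R)); last by [].
by apply: is_derive_eq; rewrite addrC.
Qed.

Lemma cas_lip u v : `|cas u - cas v| <= 2 * `|u - v|.
Proof.
have [c _ ->] := mvt_two_sided v u is_derive_cas.
by rewrite normrM ler_wpM2r// cas_le.
Qed.

Lemma cas_taylor v e : `|cas (v + e) - cas v - e * cas (- v)| <= 2 * e ^+ 2.
Proof.
have [c hc ->] := mvt_two_sided v (v + e) is_derive_cas.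
move: hc; rewrite addrAC subrr add0r => hc.
rewrite [X in X - _]mulrC -mulrBr normrM.
rewrite -[e ^+ 2]real_normK ?num_real// expr2 mulrCA ler_wpM2l//.
apply: le_trans (cas_lip _ _) _.
rewrite ler_wpM2l// (_ : - c - - v = - (c - v)) ?normrN//; ring.
Qed.

Lemma expR_taylor d : `|expR d - 1 - d| <= d ^+ 2 * expR `|d|.
Proof.
have h1 := expR_ge1Dx d; have h2 := expR_ge1Dx (- d).
have e0 := expR_gt0 d; have e1 := expR_gt0 (- d).
have ee : expR d * expR (- d) = 1 by rewrite -expRD subrr expR0.
rewrite ger0_norm; last lra.
have h3 : expR d - 1 <= d * expR d by nra.
have [d0|d0] := leP 0 d.
  by rewrite ger0_norm//; have := ler_wpM2l d0 h3; nra.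
have : 1 <= expR `|d| by rewrite -expR0 ler_expR.
have : expR d - 1 - d <= d ^+ 2 by nra.
by have := sqr_ge0 d; nra.
Qed.

Lemma ler_expR_sqr d : 0 <= d -> d ^+ 2 <= 4 * expR d.
Proof.
move=> d0; have -> : expR d = expR (d / 2) ^+ 2.
  by rewrite expr2 -expRD -splitr.
have := expR_ge1Dx (d / 2); have := expR_gt0 (d / 2); nra.
Qed.

(** The remainder of the product regroups exactly into the remainder of e^d, the remainder of [cas],
    and the mixed term d (cas(v + e) - cas(v)). *)
Lemma expcas_taylor (u v d e : R) :
  `|expR (u + d) * cas (v + e) - expR u * cas v -
    (d * (expR u * cas v) + e * (expR u * cas (- v)))| <=
  expR u * (2 * d ^+ 2 * expR `|d| + 2 * e ^+ 2 + 2 * `|d| * `|e|).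
Proof.
have -> : expR (u + d) * cas (v + e) - expR u * cas v -
    (d * (expR u * cas v) + e * (expR u * cas (- v))) =
  expR u * ((expR d - 1 - d) * cas (v + e) + (cas (v + e) - cas v - e * cas (- v)) +
    d * (cas (v + e) - cas v)) by rewrite expRD; ring.
rewrite normrM (ger0_norm (expR_ge0 _)) ler_wpM2l ?expR_ge0//.
apply: le_trans (ler_normD _ _) _; apply: lerD.
  apply: le_trans (ler_normD _ _) _; apply: lerD; last exact: cas_taylor.
  rewrite normrM mulrC -mulrA ler_pM//; [exact: cas_le|exact: expR_taylor].
rewrite normrM mulrC -mulrA mulrCA mulrA [_ * `|e|]mulrC.
have h := cas_lip (v + e) v; rewrite (_ : v + e - v = e) in h; last by ring.
by have := normr_ge0 d; nra.
Qed.

End taylor.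

Section exponential_weights.
Variables (R : realType) (m : nat).
Local Notation lam := (lebesgue_rV R m).
Implicit Types (xi : 'rV[R]_m -> R) (r s tau : R) (p x : 'rV[R]_m).

(** A class stable under multiplication by |p| and by the coordinates of p, so that the
    superpositions [expcas] can be differentiated without leaving it. *)
Definition exp_int xi := forall r, L1 lam (fun p => expR (r * enorm p) * xi p).

Lemma measurable_expnorm r : measurable_fun setT (fun p => expR (r * @enorm R m p)).
Proof.
apply: measurableT_comp => //; apply: measurable_funM => //.
exact: measurable_enorm.
Qed.

Lemma exp_int_L1 xi : exp_int xi -> L1 lam xi.
Proof. by move=> /(_ 0); apply: eq_L1 => p; rewrite mul0r expR0 mul1r. Qed.

Lemma exp_int_le xi (c : 'rV[R]_m -> R) s k : measurable_fun setT c ->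
  (forall p, `|c p| <= k * expR (s * enorm p)) -> exp_int xi ->
  exp_int (fun p => c p * xi p).
Proof.
move=> mc ck gx r; apply: (L1_le _ (L1Z k (L1_norm (gx (r + s))))).
  apply: measurable_funM; first exact: measurable_expnorm.
  by apply: measurable_funM => //; exact: L1_measurable (exp_int_L1 gx).
move=> p; rewrite !normrM !(ger0_norm (expR_ge0 _)) mulrDl expRD.
have -> : k * (expR (r * enorm p) * expR (s * enorm p) * `|xi p|) =
  expR (r * enorm p) * (k * expR (s * enorm p) * `|xi p|) by ring.
by rewrite ler_wpM2l ?expR_ge0// ler_wpM2r.
Qed.

Lemma exp_int_bM xi (c : 'rV[R]_m -> R) k : measurable_fun setT c ->
  (forall p, `|c p| <= k) -> exp_int xi -> exp_int (fun p => c p * xi p).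
Proof.
by move=> mc ck; apply: (@exp_int_le _ _ 0 k) => // p; rewrite mul0r expR0 mulr1.
Qed.

Lemma exp_intZ xi k : exp_int xi -> exp_int (fun p => k * xi p).
Proof. exact: (@exp_int_bM _ (fun=> k) `|k|). Qed.

Lemma exp_intD xi zeta : exp_int xi -> exp_int zeta ->
  exp_int (fun p => xi p + zeta p).
Proof. by move=> h1 h2 r; apply: eq_L1 _ (L1D (h1 r) (h2 r)) => p; ring. Qed.

Lemma exp_int_enorm xi : exp_int xi -> exp_int (fun p => enorm p * xi p).
Proof.
apply: (@exp_int_le _ _ 1 1); first exact: measurable_enorm.
move=> p; rewrite !mul1r ger0_norm ?enorm_ge0//.
by apply: le_trans (expR_ge1Dx _); rewrite lerDr.
Qed.

Lemma exp_int_coord xi j : exp_int xi -> exp_int (fun p => p ord0 j * xi p).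
Proof.
apply: (@exp_int_le _ _ 1 1); first exact: measurable_rV_coord.
move=> p; rewrite !mul1r; apply: le_trans (ler_coord_enorm p j) _.
by apply: le_trans (expR_ge1Dx _); rewrite lerDr.
Qed.

Lemma exp_intN xi : exp_int xi -> exp_int (fun p => xi (- p)).
Proof. by move=> h r; apply: eq_L1 _ (L1_rVN (h r)) => p; rewrite enormN. Qed.

(** Half of the Gaussian absorbs the exponential: r q <= r^2 / (2a) + a q^2 / 2. *)
Lemma exp_int_gauss (xi : 'rV[R]_m -> R) a k : 0 < a -> measurable_fun setT xi ->
  (forall p, `|xi p| <= k) -> exp_int (fun p => gaussV a p * xi p).
Proof.
move=> a0 mxi xik r.
have a20 : 0 < a / 2 by rewrite divr_gt0.
apply: (@L1_le _ _ _ lam _ (fun p => k * expR (r ^+ 2 / (2 * a)) * gaussV (a / 2) p)).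
- apply: measurable_funM; first exact: measurable_expnorm.
  by apply: measurable_funM => //; exact: measurable_gaussV.
- by apply: L1Z; exact: L1_gaussV.
- move=> p; rewrite !normrM (ger0_norm (expR_ge0 _)) (ger0_norm (gaussV_ge0 _ _)).
  rewrite mulrA -[leRHS]mulrA [leRHS]mulrC; apply: ler_pM => //.
    by rewrite mulr_ge0 ?expR_ge0.
  rewrite /gaussV -!expRD ler_expR -enorm_sqr -subr_ge0.
  have -> : r ^+ 2 / (2 * a) + - (a / 2 * enorm p ^+ 2) -
     (r * enorm p + - (a * enorm p ^+ 2)) = (2 * a)^-1 * (r - a * enorm p) ^+ 2.
    by field; exact: lt0r_neq0.
  by rewrite mulr_ge0 ?sqr_ge0// invr_ge0 mulr_ge0// ltW.
Qed.

Lemma exp_int_gaussM (g : 'rV[R]_m -> R) a : 0 < a -> L2 lam g ->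
  exp_int (fun p => gaussV a p * g p).
Proof.
move=> a0 g2 r; have a20 : 0 < a / 2 by rewrite divr_gt0.
have := exp_int_gauss a20 (@measurable_gaussV R m (a / 2)) (k := 1).
move=> /(_ _ r) h.
have h1 : L1 lam (fun p => expR (r * enorm p) * gaussV a p).
  apply: eq_L1 _ (h _) => [p|p].
    by rewrite -gaussVD -splitr.
  by rewrite ger0_norm ?gaussV_ge0 ?gaussV_le1.
have h2 : L2 lam (fun p => expR (r * enorm p) * gaussV a p).
  split; first exact: L1_measurable h1.
  have := exp_int_gauss a0 (@measurable_gaussV R m a) (k := 1).
  move=> /(_ _ (2 * r)); move=> h3; apply: eq_L1 _ (h3 _) => [p|p].
    by rewrite exprMn [expR _ ^+ 2]expr2 -expRD [gaussV _ _ ^+ 2]expr2;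
      congr (expR _ * _); ring.
  by rewrite ger0_norm ?gaussV_ge0 ?gaussV_le1.
by apply: eq_L1 _ (L2M h2 g2) => p; rewrite mulrA.
Qed.

(** Building block of all solutions, used with [s] and [tau] equal to 1 or -1. Differentiating in
    time inserts s |p|; differentiating along x_j inserts tau p_j and changes the sign of [tau]. *)
Definition expcas s tau xi (z : R * 'rV[R]_m) : R :=
  \int[lam]_p (expR (s * z.1 * enorm p) * (cas (tau * dotp p z.2) * xi p)).

Lemma measurable_cas_dotpc tau x :
  measurable_fun setT (fun p : 'rV[R]_m => cas (tau * dotp p x)).
Proof.
apply: measurableT_comp; first exact: measurable_cas.
by apply: measurable_funM => //; apply: measurable_dotp => //; exact: measurable_id.
Qed.

Lemma exp_int_cas tau x xi : exp_int xi ->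
  exp_int (fun p => cas (tau * dotp p x) * xi p).
Proof.
by apply: (@exp_int_bM _ _ 2) => [|p]; [exact: measurable_cas_dotpc|exact: cas_le].
Qed.

Lemma L1_expcas s tau xi z : exp_int xi ->
  L1 lam (fun p => expR (s * z.1 * enorm p) * (cas (tau * dotp p z.2) * xi p)).
Proof. by move=> gx; exact: exp_int_cas. Qed.

Lemma expcasZ s tau k xi z : exp_int xi ->
  expcas s tau (fun p => k * xi p) z = k * expcas s tau xi z.
Proof.
move=> gx; rewrite /expcas -IntZ; last exact: L1_expcas.
by apply: eq_Int => p; ring.
Qed.

Lemma expcas_diff s tau xi z : `|s| <= 1 -> `|tau| <= 1 -> exp_int xi ->
  differentiable (expcas s tau xi) z /\
  'd (expcas s tau xi) z =
  covector (expcas s tau (fun p => s * (enorm p * xi p)) z)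
    (fun j => expcas s (- tau) (fun p => tau * (p ord0 j * xi p)) z)
  :> (R * 'rV[R]_m -> R).
Proof.
move=> s1 tau1 gx.
set A := expcas _ _ (fun p => s * _) z; set B := fun j => _.
(* One unit absorbs the e^{|d|} of the Taylor remainder, as |h| <= 1; the other absorbs |p|^2 <= 4
   e^{|p|}, whence also the 4 in [C]. *)
pose r := `|z.1| + 2.
(* The three terms of [expcas_taylor], with |d| <= q and |e| <= m q for q = |h| |p|. *)
pose c : R := 2 + 2 * m%:R ^+ 2 + 2 * m%:R.
have c0 : 0 <= c by rewrite !addr_ge0 ?mulr_ge0 ?exprn_ge0.
pose C := 4 * c * \int[lam]_p `|expR (r * enorm p) * xi p|.
apply: (@quadratic_is_diff R _ (expcas s tau xi) (covector A B) z C).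
  exact: covector_continuous.
move=> h h1.
have gA : exp_int (fun p => s * (enorm p * xi p)).
  by apply: exp_intZ; exact: exp_int_enorm.
have gB j : exp_int (fun p => tau * (p ord0 j * xi p)).
  by apply: exp_intZ; exact: exp_int_coord.
pose u p := s * z.1 * enorm p; pose v p := tau * dotp p z.2.
pose d p := s * h.1 * enorm p; pose e p := tau * dotp p h.2.
pose rem p := (expR (u p + d p) * cas (v p + e p) - expR (u p) * cas (v p) -
    (d p * (expR (u p) * cas (v p)) + e p * (expR (u p) * cas (- v p)))) * xi p.
have i0 : L1 lam (fun p => expR (s * (h + z).1 * enorm p) *
   (cas (tau * dotp p (h + z).2) * xi p)) by exact: L1_expcas.
have i1 : L1 lam (fun p => expR (u p) * (cas (v p) * xi p)) by exact: L1_expcas.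
have i2 : L1 lam (fun p => h.1 * (expR (u p) * (cas (v p) * (s * (enorm p * xi p))))).
  by apply: L1Z; exact: L1_expcas.
have i3 j : L1 lam (fun p => h.2 ord0 j * (expR (u p) *
    (cas (- tau * dotp p z.2) * (tau * (p ord0 j * xi p))))).
  by apply: L1Z; exact: L1_expcas.
have remE p : rem p = expR (s * (h + z).1 * enorm p) *
   (cas (tau * dotp p (h + z).2) * xi p) - expR (u p) * (cas (v p) * xi p) -
   (h.1 * (expR (u p) * (cas (v p) * (s * (enorm p * xi p)))) +
    \sum_j h.2 ord0 j * (expR (u p) *
      (cas (- tau * dotp p z.2) * (tau * (p ord0 j * xi p))))).
  rewrite /rem.
  have -> : s * (h + z).1 * enorm p = u p + d p by rewrite /u /d /=; ring.
  have -> : tau * dotp p (h + z).2 = v p + e p by rewrite /v /e /= dotpDr; ring.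
  have -> : \sum_j h.2 ord0 j * (expR (u p) *
      (cas (- tau * dotp p z.2) * (tau * (p ord0 j * xi p)))) =
      e p * (expR (u p) * cas (- v p)) * xi p.
    rewrite mulNr -/(v p) /e /dotp mulr_sumr !mulr_suml.
    by apply: eq_bigr => j _; ring.
  by rewrite /d; ring.
have i23 := L1D i2 (L1_sum (index_enum 'I_m) xpredT i3).
have irem : L1 lam rem.
  by rewrite (funext remE); apply: L1B => //; exact: L1B.
have -> : expcas s tau xi (h + z) - expcas s tau xi z - covector A B h =
    \int[lam]_p rem p.
  rewrite (funext remE) IntB//; last exact: L1B.
  rewrite IntB// IntD//; last exact: L1_sum.
  rewrite Int_sum// IntZ; last exact: L1_expcas.
  congr (_ - (_ + _)); apply: eq_bigr => j _.
  by rewrite IntZ//; exact: L1_expcas.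
have ir := L1_norm (gx r).
have h0 := normr_ge0 h; have hh1 := fst_le_norm h; have hh2 := snd_le_norm h.
have -> : C * `|h| ^+ 2 = \int[lam]_p (4 * c * `|h| ^+ 2 * `|expR (r * enorm p) * xi p|).
  by rewrite IntZ// /C; ring.
apply: Int_norm_le => //; first exact: L1Z.
move=> p; rewrite /rem [leLHS]normrM [`|expR _ * _|]normrM (ger0_norm (expR_ge0 _)).
rewrite [leRHS]mulrA ler_wpM2r//.
apply: le_trans (expcas_taylor _ _ _ _) _.
have n0 := enorm_ge0 p; set N := enorm p in n0 *.
have dle : `|d p| <= `|h| * N.
  rewrite /d !normrM (ger0_norm (enorm_ge0 _)) ler_wpM2r//.
  by rewrite -[leRHS]mul1r ler_pM.
have dle1 : `|d p| <= N by apply: le_trans dle _; rewrite ler_piMl.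
have ele : `|e p| <= m%:R * (`|h| * N).
  rewrite /e normrM; apply: le_trans (ler_piMl _ tau1) _ => //.
  apply: le_trans (norm_dotp_le _ _) _.
  by rewrite -/N -mulrA ler_wpM2l// mulrC ler_wpM2r.
set q := `|h| * N in dle ele.
have q0 : 0 <= q by rewrite mulr_ge0.
have E1 : 1 <= expR N by rewrite -expR0 ler_expR.
have dN : expR `|d p| <= expR N by rewrite ler_expR.
have step : 2 * d p ^+ 2 * expR `|d p| + 2 * e p ^+ 2 + 2 * `|d p| * `|e p| <=
    c * q ^+ 2 * expR N.
  rewrite -(real_normK (num_real (d p))) -(real_normK (num_real (e p))).
  have d2 : `|d p| ^+ 2 <= q ^+ 2 by rewrite lerXn2r ?nnegrE.
  have e2 : `|e p| ^+ 2 <= m%:R ^+ 2 * q ^+ 2.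
    by rewrite -exprMn lerXn2r ?nnegrE// mulr_ge0.
  have de : `|d p| * `|e p| <= m%:R * q ^+ 2.
    by rewrite expr2 mulrCA ler_pM.
  have q2 : 0 <= q ^+ 2 by rewrite exprn_ge0.
  have -> : c * q ^+ 2 * expR N = 2 * q ^+ 2 * expR N +
      2 * (m%:R ^+ 2 * q ^+ 2) * expR N + 2 * (m%:R * q ^+ 2) * expR N.
    by rewrite /c; ring.
  apply: lerD; first apply: lerD.
  - by rewrite ler_pM ?mulr_ge0 ?exprn_ge0 ?expR_ge0// ler_wpM2l.
  - apply: (@le_trans _ _ (2 * (m%:R ^+ 2 * q ^+ 2))); first by rewrite ler_wpM2l.
    by rewrite ler_peMr// !mulr_ge0.
  - apply: (@le_trans _ _ (2 * (m%:R * q ^+ 2))); first by rewrite -mulrA ler_wpM2l.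
    by rewrite ler_peMr// !mulr_ge0.
apply: le_trans (ler_wpM2l (expR_ge0 _) step) _.
have uE : expR (u p) <= expR (`|z.1| * N).
  rewrite ler_expR /u -/N ler_wpM2r//; apply: le_trans (ler_norm _) _.
  by rewrite normrM ler_piMl.
have NE := ler_expR_sqr n0.
have -> : expR (r * N) = expR (`|z.1| * N) * (expR N * expR N).
  by rewrite -!expRD /r; congr expR; ring.
rewrite /q exprMn.
have -> : expR (u p) * (c * (`|h| ^+ 2 * N ^+ 2) * expR N) =
  c * `|h| ^+ 2 * (expR (u p) * (N ^+ 2 * expR N)) by ring.
have -> : 4 * c * `|h| ^+ 2 * (expR (`|z.1| * N) * (expR N * expR N)) =
  c * `|h| ^+ 2 * (expR (`|z.1| * N) * (4 * expR N * expR N)) by ring.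
rewrite ler_wpM2l ?mulr_ge0 ?exprn_ge0//.
rewrite ler_pM ?expR_ge0 ?mulr_ge0 ?exprn_ge0 ?expR_ge0//.
by rewrite ler_wpM2r ?expR_ge0.
Qed.

Lemma expcas_continuous s tau xi : `|s| <= 1 -> `|tau| <= 1 -> exp_int xi ->
  continuous (expcas s tau xi).
Proof.
by move=> s1 t1 gx z; apply: differentiable_continuous; case: (expcas_diff z s1 t1 gx).
Qed.

Lemma expcas_derive s tau xi v z : `|s| <= 1 -> `|tau| <= 1 -> exp_int xi ->
  'D_v (expcas s tau xi) z =
  v.1 * expcas s tau (fun p => s * (enorm p * xi p)) z +
  \sum_j v.2 ord0 j * expcas s (- tau) (fun p => tau * (p ord0 j * xi p)) z.
Proof.
by move=> s1 t1 gx; have [df d] := expcas_diff z s1 t1 gx; rewrite deriveE// d.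
Qed.

Lemma expcas_C1 s tau xi : `|s| <= 1 -> `|tau| <= 1 -> exp_int xi ->
  C1 (expcas s tau xi).
Proof.
move=> s1 t1 gx; split=> [z|v]; first by case: (expcas_diff z s1 t1 gx).
rewrite (funext (fun z => expcas_derive v z s1 t1 gx)) => z.
apply: cvgD; first apply: cvgMr.
  by apply: expcas_continuous => //; apply: exp_intZ; exact: exp_int_enorm.
apply: cvg_sum => j; apply: cvgMr; apply: expcas_continuous => //.
  by rewrite normrN.
by apply: exp_intZ; exact: exp_int_coord.
Qed.

End exponential_weights.

(** * Continuous functions on space-time *)

Section borel.
Variables (R : realType) (m : nat).
Local Notation Z := (R * 'rV[R]_m)%type.
Local Notation lam := (lebesgue_rV R m).

Lemma rat_near (x e : R) : 0 < e -> exists q : rat, `|ratr q - x| < e.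
Proof.
move=> e0; have xe : x - e < x + e by rewrite ltrD2l gtrN.
have [q] := rat_in_itvoo xe; rewrite in_itv/= => /andP[h1 h2].
by exists q; rewrite ltr_norml; apply/andP; split; lra.
Qed.

(** The measurable sets come from a product sigma-algebra, the open sets from the product topology.
    They are compared by writing [U] as the countable union of the boxes with rational centre that
    it contains. *)
Lemma open_measurable_space_time (U : set Z) : open U -> measurable U.
Proof.
move=> oU.
pose box (q : (rat * 'rV[rat]_m) * nat) : set Z :=
  [set z : Z | `|ratr q.1.1 - z.1| < q.2.+1%:R^-1 /\
           forall j, `|ratr (q.1.2 ord0 j) - z.2 ord0 j| < q.2.+1%:R^-1].
have mbox q : measurable (box q).
  rewrite (_ : box q = (fun z : Z => z.1) @^-1` [set t | `|ratr q.1.1 - t| < q.2.+1%:R^-1]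
    `&` (fun z : Z => z.2) @^-1` [set x : 'rV[R]_m | forall j,
      [set t | `|ratr (q.1.2 ord0 j) - t| < q.2.+1%:R^-1] (x ord0 j)]); last first.
    by apply/seteqP; split.
  have mb (c : R) : measurable ([set t | `|c - t| < q.2.+1%:R^-1] : set (measurableTypeR R)).
    by rewrite -[X in measurable X]/(ball c q.2.+1%:R^-1); exact: measurable_ball.
  apply: measurableI; rewrite -[X in measurable X]setTI.
    by apply: measurable_fst => //; exact: mb.
  apply: measurable_snd => //.
  by apply: (@measurable_rV_box R m (fun j =>
    [set t | `|ratr (q.1.2 ord0 j) - t| < q.2.+1%:R^-1])) => j; exact: mb.
pose F q := if pselect (box q `<=` U) then box q else set0.
have -> : U = \bigcup_q F q.
  apply/seteqP; split=> [z Uz|z [q _]]; last first.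
    by rewrite /F; case: pselect => // h /h.
  have /nbhs_ballP[e /= e0 eU] := open_nbhs_nbhs (conj oU Uz).
  have [k ke] : exists k : nat, 2 * k.+1%:R^-1 < e.
    exists (Num.truncn (2 / e)); rewrite ltr_pdivrMr// mulrC -ltr_pdivrMr//.
    exact: truncnS_gt.
  have k0 : 0 < k.+1%:R^-1 :> R by rewrite invr_gt0.
  have [q1 hq1] := rat_near z.1 k0.
  have /choice[q2 hq2] j : exists q : rat, `|ratr q - z.2 ord0 j| < k.+1%:R^-1.
    exact: rat_near.
  pose q := ((q1, \row_j q2 j) : rat * 'rV[rat]_m, k).
  exists q => //; rewrite /F; case: pselect => /= [_|].
    by split=> //= j; rewrite mxE.
  move=> nU; exfalso; apply: nU => w [/= w1 w2]; apply: eU.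
  have tri (a b c : R) : `|a - b| < k.+1%:R^-1 -> `|a - c| < k.+1%:R^-1 -> `|b - c| < e.
    move=> ab ac; apply: lt_trans ke; rewrite (_ : b - c = (a - c) - (a - b)); last by ring.
    by apply: le_lt_trans (ler_normB _ _) _; rewrite mulr_natl mulr2n ltrD.
  split; first exact: tri hq1 w1.
  split=> // i j; rewrite (ord1 i).
  by have := w2 j; rewrite mxE; exact: tri (hq2 j).
have cT : countable [set: ((rat * 'rV[rat]_m) * nat)%type] by exact: countableP.
apply: (countable_bigcupT_measurable cT) => q; rewrite /F.
have [h|h] := pselect (box q `<=` U).
  by case: pselect => // h'; exact: mbox.
by case: pselect => // h'; exact: measurable0.
Qed.

Lemma continuous_measurable_space_time (f : Z -> R) :
  continuous f -> measurable_fun setT f.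
Proof.
move=> /continuousP cf; apply: (measurability _ (RGenOpens.measurableE R)).
move=> _ [_ [a [b ->] <-]]; rewrite setTI; apply: open_measurable_space_time.
exact/cf/interval_open.
Qed.

Lemma continuous_slice (f : Z -> R) t : continuous f -> continuous (fun x => f (t, x)).
Proof.
move=> cf x; apply: (@cvg_comp _ _ _ (fun x => (t, x)) f _ (nbhs (t, x))); last exact: cf.
by apply: (@cvg_pair _ _ _ (nbhs x) (nbhs t) (nbhs x) _ _ _ (cst t) id);
  [exact: cvg_cst|exact: cvg_id].
Qed.

Lemma continuous_measurable_rV (f : 'rV[R]_m -> R) :
  continuous f -> measurable_fun setT f.
Proof.
move=> cf; have c2 : continuous (fun z : Z => f z.2).
  move=> z; apply: (@cvg_comp _ _ _ snd f _ (nbhs z.2)); last exact: cf.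
  exact: cvg_snd.
rewrite (_ : f = (fun z : Z => f z.2) \o pair (0 : R))//.
apply: measurableT_comp; first exact: continuous_measurable_space_time.
exact: measurable_pair1.
Qed.

(** A sup-norm ball around a point with f(x) <> 0 is a cube of positive measure on which [f] does
    not vanish. *)
Lemma continuous_ae0 (f : 'rV[R]_m -> R) : continuous f ->
  {ae lam, forall x, f x = 0} -> forall x, f x = 0.
Proof.
move=> cf [N [mN N0 fN]] x; apply: contrapT => /eqP fx.
have : \forall y \near x, f y != 0.
  have nfx : 0 < `|f x| by rewrite normr_gt0.
  have /cvgr_dist_lt /(_ _ nfx) : f @ x --> f x by exact: cf.
  apply: filterS => y.
  by apply: contraTneq => ->; rewrite subr0 ltxx.
move=> /nbhs_ballP[e /= e0 eU].
have mB (j : 'I_m) : measurable (ball (x ord0 j) e : set (measurableTypeR R)).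
  exact: measurable_ball.
have : lam [set y | forall j, ball (x ord0 j) e (y ord0 j)] = 0.
  apply: (subset_measure0 _ mN _ N0).
    exact: (measurable_rV_box mB).
  move=> y hy; apply: fN => /= fy.
  have : f y != 0 by apply: eU; split=> // i j; rewrite (ord1 i); exact: hy.
  by rewrite fy eqxx.
rewrite (lebesgue_rV_box mB) => /eqP.
have : (0 < \prod_(i < m) leb R (ball (x ord0 i) e))%E.
  apply: (@big_ind _ (fun y => 0 < y)%E); [exact: lte01|exact: mule_gt0|].
  by move=> j _; rewrite lebesgue_measure_ball ?ltW// lte_fin mulrn_wgt0.
by move=> /[swap] /eqP ->; rewrite ltxx.
Qed.

Lemma continuous_ae0_line (f : R -> R) : continuous f ->
  {ae leb R, forall x, f x = 0} -> forall x, f x = 0.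
Proof.
move=> cf [N [mN N0 fN]] x; apply: contrapT => /eqP fx.
have : \forall y \near x, f y != 0.
  have nfx : 0 < `|f x| by rewrite normr_gt0.
  have /cvgr_dist_lt /(_ _ nfx) : f @ x --> f x by exact: cf.
  apply: filterS => y.
  by apply: contraTneq => ->; rewrite subr0 ltxx.
move=> /nbhs_ballP[e /= e0 eU].
have : leb R (ball x e) = 0.
  apply: (subset_measure0 _ mN _ N0); first exact: measurable_ball.
  move=> y hy; apply: fN => /= fy.
  by have := eU y hy; rewrite fy eqxx.
rewrite lebesgue_measure_ball ?ltW// => -[] /eqP.
by rewrite mulrn_eq0/= gt_eqF.
Qed.

Lemma space_time_bounded (f : Z -> R) (a b r : R) : continuous f ->
  exists2 M, 0 <= M & forall t (x : 'rV[R]_m), a <= t <= b -> (forall j, `|x ord0 j| <= r) ->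
    `|f (t, x)| <= M.
Proof.
move=> cf.
pose K : set Z := `[a, b]%classic `*` [set x : 'rV[R]_m | forall j, `[- r, r]%classic (x ord0 j)].
have cK : compact K.
  apply: compact_setX; first exact: segment_compact.
  by apply: (@rV_compact R m (fun j => `[- r, r]%classic)) => j; exact: segment_compact.
have : compact (f @` K).
  by apply: continuous_compact => //; exact: continuous_subspaceT.
move=> /compact_bounded[M [_ hM]]; exists (`|M| + 1); first by rewrite addr_ge0.
move=> t x tab xr; apply: (hM (`|M| + 1)).
  by rewrite ltr_pwDr// ler_norm.
exists (t, x) => //; split; first by rewrite /= in_itv.
by move=> j /=; rewrite in_itv/= -ler_norml.
Qed.

Lemma line_derive (f : Z -> R) (z v : Z) (s : R) :
  (forall w, differentiable f w) ->
  is_derive s 1 (fun s => f (z + s *: v)) ('D_v f (z + s *: v)).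
Proof.
move=> df; have d := @diff_derivable _ _ _ f (z + s *: v) v (df _).
have e : (fun h => h^-1 *: (((fun s => f (z + s *: v)) \o shift s) (h *: (1 : R)) -
    f (z + s *: v))) =
  (fun h => h^-1 *: ((f \o shift (z + s *: v)) (h *: v) - f (z + s *: v))).
  apply/funext => h; congr (_ *: (f _ - _)) => /=.
  by rewrite [h *: 1]mulr1 scalerDl addrCA.
by apply: DeriveDef; [rewrite /derivable e|rewrite /derive e].
Qed.

End borel.

(** * A continuously differentiable cutoff *)

Section cutoff.
Variable R : realType.
Implicit Types (u h : R).

(** Squaring makes the positive part continuously differentiable. *)
Definition sqpos u : R := Num.max 0 u ^+ 2.

Lemma is_derive_sqpos u : is_derive u 1 sqpos (2 * Num.max 0 u).
Proof.
pose L : R -> R := fun h => 2 * Num.max 0 u * h.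
have cL : continuous L by move=> h; apply: cvgMr; exact: cvg_id.
have q h : `|h| <= 1 -> `|sqpos (h + u) - sqpos u - L h| <= 1 * `|h| ^+ 2.
  move=> _; rewrite mul1r real_normK ?num_real// /sqpos /L.
  rewrite ler_norml; case: (leP 0 u) => u0; case: (leP 0 (h + u)) => hu;
  by apply/andP; split; nra.
have [d dE] := @quadratic_is_diff R R sqpos
  ( *:%R (2 * Num.max 0 u) : {linear R -> R}) u 1 cL q.
apply: DeriveDef; first exact: diff_derivable.
by rewrite deriveE// dE; exact: mulr1.
Qed.

Variable m : nat.
Implicit Types (x : 'rV[R]_m).

(** A bump with values in [0, 1] that vanishes outside the ball of radius k + 1 and tends to 1;
    being polynomial inside, it has an explicit gradient. *)
Definition cutoff (k : nat) x : R := sqpos (1 - dotp x x / k.+1%:R ^+ 2).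

Definition cutoff' (k : nat) (j : 'I_m) x : R :=
  - 4 * Num.max 0 (1 - dotp x x / k.+1%:R ^+ 2) * x ord0 j / k.+1%:R ^+ 2.

Lemma dotp_continuous : continuous (fun x => dotp x x).
Proof.
move=> x; apply: (@cvg_sum R _ (nbhs x) (nbhs_filter x)) => j.
by apply: cvgM; exact: coord_continuous.
Qed.

Lemma sqpos_continuous : continuous sqpos.
Proof. by move=> u; exact: is_derive1_continuous (is_derive_sqpos u). Qed.

Lemma cutoff_arg_cvg k x : (1 - dotp y y / k.+1%:R ^+ 2) @[y --> x] -->
  1 - dotp x x / k.+1%:R ^+ 2.
Proof.
apply: (@cvgB _ _ _ (nbhs x) (nbhs_filter x)); first exact: cvg_cst.
by apply: (@cvgMl _ _ (nbhs x) (nbhs_filter x)); exact: dotp_continuous.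
Qed.

Lemma cutoff_continuous k : continuous (cutoff k).
Proof.
move=> x; apply: (@cvg_comp _ _ _ (fun y => 1 - dotp y y / k.+1%:R ^+ 2) sqpos
  _ _ _ (@cutoff_arg_cvg k x)).
exact: sqpos_continuous.
Qed.

Lemma cutoff'_continuous k j : continuous (cutoff' k j).
Proof.
move=> x; apply: (@cvgMl _ _ (nbhs x) (nbhs_filter x)).
apply: (@cvgM _ _ (nbhs x) (nbhs_filter x)); last exact: coord_continuous.
apply: (@cvgMr _ _ (nbhs x) (nbhs_filter x)); apply: (@cvg_comp _ _ _ (fun y => 1 - dotp y y / k.+1%:R ^+ 2) (Num.max 0)
  _ _ _ (@cutoff_arg_cvg k x)).
have -> : Num.max (0 : R) = fun u => 2^-1 * (u + `|u|).
  apply/funext => u; case: (leP 0 u) => u0; first by rewrite ger0_norm//; field.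
  by rewrite ltr0_norm// subrr mulr0.
by apply: cvgMr; apply: cvgD; [exact: cvg_id|exact: norm_continuous].
Qed.

Lemma cutoff_deriv k j x (s : R) : is_derive s 1
  (fun s => cutoff k (s *: delta_mx ord0 j + x)) (cutoff' k j (s *: delta_mx ord0 j + x)).
Proof.
set v : 'rV[R]_m := delta_mx ord0 j.
have dv y : dotp y v = y ord0 j.
  rewrite /dotp (bigD1 j)//= mxE !eqxx mulr1 big1 ?addr0// => i ij.
  by rewrite mxE (negPf ij) andbF mulr0.
have vj : v ord0 j = 1 by rewrite mxE !eqxx.
pose c : R := (k.+1%:R ^+ 2)^-1.
pose F (u : R) := (1 - c * dotp x x) + ((- (2 * c * x ord0 j)) * u + - c * u ^+ 2).
have e u : F u = 1 - dotp (u *: v + x) (u *: v + x) / k.+1%:R ^+ 2.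
  rewrite /F -/c dotpDl !dotpDr (dotpC (u *: v) x) !dotpZr !dv.
  by rewrite [(u *: v) _ _]mxE vj; ring.
have d1 : is_derive s 1 F (- (2 * c * x ord0 j) + - c * (2 * s)).
  have da : is_derive s 1 (fun s => - (2 * c * x ord0 j) * s) (- (2 * c * x ord0 j)).
    exact: is_derive_mull.
  have db : is_derive s 1 (fun s => - c * s ^+ 2) (- c * (2 * s)).
    exact: (@is_derive1_comp _ (fun u => - c * u) _ _ _ _
      (is_derive_mull _ _) (is_derive_sqr _)).
  have := is_deriveD (is_derive_cst (1 - c * dotp x x) s 1) (is_deriveD da db).
  by move=> h; apply: is_derive_eq h _; rewrite add0r.
have h := is_derive1_comp (is_derive_sqpos (F s)) d1.
have -> : (fun s => cutoff k (s *: v + x)) = sqpos \o F.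
  by apply/funext => u; rewrite /cutoff /= e.
apply: is_derive_eq h _; rewrite e /cutoff' [(s *: v + x) _ _]mxE.
by rewrite [(s *: v) _ _]mxE vj mulr1 -/c; ring.
Qed.

Lemma cutoff_ge0 k x : 0 <= cutoff k x.
Proof. exact: sqr_ge0. Qed.

Lemma cutoff_le1 k x : cutoff k x <= 1.
Proof.
rewrite /cutoff /sqpos exprn_ile1// ?le_max ?lexx// ge_max ler01/=.
by rewrite gerBl mulr_ge0 ?dotp_ge0// invr_ge0 exprn_ge0.
Qed.

Lemma cutoff_supp k x j : k.+1%:R < `|x ord0 j| ->
  Num.max 0 (1 - dotp x x / k.+1%:R ^+ 2) = 0.
Proof.
move=> xj; apply/max_idPl; rewrite subr_le0 ler_pdivlMr ?exprn_gt0// mul1r.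
rewrite -enorm_sqr lerXn2r ?nnegrE ?enorm_ge0//.
exact: le_trans (ltW xj) (ler_coord_enorm _ _).
Qed.

(** On the support |x_j| <= k + 1, which cancels one of the two factors k + 1 in the denominator. *)
Lemma cutoff'_le k j x : `|cutoff' k j x| <= 4 * k.+1%:R^-1.
Proof.
have [xj|xj] := ltP k.+1%:R (`|x ord0 j|).
  by rewrite /cutoff' (cutoff_supp xj) mulr0 !mul0r normr0 mulr_ge0.
rewrite /cutoff' !normrM normrN (ger0_norm (_ : 0 <= 4))//.
set M := Num.max _ _.
have M1 : `|M| <= 1.
  rewrite ger0_norm ?le_max ?lexx// ge_max ler01/=.
  by rewrite gerBl mulr_ge0 ?dotp_ge0// invr_ge0 exprn_ge0.
have -> : 4 * k.+1%:R^-1 = 4 * 1 * k.+1%:R * (k.+1%:R ^+ 2)^-1 :> R.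
  by field; rewrite nat1r pnatr_eq0.
by rewrite [`|_^-1|]ger0_norm ?invr_ge0// ler_wpM2r ?invr_ge0// ler_pM// ler_wpM2l.
Qed.

Lemma cutoff_cvg x : cutoff k x @[k --> \oo] --> (1 : R).
Proof.
have -> : 1 = sqpos (1 - dotp x x * 0 ^+ 2) :> R.
  by rewrite expr0n mulr0 subr0 /sqpos (max_idPr ler01) expr1n.
have h : (1 - dotp x x * k.+1%:R^-1 ^+ 2) @[k --> \oo] --> 1 - dotp x x * 0 ^+ 2.
  apply: cvgB; first exact: cvg_cst.
  apply: cvgMr; apply: cvg_sqr_comp; exact: (@cvg_harmonic R).
have -> : (cutoff^~ x) = fun k => sqpos (1 - dotp x x * k.+1%:R^-1 ^+ 2).
  by apply/funext => k; rewrite /cutoff exprVn.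
by apply: cvg_comp h _; exact: sqpos_continuous.
Qed.

End cutoff.

(** * Conservation laws *)

Section conservation.
Variables (R : realType) (m : nat).
Local Notation Z := (R * 'rV[R]_m)%type.
Local Notation lam := (lebesgue_rV R m).
Implicit Types (x : 'rV[R]_m) (k : nat).

Let cube (k : nat) : set 'rV[R]_m :=
  [set x | forall j, `[- k.+1%:R, k.+1%:R]%classic (x ord0 j)].

Let measurable_cube k : measurable (cube k).
Proof. by apply: (@measurable_rV_box R m (fun j => `[- k.+1%:R, k.+1%:R]%classic)). Qed.

Let L1_cube k : L1 lam (\1_(cube k) : _ -> R).
Proof.
apply: L1_lty0 => //; rewrite integral_indic// setIT.
rewrite [X in (X < _)%E](@lebesgue_rV_box R m (fun j => `[- k.+1%:R, k.+1%:R]%classic))//.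
rewrite -ge0_fin_numE; last by apply: prode_ge0 => i _; exact: measure_ge0.
apply: prode_fin_num => i _; rewrite ge0_fin_numE ?measure_ge0// lebesgue_measure_itv/=.
by case: ifP => _; rewrite ?ltry// -EFinD ltry.
Qed.

Let out_cube k x : ~ cube k x -> exists j, k.+1%:R < `|x ord0 j|.
Proof.
move=> /existsNP[j]; rewrite /= in_itv/= -ler_norml => /negP.
by rewrite -ltNge => h; exists j.
Qed.

Let in_cube k x : cube k x -> forall j, `|x ord0 j| <= k.+1%:R.
Proof. by move=> h j; have := h j; rewrite /= in_itv/= -ler_norml. Qed.

Lemma L1_compact (g : 'rV[R]_m -> R) k M : measurable_fun setT g ->
  (forall x, (forall j, `|x ord0 j| <= k.+1%:R) -> `|g x| <= M) ->
  (forall x j, k.+1%:R < `|x ord0 j| -> g x = 0) -> L1 lam g.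
Proof.
move=> mg gM g0; apply: (L1_le mg (L1Z M (L1_cube k))) => x; rewrite indicE.
have [xk|xk] := pselect (cube k x).
  by rewrite mem_set// mulr1 gM//; exact: in_cube.
by rewrite memNset// mulr0; have [j /g0->] := out_cube xk; rewrite normr0.
Qed.

Let itv1 (a b : R) : R -> R := \1_(`[a, b]%classic).

Let L1_itv1 a b : L1 (leb R) (itv1 a b).
Proof. exact: integrable_indic_itv. Qed.

Let itv1E a b s : itv1 a b s = (a <= s <= b)%R%:R.
Proof. by rewrite /itv1 indicE; congr (nat_of_bool _)%:R; rewrite mem_setE in_itv. Qed.

Lemma L1_slab_compact (g : Z -> R) a b k M : measurable_fun setT g ->
  (forall s x, a <= s <= b -> (forall j, `|x ord0 j| <= k.+1%:R) ->
    `|g (s, x)| <= M) ->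
  (forall s x j, k.+1%:R < `|x ord0 j| -> g (s, x) = 0) ->
  L1 (leb R \x lam)%E (fun z => itv1 a b z.1 * g z).
Proof.
move=> mg gM g0.
have [i1 _] := L1_tensor (m1 := leb R) (m2 := lam) (L1_itv1 a b) (L1Z M (L1_cube k)).
apply: (@L1_le _ _ _ (leb R \x lam)%E _ _ _ i1) => [|[s x]].
  apply: measurable_funM => //.
  exact: measurableT_comp (L1_measurable (L1_itv1 a b)) measurable_fst.
rewrite /= normrM itv1E normr_nat; case: (boolP (a <= s <= b)) => sab; last first.
  by rewrite !mul0r.
rewrite !mul1r indicE; have [xk|xk] := pselect (cube k x).
  by rewrite mem_set// mulr1 gM//; exact: in_cube.
by rewrite memNset// mulr0; have [j /g0->] := out_cube xk; rewrite normr0.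
Qed.

Let e j : Z := (0, delta_mx ord0 j).

Let measurable_slice (g : Z -> R) s : measurable_fun setT g ->
  measurable_fun setT (fun x => g (s, x)).
Proof.
move=> mg; rewrite (_ : (fun x => g (s, x)) = g \o pair s)//.
by apply: measurableT_comp => //; exact: measurable_pair1.
Qed.

(** The integrand is the x_j-derivative of the compactly supported function [G], so [Int_deriv0]
    applies to the translations along the j-th axis. *)
Lemma cutoff_ibp (Q : Z -> R) k j t : C1 Q ->
  \int[lam]_x (cutoff' k j x * Q (t, x) + cutoff k x * 'D_(e j) Q (t, x)) = 0.
Proof.
move=> [dQ cDQ]; have cQ : continuous Q by move=> z; exact: differentiable_continuous.
set v : 'rV[R]_m := delta_mx ord0 j.
pose G (x : 'rV[R]_m) := cutoff k x * Q (t, x).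
pose g (x : 'rV[R]_m) := cutoff' k j x * Q (t, x) + cutoff k x * 'D_(e j) Q (t, x).
have [M1 M10 hM1] := @space_time_bounded R m Q t t k.+1%:R cQ.
have [M2 M20 hM2] := @space_time_bounded R m ('D_(e j) Q) t t k.+1%:R (cDQ (e j)).
have tt : t <= t <= t by rewrite lexx.
have cQt := @continuous_slice R m Q t cQ.
have cDQt := @continuous_slice R m ('D_(e j) Q) t (cDQ (e j)).
have cG : continuous G.
  move=> x; apply: (@cvgM _ _ (nbhs x) (nbhs_filter x)); last exact: cQt.
  exact: cutoff_continuous.
have cg : continuous g.
  move=> x; apply: (@cvgD _ _ _ (nbhs x) (nbhs_filter x)).
    apply: (@cvgM _ _ (nbhs x) (nbhs_filter x)); last exact: cQt.
    exact: cutoff'_continuous.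
  apply: (@cvgM _ _ (nbhs x) (nbhs_filter x)); last exact: cDQt.
  exact: cutoff_continuous.
have cut1 x : `|cutoff k x| <= 1 by rewrite ger0_norm ?cutoff_ge0 ?cutoff_le1.
have cut0 x i : k.+1%:R < `|x ord0 i| -> cutoff k x = 0.
  by move=> /cutoff_supp h; rewrite /cutoff /sqpos h expr0n.
have cut'0 x i : k.+1%:R < `|x ord0 i| -> cutoff' k j x = 0.
  by move=> /cutoff_supp h; rewrite /cutoff' h mulr0 !mul0r.
have iG : L1 lam G.
  apply: (@L1_compact G k (1 * M1)).
  - exact: continuous_measurable_rV.
  - by move=> x xk; rewrite normrM ler_pM// hM1.
  - by move=> x i /cut0; rewrite /G => ->; rewrite mul0r.
have ig : L1 lam g.
  apply: (@L1_compact g k (4 * k.+1%:R^-1 * M1 + 1 * M2)).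
  - exact: continuous_measurable_rV.
  - move=> x xk; apply: le_trans (ler_normD _ _) _.
    rewrite (normrM (cutoff' k j x)) (normrM (cutoff k x)).
    by apply: lerD; apply: ler_pM => //; [exact: cutoff'_le|exact: hM1|exact: hM2].
  - by move=> x i xi; rewrite /g (cut0 _ _ xi) (cut'0 _ _ xi) !mul0r addr0.
apply: (@Int_deriv0 R _ _ lam (fun s x => s *: v + x) G g) => //.
- apply/measurable_fun_rVP => i; under eq_fun do rewrite !mxE.
  apply: measurable_funD; last exact: measurableT_comp (measurable_rV_coord i) measurable_snd.
  by apply: measurable_funM => //; exact: measurable_fst.
- by move=> s f f1; split; [exact: L1_rV_shift|exact: Int_rV_shift].
- by move=> x; rewrite scale0r add0r.
- move=> x s; have d1 := cutoff_deriv k j x s.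
  have lineE (u : R) : (t, x) + u *: e j = (t, u *: v + x).
    by congr (_, _); rewrite /= ?scaler0 ?addr0 ?[_ *: 0]mulr0 ?addr0// addrC.
  have d2 := line_derive (t, x) (e j) s dQ.
  rewrite lineE in d2; rewrite (funext (fun u => congr1 Q (lineE u))) in d2.
  have := is_deriveM d1 d2.
  move=> h; apply: is_derive_eq h _.
  by rewrite /g /GRing.scale /= addrC; congr (_ + _); rewrite mulrC.
- move=> x s; apply: (@cvg_comp _ _ _ (fun s => s *: v + x) g (nbhs s) (nbhs (s *: v + x))).
    apply: cvgD; last exact: cvg_cst.
    by apply: cvgZl; exact: cvg_id.
  exact: cg.
Qed.

(** Divergence theorem on an unbounded slab. No pointwise decay of [P] or [Q] is available:
    integrability of the flux on the slab and of the two end slices of [P] has to do. *)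
Lemma conservation (P : Z -> R) (Q : 'I_m -> Z -> R) a b : a < b ->
  C1 P -> (forall j, C1 (Q j)) ->
  (forall z, 'D_((1, 0) : Z) P z + \sum_j 'D_((0, delta_mx ord0 j) : Z) (Q j) z = 0) ->
  (forall j, L1 (leb R \x lam)%E (fun z => \1_(`[a, b]%classic) z.1 * Q j z)) ->
  L1 lam (fun x => P (a, x)) -> L1 lam (fun x => P (b, x)) ->
  \int[lam]_x P (a, x) = \int[lam]_x P (b, x).
Proof.
move=> ab [dP cDP] CQ div0 iQ ia ib.
pose e0 : Z := (1, 0).
have dQ j := (CQ j).1; have cDQ j := (CQ j).2.
have cP : continuous P by move=> z; exact: differentiable_continuous.
have cQ j : continuous (Q j) by move=> z; apply: differentiable_continuous; exact: dQ.
have ccut k : continuous (fun z : Z => cutoff k z.2).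
  move=> z; apply: (@cvg_comp _ _ _ snd (cutoff k) _ (nbhs z.2)); first exact: cvg_snd.
  exact: cutoff_continuous.
have ccut' k j : continuous (fun z : Z => cutoff' k j z.2).
  move=> z; apply: (@cvg_comp _ _ _ snd (cutoff' k j) _ (nbhs z.2)); first exact: cvg_snd.
  exact: cutoff'_continuous.
have cut0 k x i : k.+1%:R < `|x ord0 i| -> cutoff k x = 0.
  by move=> /cutoff_supp h; rewrite /cutoff /sqpos h expr0n.
have cut1 k x : `|cutoff k x| <= 1 by rewrite ger0_norm ?cutoff_ge0 ?cutoff_le1.
pose K := \int[(leb R \x lam)%E]_z \sum_j `|itv1 a b z.1 * Q j z|.
have iK : L1 (leb R \x lam)%E (fun z => \sum_j `|itv1 a b z.1 * Q j z|).
  by apply: L1_sum => j; exact: L1_norm (iQ j).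
(* Localized by the cutoff, the change from [a] to [b] is the flux through the gradient of the
   cutoff, which is at most 4 / (k + 1) in each direction. *)
have key k : `|\int[lam]_x (cutoff k x * (P (b, x) - P (a, x)))| <= 4 * K * k.+1%:R^-1.
  pose f z := cutoff k z.2 * 'D_e0 P z.
  have cf : continuous f.
    by move=> z; apply: cvgM; [exact: ccut|exact: cDP].
  have mf := continuous_measurable_space_time cf.
  have [M M0 hM] := @space_time_bounded R m ('D_e0 P) a b k.+1%:R (cDP e0).
  pose F z := itv1 a b z.1 * f z.
  have iF : L1 (leb R \x lam)%E F.
    apply: (@L1_slab_compact f a b k (1 * M)) => //.
      by move=> s x sab xk; rewrite normrM ler_pM// hM.
    by move=> s x i /cut0; rewrite /f /= => ->; rewrite mul0r.
  have i1 s : L1 lam (fun x => F (s, x)).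
    have [M' M'0 hM'] := @space_time_bounded R m ('D_e0 P) s s k.+1%:R (cDP e0).
    apply: (@L1Z _ _ _ lam (itv1 a b s) (fun x => f (s, x))).
    apply: (@L1_compact _ k (1 * M')).
    - exact: measurable_slice.
    - by move=> x xk; rewrite normrM ler_pM// hM'// lexx.
    - by move=> x i /cut0; rewrite /f /= => ->; rewrite mul0r.
  have dPx x (s : R) : is_derive s 1 (fun s : R => P (s, x)) ('D_e0 P (s, x)).
    have lineE (u : R) : (0, x) + u *: e0 = (u, x) :> Z.
      by congr (_, _); rewrite /= ?scaler0 ?addr0// add0r [u *: 1]mulr1.
    have d := line_derive (0, x) e0 s dP.
    by rewrite lineE (funext (fun u => congr1 P (lineE u))) in d.
  have cPx x : continuous (fun s : R => 'D_e0 P (s, x)).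
    move=> s; apply: (@cvg_comp _ _ _ (fun s : R => (s, x)) ('D_e0 P) (nbhs s) (nbhs (s, x))).
      by apply: (@cvg_pair _ _ _ (nbhs s) (nbhs s) (nbhs x) _ _ _ id (cst x));
        [exact: cvg_id|exact: cvg_cst].
    exact: cDP.
  have FE x : (fun s : R => F (s, x)) =
      fun s : R => cutoff k x * (((fun s : R => 'D_e0 P (s, x)) \_ `[a, b]) s).
    apply/funext => s; rewrite /F /f /= /itv1 /patch indicE.
    by case: (_ \in _); rewrite ?mul1r ?mul0r ?mulr0.
  have ip x : L1 (leb R) ((fun s : R => 'D_e0 P (s, x)) \_ `[a, b]).
    have := @integrable_mkcond _ _ _ (leb R) `[a, b]%classic
      (EFin \o (fun s : R => 'D_e0 P (s, x))) (measurable_itv _).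
    rewrite restrict_EFin; move=> [+ _]; apply.
    apply: continuous_compact_integrable; first exact: segment_compact.
    exact: continuous_subspaceT.
  have i2 x : L1 (leb R) (fun s : R => F (s, x)) by rewrite FE; exact: L1Z.
  have [_ e1] := Fubini1 iF i1; have [_ e2] := Fubini2 iF i2.
  have -> : \int[lam]_x (cutoff k x * (P (b, x) - P (a, x))) =
      \int[(leb R \x lam)%E]_z F z.
    rewrite e2; apply: eq_Int => x; rewrite FE IntZ// -Rintegral_mkcond.
    by rewrite (@Rintegral_FTC _ (fun s => P (s, x))).
  pose G z := \sum_j cutoff' k j z.2 * (itv1 a b z.1 * Q j z).
  have iGj j : L1 (leb R \x lam)%E (fun z => cutoff' k j z.2 * (itv1 a b z.1 * Q j z)).
    apply: (@L1_bM _ _ _ _ (4 * k.+1%:R^-1)); last exact: iQ.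
      exact: continuous_measurable_space_time (ccut' k j).
    by move=> z; exact: cutoff'_le.
  have iG : L1 (leb R \x lam)%E G by exact: L1_sum.
  have cut'0 j x i : k.+1%:R < `|x ord0 i| -> cutoff' k j x = 0.
    by move=> /cutoff_supp h; rewrite /cutoff' h mulr0 !mul0r.
  have j1 j s : L1 lam (fun x => cutoff' k j x * Q j (s, x)).
    have [M' M'0 hM'] := @space_time_bounded R m (Q j) s s k.+1%:R (cQ j).
    apply: (@L1_compact _ k (4 * k.+1%:R^-1 * M')).
    - apply: (@measurable_slice (fun z => cutoff' k j z.2 * Q j z)).
      apply: measurable_funM; first exact: continuous_measurable_space_time (ccut' k j).
      exact: continuous_measurable_space_time.
    - by move=> x xk; rewrite normrM ler_pM// ?cutoff'_le// hM'// lexx.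
    - by move=> x i /cut'0 ->; rewrite mul0r.
  have j2 j s : L1 lam (fun x => cutoff k x * 'D_(e j) (Q j) (s, x)).
    have [M' M'0 hM'] := @space_time_bounded R m ('D_(e j) (Q j)) s s k.+1%:R (cDQ j _).
    apply: (@L1_compact _ k (1 * M')).
    - apply: (@measurable_slice (fun z => cutoff k z.2 * 'D_(e j) (Q j) z)).
      apply: measurable_funM; first exact: continuous_measurable_space_time (ccut k).
      by apply: continuous_measurable_space_time; exact: cDQ.
    - by move=> x xk; rewrite normrM ler_pM// hM'// lexx.
    - by move=> x i /cut0 ->; rewrite mul0r.
  have iG1 s : L1 lam (fun x => G (s, x)).
    apply: L1_sum => j; apply: eq_L1 _ (L1Z (itv1 a b s) (j1 j s)) => x /=; ring.
  have [_ e3] := Fubini1 iG iG1.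
  (* On each slice, the divergence equation replaces the time derivative of [P] by space
     derivatives, and [cutoff_ibp] moves these onto the cutoff. *)
  have -> : \int[(leb R \x lam)%E]_z F z = \int[(leb R \x lam)%E]_z G z.
    rewrite e1 e3; apply: eq_Int => s; apply/eqP; rewrite -subr_eq0 -IntB//.
    have i3 j := L1D (j1 j s) (j2 j s).
    rewrite (eq_Int _ (g := fun x => - itv1 a b s * \sum_j
       (cutoff' k j x * Q j (s, x) + cutoff k x * 'D_(e j) (Q j) (s, x)))).
      rewrite IntZ; last exact: L1_sum.
      rewrite Int_sum// big1 ?mulr0// => j _; exact: cutoff_ibp.
    move=> x; rewrite /F /G /f /=.
    have -> : 'D_e0 P (s, x) = - \sum_j 'D_(e j) (Q j) (s, x).
      by apply/eqP; rewrite -addr_eq0; apply/eqP; exact: div0.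
    under [X in _ - X]eq_bigr => j _ do rewrite mulrCA.
    rewrite -mulr_sumr big_split /= -mulr_sumr; ring.
  apply: le_trans (Int_norm_le iG (L1Z (4 * k.+1%:R^-1) iK) _) _.
    move=> z; apply: le_trans (ler_norm_sum _ _ _) _; rewrite mulr_sumr.
    by apply: ler_sum => j _; rewrite normrM ler_wpM2r// cutoff'_le.
  by rewrite IntZ// /K mulrAC.
have lim : \int[lam]_x (cutoff k x * (P (b, x) - P (a, x))) @[k --> \oo] -->
    \int[lam]_x (P (b, x) - P (a, x)).
  have iba := L1B ib ia.
  apply: (@Int_dct _ _ _ lam _ _ (fun x => `|P (b, x) - P (a, x)|)).
  - move=> k; apply: measurable_funM; last exact: L1_measurable iba.
    by apply: continuous_measurable_rV; exact: cutoff_continuous.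
  - exact: L1_measurable iba.
  - apply: nearW => x; rewrite -[X in _ --> X]mul1r; apply: cvgMl; exact: cutoff_cvg.
  - exact: L1_norm.
  - by move=> k x; rewrite normrM ler_piMl.
have lim0 : \int[lam]_x (cutoff k x * (P (b, x) - P (a, x))) @[k --> \oo] --> (0 : R).
  apply/norm_cvg0P; apply: (@squeeze_cvgr _ _ _ _ (cst 0) (fun k => 4 * K * k.+1%:R^-1)).
  - by apply: nearW => k; rewrite normr_ge0 /=; exact: key.
  - exact: cvg_cst.
  - rewrite -[0](mulr0 (4 * K)); apply: cvgMr; exact: (@cvg_harmonic R).
have lim_eq := cvg_unique _ lim lim0.
by apply/esym/eqP; rewrite -subr_eq0 -IntB// lim_eq.
Qed.

End conservation.

(** * The real Clifford algebra and the hyperbolic group *)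

Section clifford_action.
Variables (R : realType) (m : nat).
Local Notation CR := (clifford R m).
Implicit Types (u v : CR) (p q : 'rV[R]_m) (A B C : {set 'I_m}).

Lemma gen_mulE (K : comNzRingType) (w : clifford K m) (j : 'I_m) C :
  (clifford_gen K j * w) C =
  (-1) ^+ swaps [set j]%SET (symdiff [set j]%SET C) * w (symdiff [set j]%SET C).
Proof.
rewrite clifford_mulE (bigD1 [set j]%SET) //= big1 => [|A Aj].
  by rewrite addr0 ffunE eqxx mul1r.
by rewrite ffunE (negPf Aj) mul0r mulr0.
Qed.

Lemma gen_sqr (j : 'I_m) : clifford_gen R j * clifford_gen R j = -1.
Proof.
have /eqP := clifford_gen_anticomm R j j; rewrite eqxx mulr1 -mulr2n scaleNr.
rewrite -scaler_nat -scalerN => /eqP h.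
by apply: (scalerI (a := 2 : R)); rewrite ?pnatr_eq0.
Qed.


Lemma clifford_addE u v C : (u + v) C = u C + v C. Proof. by rewrite ffunE. Qed.
Lemma clifford_oppE u C : (- u) C = - u C. Proof. by rewrite ffunE. Qed.
Definition cE := (clifford_scaleE, clifford_addE, clifford_oppE).

Definition cinner u v : R := \sum_C u C * v C.

Lemma cinnerC u v : cinner u v = cinner v u.
Proof. by apply: eq_bigr => C _; rewrite mulrC. Qed.

Lemma cinnerDl u u' v : cinner (u + u') v = cinner u v + cinner u' v.
Proof. by rewrite -big_split; apply: eq_bigr => C _; rewrite ffunE mulrDl. Qed.

Lemma cinnerZl k u v : cinner (k *: u) v = k * cinner u v.
Proof. by rewrite mulr_sumr; apply: eq_bigr => C _; rewrite clifford_scaleE mulrA. Qed.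

Lemma cinnerDr u v v' : cinner u (v + v') = cinner u v + cinner u v'.
Proof. by rewrite cinnerC cinnerDl !(cinnerC u). Qed.

Lemma cinnerZr k u v : cinner u (k *: v) = k * cinner u v.
Proof. by rewrite cinnerC cinnerZl cinnerC. Qed.

Lemma cinner_ge0 u : 0 <= cinner u u.
Proof. by apply: sumr_ge0 => C _; rewrite -expr2 sqr_ge0. Qed.

Lemma cinner_suml (I : Type) (r : seq I) (F : I -> CR) v :
  cinner (\sum_(i <- r) F i) v = \sum_(i <- r) cinner (F i) v.
Proof.
elim/big_ind2: _ => [|x1 x2 y1 y2 <- <-|//]; last by rewrite cinnerDl.
by rewrite /cinner big1 // => C _; rewrite ffunE mul0r.
Qed.

Lemma cinner_sumr (I : Type) (r : seq I) (F : I -> CR) v :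
  cinner v (\sum_(i <- r) F i) = \sum_(i <- r) cinner v (F i).
Proof. by rewrite cinnerC cinner_suml; apply: eq_bigr => i _; rewrite cinnerC. Qed.

(** Left multiplication by e_j permutes the basis up to signs; since e_j^2 = -1, the signs of a
    blade and of its image are opposite, which makes the map skew-adjoint. *)
Lemma cinner_gen j u v :
  cinner (clifford_gen R j * u) v = - cinner u (clifford_gen R j * v).
Proof.
rewrite /cinner (reindex_inj (can_inj (symdiffK [set j]%SET))) -sumrN /=.
apply: eq_bigr => C _; rewrite !gen_mulE symdiffK.
have := congr1 (fun w : CR => w C) (mulrA (clifford_gen R j) (clifford_gen R j) (blade R C)).
rewrite gen_sqr mulN1r !gen_mulE symdiffK !ffunE eqxx mulr1 => h.
set s := (-1) ^+ swaps _ (symdiff _ C); set s' := (-1) ^+ swaps _ _.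
have -> : s' = - s.
  have : s * s = 1 by rewrite -expr2 /s sqrr_sign.
  have : s * s' = -1 by [].
  by move=> h1 h2; rewrite -[s']mul1r -h2 -mulrA h1 mulrN1.
by ring.
Qed.

Definition vecR p : CR := \sum_j p ord0 j *: clifford_gen R j.

Lemma vecRN p : vecR (- p) = - vecR p.
Proof. by rewrite -sumrN; apply: eq_bigr => j _; rewrite mxE scaleNr. Qed.

Lemma vecR_mul p u : vecR p * u = \sum_j p ord0 j *: (clifford_gen R j * u).
Proof. by rewrite mulr_suml; apply: eq_bigr => j _; rewrite scalerAl. Qed.

Lemma vecR_mulE p u C : (vecR p * u) C = \sum_j p ord0 j * (clifford_gen R j * u) C.
Proof. by rewrite vecR_mul sum_ffunE; apply: eq_bigr => j _; rewrite clifford_scaleE. Qed.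

Lemma cinner_vecR p u v : cinner (vecR p * u) v = - cinner u (vecR p * v).
Proof.
rewrite !vecR_mul cinner_suml cinner_sumr -sumrN; apply: eq_bigr => j _.
by rewrite cinnerZl cinnerZr cinner_gen mulrN.
Qed.

(** Twice the square is a double sum of anticommutators, of which only the diagonal survives. *)
Lemma vecR_sqr p : vecR p * vecR p = - dotp p p *: 1.
Proof.
have E : vecR p * vecR p = \sum_i \sum_j (p ord0 i * p ord0 j) *:
    (clifford_gen R i * clifford_gen R j).
  rewrite vecR_mul; apply: eq_bigr => i _; rewrite mulr_sumr scaler_sumr.
  by apply: eq_bigr => j _; rewrite -scalerAr scalerA.
apply: (scalerI (a := 2 : R)); first by rewrite pnatr_eq0.
rewrite scaler_nat mulr2n {1}E exchange_big /= E -big_split /=.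
transitivity (\sum_i (-2 * p ord0 i ^+ 2) *: (1 : CR)); last first.
  by rewrite -scaler_suml scalerA -mulr_sumr mulNr mulrN.
apply: eq_bigr => i _; rewrite -big_split (bigD1 i) //= big1 => [|j ji].
  by rewrite addr0 -scalerDr (clifford_gen_anticomm R) eqxx mulr1 scalerA mulrC expr2.
rewrite [p _ _ * _]mulrC -scalerDr (clifford_gen_anticomm R) (negPf ji).
by rewrite mulr0 !scale0r scaler0.
Qed.

Lemma vecR_mulK p u : vecR p * (vecR p * u) = - dotp p p *: u.
Proof. by rewrite mulrA vecR_sqr -scalerAl mul1r. Qed.

Lemma cinner_vecR_sqr p u : cinner (vecR p * u) (vecR p * u) = dotp p p * cinner u u.
Proof. by rewrite cinner_vecR vecR_mulK cinnerZr mulNr opprK. Qed.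

End clifford_action.

Section hyperbolic.
Variables (R : realType) (m : nat).
Local Notation CR := (clifford R m).
Local Notation lam := (lebesgue_rV R m).
Implicit Types (gam eta : 'rV[R]_m -> CR) (p x : 'rV[R]_m) (s t : R)
  (C : {set 'I_m}).

Definition ch t p : R := (expR (t * enorm p) + expR (- (t * enorm p))) / 2.
(** This is sinh(t|p|) / |p|. At p = 0 the inverse of zero makes it 0 and not the limit t, which is
    harmless: it multiplies [vecR p], or is weighted by |p|^2, wherever it matters. *)
Definition sh t p : R := (expR (t * enorm p) - expR (- (t * enorm p))) / 2 / enorm p.

(* Transported by the Hartley transform, e^{-tD} acts as the operator hyp t. *)
Definition hyp t gam p : CR := ch t p *: gam p + sh t p *: (vecR p * gam (- p)).

(** Real counterpart of multiplication by -ip/|p|, and an involution away from the origin. Its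
    spectral parts [chip] and [chim] correspond to [chi_minus] and [chi_plus]; on them [hyp t] acts
    as e^{t|p|} and e^{-t|p|}. *)
Definition flip gam p : CR := (enorm p)^-1 *: (vecR p * gam (- p)).
Definition chip gam p : CR := 2^-1 *: (gam p + flip gam p).
Definition chim gam p : CR := 2^-1 *: (gam p - flip gam p).

Lemma hypE t gam p : hyp t gam p =
  expR (t * enorm p) *: chip gam p + expR (- (t * enorm p)) *: chim gam p.
Proof.
rewrite /hyp /chip /chim /flip /ch /sh; apply/ffunP => C.
rewrite !cE; ring.
Qed.

Lemma chN t p : ch t (- p) = ch t p. Proof. by rewrite /ch enormN. Qed.
Lemma shN t p : sh t (- p) = sh t p. Proof. by rewrite /sh enormN. Qed.

Lemma vec_enorm0 p : enorm p = 0 -> vecR p = 0.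
Proof.
move=> /eqP; rewrite enorm_eq0 => /eqP ->; rewrite /vecR big1// => j _.
by rewrite mxE scale0r.
Qed.

Lemma chD s t p : ch (s + t) p = ch s p * ch t p + enorm p ^+ 2 * (sh s p * sh t p).
Proof.
have [p0|p0] := eqVneq (enorm p) 0.
  by rewrite /ch /sh p0 !mulr0 oppr0 expR0 expr0n mul0r addr0; field.
by rewrite /ch /sh [(s + t) * _]mulrDl opprD !expRD; field.
Qed.

Lemma shD s t p : sh (s + t) p = ch s p * sh t p + sh s p * ch t p.
Proof.
have [p0|p0] := eqVneq (enorm p) 0.
  by rewrite /ch /sh p0 invr0 !mulr0 mul0r addr0.
by rewrite /ch /sh [(s + t) * _]mulrDl opprD !expRD; field.
Qed.

(** Two reflections cancel and p (-p) = |p|^2, so the group law reduces to the addition formulas of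
    cosh and sinh. *)
Lemma hypD s t gam p : hyp s (hyp t gam) p = hyp (s + t) gam p.
Proof.
have e : vecR p * (ch t p *: gam (- p) + sh t p *: (- vecR p * gam p)) =
    ch t p *: (vecR p * gam (- p)) + sh t p *: (enorm p ^+ 2 *: gam p).
  rewrite mulrDr -!scalerAr mulNr mulrN vecR_mulK -enorm_sqr scaleNr opprK //.
rewrite /hyp chN shN opprK chD shD vecRN e.
by apply/ffunP => C; rewrite !cE; ring.
Qed.

Lemma hyp0 gam p : hyp 0 gam p = gam p.
Proof.
rewrite /hyp /ch /sh mul0r oppr0 expR0 subrr !mul0r scale0r addr0.
by rewrite -[1 + 1](natrD _ 1 1) divff ?scale1r// pnatr_eq0.
Qed.

Lemma hyp_even (c : 'rV[R]_m -> R) t gam p : c (- p) = c p ->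
  hyp t (fun p => c p *: gam p) p = c p *: hyp t gam p.
Proof.
by move=> cN; rewrite /hyp cN -scalerAr scalerDr !scalerA ![c p * _]mulrC.
Qed.

Lemma enorm_flip gam p : enorm p *: flip gam p = vecR p * gam (- p).
Proof.
have [p0|p0] := eqVneq (enorm p) 0; last by rewrite /flip scalerA divff// scale1r.
by rewrite p0 scale0r vec_enorm0// mul0r.
Qed.

Lemma vecR_flip gam p : vecR p * flip gam (- p) = enorm p *: gam p.
Proof.
rewrite /flip enormN vecRN opprK mulNr scalerN mulrN -scalerAr vecR_mulK.
rewrite -enorm_sqr scaleNr scalerN opprK scalerA; congr (_ *: _).
have [->|p0] := eqVneq (enorm p) 0; first by rewrite invr0 mul0r.
by field; rewrite p0.
Qed.

(** This eigenvalue relation and that of [chim], of opposite sign, are what makes [Wext] solve its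
    equation. *)
Lemma vecR_chip gam p : vecR (- p) * chip gam (- p) = - (enorm p *: chip gam p).
Proof.
rewrite vecRN mulNr /chip -scalerAr mulrDr vecR_flip -enorm_flip -scalerDr.
by rewrite scalerA scalerA mulrC addrC.
Qed.

Lemma vecR_chim gam p : vecR (- p) * chim gam (- p) = enorm p *: chim gam p.
Proof.
rewrite vecRN mulNr /chim -scalerAr mulrBr vecR_flip -enorm_flip -scalerBr.
by rewrite scalerA scalerA mulrC -scalerN opprB.
Qed.

Lemma cinner_hyp t gam p : cinner (hyp t gam p) (hyp t gam p) =
  ch t p ^+ 2 * cinner (gam p) (gam p) +
  (ch t p * sh t p) * (2 * cinner (gam p) (vecR p * gam (- p))) +
  enorm p ^+ 2 * sh t p ^+ 2 * cinner (gam (- p)) (gam (- p)).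
Proof.
rewrite /hyp cinnerDl !cinnerDr !cinnerZl !cinnerZr cinner_vecR_sqr -enorm_sqr.
rewrite [cinner (_ * _) (gam p)]cinnerC; ring.
Qed.

(* Wext eps eta (t, .) is the Hartley transform of hyp (eps * t) eta: it solves
   (d_0 + eps D) f = 0. *)
Definition Wext eps eta (z : R * 'rV[R]_m) : CR :=
  [ffun C => expcas eps 1 (fun p => chip eta p C) z +
             expcas (- eps) 1 (fun p => chim eta p C) z].

Definition measc gam := forall C, measurable_fun setT (fun p => gam p C).
Definition exp_intc eta := forall C, exp_int (fun p => eta p C).

(** A combination of reflected coordinates with coefficients bounded by 1, from which measurability,
    square integrability and [exp_int] pass to [flip gam]. *)
Lemma flipE gam p C : flip gam p C = \sum_j
  (p ord0 j / enorm p * (-1) ^+ swaps [set j]%SET (symdiff [set j]%SET C)) *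
  gam (- p) (symdiff [set j]%SET C).
Proof.
rewrite /flip clifford_scaleE vecR_mulE mulr_sumr; apply: eq_bigr => j _.
by rewrite gen_mulE; ring.
Qed.

Lemma measurable_enormV : measurable_fun setT (fun p : 'rV[R]_m => (enorm p)^-1).
Proof.
rewrite (_ : (fun p : 'rV[R]_m => (enorm p)^-1) = (fun u : R => u `^ (-1)) \o @enorm R m).
  by apply: measurableT_comp; [exact: measurable_powR|exact: measurable_enorm].
by apply/funext => p /=; rewrite powR_inv1 ?enorm_ge0.
Qed.

Lemma measurable_flip_coef j k :
  measurable_fun setT (fun p : 'rV[R]_m => p ord0 j / enorm p * (-1) ^+ k : R).
Proof.
apply: measurable_funM => //; apply: measurable_funM; last exact: measurable_enormV.
exact: measurable_rV_coord.
Qed.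

Lemma flip_coef_le1 j k p : `|p ord0 j / enorm p * (-1) ^+ k| <= 1.
Proof.
rewrite mulrC normrMsign normrM normfV (ger0_norm (enorm_ge0 p)).
have [->|p0] := eqVneq (enorm p) 0; first by rewrite invr0 mulr0.
by rewrite ler_pdivrMr ?mul1r ?ler_coord_enorm// lt0r p0 enorm_ge0.
Qed.

Lemma measc_flip gam : measc gam -> measc (flip gam).
Proof.
move=> mg C; rewrite (funext (fun p => flipE gam p C)); apply: measurable_sum => j.
apply: measurable_funM; first exact: measurable_flip_coef.
exact: (measurable_comp_oppV (mg _)).
Qed.

Lemma exp_int_sum (I : Type) (r : seq I) (F : I -> 'rV[R]_m -> R) :
  (forall i, exp_int (F i)) -> exp_int (fun p => \sum_(i <- r) F i p).
Proof.
move=> iF k; apply: (@eq_L1 _ _ _ lam (fun p => \sum_(i <- r) expR (k * enorm p) * F i p)).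
  by move=> p; rewrite mulr_sumr.
by apply: L1_sum => i; exact: iF.
Qed.

Lemma eq_exp_int (xi zeta : 'rV[R]_m -> R) : xi =1 zeta -> exp_int xi -> exp_int zeta.
Proof. by move=> /funext ->. Qed.

Lemma exp_intc_flip eta : exp_intc eta -> exp_intc (flip eta).
Proof.
move=> ie C; rewrite (funext (fun p => flipE eta p C)); apply: exp_int_sum => j.
apply: (@exp_int_bM R m _ _ 1); [exact: measurable_flip_coef|exact: flip_coef_le1|].
exact: (exp_intN (ie _)).
Qed.

Lemma exp_intc_chip eta : exp_intc eta -> exp_intc (chip eta).
Proof.
move=> ie C; apply: (eq_exp_int _ (exp_intZ 2^-1 (exp_intD (ie C) (exp_intc_flip ie C)))) => p.
by rewrite !cE.
Qed.

Lemma exp_intc_chim eta : exp_intc eta -> exp_intc (chim eta).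
Proof.
move=> ie C; apply: (eq_exp_int _ (exp_intZ 2^-1 (exp_intD (ie C)
  (exp_intZ (-1) (exp_intc_flip ie C))))) => p.
by rewrite !cE mulN1r.
Qed.

Lemma exp_int_expM xi s : exp_int xi -> exp_int (fun p => expR (s * @enorm R m p) * xi p).
Proof.
by move=> ix r; apply: eq_L1 _ (ix (r + s)) => p; rewrite mulrA -expRD mulrDl.
Qed.

Lemma exp_intc_hyp t eta : exp_intc eta -> exp_intc (hyp t eta).
Proof.
move=> ie C; apply: (eq_exp_int _ (exp_intD (exp_int_expM t (exp_intc_chip ie C))
  (exp_int_expM (- t) (exp_intc_chim ie C)))) => p.
by rewrite hypE !cE mulNr.
Qed.

Lemma hartley_hyp eps eta t x C : exp_intc eta ->
  Wext eps eta (t, x) C = hartley (fun p => hyp (eps * t) eta p C) x.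
Proof.
move=> ie; rewrite ffunE /expcas /hartley -IntD; [|exact/L1_expcas/exp_intc_chip|
  exact/L1_expcas/exp_intc_chim].
apply: eq_Int => p; rewrite hypE !cE mul1r dotpC !mulNr; ring.
Qed.

Lemma expcas_sum s tau (I : Type) (r : seq I) (F : I -> 'rV[R]_m -> R) z :
  (forall i, exp_int (F i)) ->
  expcas s tau (fun p => \sum_(i <- r) F i p) z = \sum_(i <- r) expcas s tau (F i) z.
Proof.
move=> iF; rewrite /expcas -Int_sum; last by move=> i; apply: L1_expcas; exact: iF.
by apply: eq_Int => p; rewrite !mulr_sumr.
Qed.

Lemma expcasN s tau xi z : exp_int xi ->
  expcas s (- tau) xi z = expcas s tau (fun p => xi (- p)) z.
Proof.
move=> ix; rewrite /expcas -Int_rVN; last exact: L1_expcas.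
by apply: eq_Int => p; rewrite enormN dotpNl mulrNN.
Qed.

Lemma eq_expcas s tau (xi zeta : 'rV[R]_m -> R) z : xi =1 zeta -> expcas s tau xi z = expcas s tau zeta z.
Proof. by move=> /funext ->. Qed.

Definition derivc (v : R * 'rV[R]_m) (f : R * 'rV[R]_m -> CR) z : CR :=
  [ffun C => 'D_v (fun w => f w C) z].

Lemma WextE eps eta C : (fun z => Wext eps eta z C) =
  (fun z => expcas eps 1 (fun p => chip eta p C) z +
            expcas (- eps) 1 (fun p => chim eta p C) z).
Proof. by apply/funext => z; rewrite ffunE. Qed.

Lemma C1D (f g : R * 'rV[R]_m -> R) : C1 f -> C1 g -> C1 (fun z => f z + g z).
Proof.
move=> [df cf] [dg cg]; split=> [z|v]; first exact: differentiableD.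
rewrite (_ : (fun z => _) = fun z => 'D_v f z + 'D_v g z).
  by move=> z; apply: cvgD; [exact: cf|exact: cg].
by apply/funext => z; rewrite deriveD//; exact: diff_derivable.
Qed.

Lemma Wext_C1 eps eta C : `|eps| <= 1 -> exp_intc eta -> C1 (fun z => Wext eps eta z C).
Proof.
move=> eps1 ie; rewrite WextE; apply: C1D; apply: expcas_C1; rewrite ?normrN ?normr1//.
  exact: exp_intc_chip.
exact: exp_intc_chim.
Qed.

Lemma expcas_deriveZ s tau xi v z : `|s| <= 1 -> `|tau| <= 1 -> exp_int xi ->
  'D_v (expcas s tau xi) z =
  v.1 * (s * expcas s tau (fun p => enorm p * xi p) z) +
  \sum_j v.2 ord0 j * (tau * expcas s (- tau) (fun p => p ord0 j * xi p) z).
Proof.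
move=> s1 t1 ix; rewrite expcas_derive//; congr (_ * _ + _).
  exact: (@expcasZ R m s tau s _ z (exp_int_enorm ix)).
apply: eq_bigr => j _; congr (_ * _).
exact: (@expcasZ R m s (- tau) tau _ z (exp_int_coord j ix)).
Qed.

Lemma Wext_derive eps eta v z C : `|eps| <= 1 -> exp_intc eta ->
  'D_v (fun z => Wext eps eta z C) z =
  v.1 * eps * (expcas eps 1 (fun p => enorm p * chip eta p C) z -
               expcas (- eps) 1 (fun p => enorm p * chim eta p C) z) +
  \sum_j v.2 ord0 j * (expcas eps (-1) (fun p => p ord0 j * chip eta p C) z +
                       expcas (- eps) (-1) (fun p => p ord0 j * chim eta p C) z).
Proof.
move=> e1 ie; have ip := exp_intc_chip ie C; have im := exp_intc_chim ie C.
have e1' : `|- eps| <= 1 by rewrite normrN.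
have t1 : `|1 : R| <= 1 by rewrite normr1.
set f := expcas eps 1 (fun p => chip eta p C).
set g := expcas (- eps) 1 (fun p => chim eta p C).
have -> : (fun z => Wext eps eta z C) = f + g by rewrite WextE.
pose a j := expcas eps (-1) (fun p => p ord0 j * chip eta p C) z.
pose b j := expcas (- eps) (-1) (fun p => p ord0 j * chim eta p C) z.
pose A := expcas eps 1 (fun p => enorm p * chip eta p C) z.
pose B := expcas (- eps) 1 (fun p => enorm p * chim eta p C) z.
have d1 : 'D_v f z = v.1 * (eps * A) + \sum_j v.2 ord0 j * (1 * a j).
  exact: expcas_deriveZ.
have d2 : 'D_v g z = v.1 * (- eps * B) + \sum_j v.2 ord0 j * (1 * b j).
  exact: expcas_deriveZ.
have df : derivable f z v by apply: diff_derivable; exact: (expcas_C1 e1 t1 ip).1.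
have dg : derivable g z v by apply: diff_derivable; exact: (expcas_C1 e1' t1 im).1.
suff : 'D_v (f + g) z = v.1 * eps * (A - B) + \sum_j v.2 ord0 j * (a j + b j) by [].
rewrite (deriveD df dg); clearbody f g a b A B; rewrite d1 d2.
under [in RHS]eq_bigr => j _ do rewrite mulrDr.
rewrite big_split /=.
under [X in _ + X + _ = _]eq_bigr => j _ do rewrite mul1r.
under [X in _ + (_ + X) = _]eq_bigr => j _ do rewrite mul1r.
by ring.
Qed.

Lemma exp_intc_gen eta j : exp_intc eta -> exp_intc (fun p => clifford_gen R j * eta p).
Proof.
move=> ie C; apply: (eq_exp_int (fun p => esym (gen_mulE _ _ _))); exact: exp_intZ.
Qed.

Lemma exp_intc_vecR eta : exp_intc eta -> exp_intc (fun p => vecR p * eta p).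
Proof.
move=> ie C; apply: (eq_exp_int (fun p => esym (vecR_mulE p _ C))).
by apply: exp_int_sum => j; apply: exp_int_coord; exact: (exp_intc_gen j ie).
Qed.

(** The substitution p -> -p restores the argument of [cas] that the differentiation had reflected,
    and reflects the multiplier instead. *)
Lemma expcas_vecR s eta C z : exp_intc eta ->
  \sum_j expcas s (-1) (fun p => p ord0 j * (clifford_gen R j * eta p) C) z =
  expcas s 1 (fun p => (vecR (- p) * eta (- p)) C) z.
Proof.
move=> ie; etransitivity; last exact: (@expcasN s 1 _ z (exp_intc_vecR ie C)).
etransitivity; last first.
  by apply: eq_expcas => p; exact: (esym (vecR_mulE p (eta p) C)).
rewrite expcas_sum// => j; apply: exp_int_coord; exact: (exp_intc_gen j ie).
Qed.

(** The time derivative is eps (A - B), with |p| inserted in the two spectral parts; by [vecR_chip]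
    and [vecR_chim] the Dirac sum is B - A. *)
Lemma Wext_dirac eps eta z : `|eps| <= 1 -> exp_intc eta ->
  derivc (1, 0) (Wext eps eta) z +
  eps *: \sum_j clifford_gen R j * derivc (0, delta_mx ord0 j) (Wext eps eta) z = 0.
Proof.
move=> e1 ie; have ip := exp_intc_chip ie; have im := exp_intc_chim ie.
apply/ffunP => C; rewrite !cE ffunE sum_ffunE Wext_derive//=.
rewrite [X in _ + X + _]big1 => [|j _]; last by rewrite mxE mul0r.
pose a s (eta : 'rV[R]_m -> CR) j :=
  expcas s (-1) (fun p => p ord0 j * (clifford_gen R j * eta p) C) z.
have dE j : (clifford_gen R j * derivc (0, delta_mx ord0 j) (Wext eps eta) z) C =
    a eps (chip eta) j + a (- eps) (chim eta) j.
  rewrite gen_mulE ffunE Wext_derive// mul0r mul0r add0r (bigD1 j)//= big1 => [|i ij].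
    rewrite mxE !eqxx mul1r addr0 mulrDr.
    have aE s eta' : exp_intc eta' -> (-1) ^+ swaps [set j]%SET (symdiff [set j]%SET C) *
       expcas s (-1) (fun p => p ord0 j * eta' p (symdiff [set j]%SET C)) z = a s eta' j.
      move=> ie'; etransitivity.
        exact: (esym (@expcasZ R m s (-1) _ _ z (exp_int_coord j (ie' _)))).
      by apply: eq_expcas => p; rewrite gen_mulE mulrCA.
    by congr (_ + _); exact: aE.
  by rewrite mxE (negPf ij) andbF mul0r.
have -> : \sum_j (clifford_gen R j * derivc (0, delta_mx ord0 j) (Wext eps eta) z) C =
    \sum_j a eps (chip eta) j + \sum_j a (- eps) (chim eta) j.
  by rewrite -big_split; apply: eq_bigr => j _; exact: dE.
set A := expcas eps 1 _ z; set B := expcas (- eps) 1 _ z.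
have S1 : \sum_j a eps (chip eta) j = - A.
  transitivity (-1 * A); last by rewrite mulN1r.
  etransitivity; first exact: (@expcas_vecR eps (chip eta) C z ip).
  etransitivity; last exact: (@expcasZ R m eps 1 (-1) _ z (exp_int_enorm (ip C))).
  by apply: eq_expcas => p; rewrite vecR_chip !cE mulN1r.
have S2 : \sum_j a (- eps) (chim eta) j = B.
  etransitivity; first exact: (@expcas_vecR (- eps) (chim eta) C z im).
  by apply: eq_expcas => p; rewrite vecR_chim cE.
by clearbody a A B; rewrite S1 S2 ffunE; ring.
Qed.

End hyperbolic.

(** * The energy identity *)

Section weighted.
Context d (T : measurableType d) (R : realType).
Variables (mu nu : {measure set T -> \bar R}) (w : T -> R).
Hypothesis w0 : forall x, 0 <= w x.
Hypothesis mw : measurable_fun setT w.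
Hypothesis nuE : forall A, measurable A -> nu A = (\int[mu]_(x in A) (w x)%:E)%E.

Import HBNNSimple.

(** The case of simple functions, extended below by monotone convergence. *)
Let integral_weighted_nnsfun (h : {nnsfun T >-> R}) :
  (\int[nu]_x (h x)%:E = \int[mu]_x (w x * h x)%:E)%E.
Proof.
have m1 r : measurable (h @^-1` [set r]) by [].
pose g (r : R) (x : T) := ((w x)%:E * (r%:E * (\1_(h @^-1` [set r]) x)%:E))%E.
have g0 r x : (0 <= g r x)%E by apply: mule_ge0; [rewrite lee_fin|exact: nnfun_muleindic_ge0].
have mg r : measurable_fun setT (g r).
  by apply/measurable_EFinP; apply: measurable_funM => //; exact: measurable_funM.
have -> : (\int[mu]_x (w x * h x)%:E = \int[mu]_x \sum_(r \in range h) g r x)%E.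
  apply: eq_integral => x _; rewrite EFinM fimfunE -fsumEFin// ge0_mule_fsumr//.
  by move=> r; exact: nnfun_muleindic_ge0.
rewrite ge0_integral_fsum// integralT_nnsfun sintegralE.
apply: eq_fsbigr => r _; rewrite nuE// /g integral_mkcond.
have [r0|r0] := leP 0 r; last first.
  have A0 : h @^-1` [set r] = set0 by exact: preimage_nnfun0.
  rewrite A0 !integral0_eq ?mule0// => x _; first by rewrite indic0 mule0 mule0.
  by rewrite patchE in_set0.
have mA : measurable_fun setT ((fun x => (w x)%:E) \_ (h @^-1` [set r])).
  apply: (measurable_restrictT _ (m1 r)).1; apply: measurable_funTS.
  exact/measurable_EFinP.
have A0 x : setT x -> (0 <= ((fun x => (w x)%:E) \_ (h @^-1` [set r])) x)%E.
  by move=> _; apply: erestrict_ge0 => y _; rewrite lee_fin.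
rewrite -(@ge0_integralZl _ _ _ mu setT measurableT _ mA r%:E A0); last by rewrite lee_fin.
apply: eq_integral => x _; rewrite patchE indicE; case: (x \in _); rewrite /=.
  by rewrite mule1 muleC.
by rewrite !mule0.
Qed.

Lemma ge0_integral_weighted (f : T -> R) : measurable_fun setT f -> (forall x, 0 <= f x) ->
  (\int[nu]_x (f x)%:E = \int[mu]_x (w x * f x)%:E)%E.
Proof.
move=> mf f0; have mF : measurable_fun setT (EFin \o f) by exact/measurable_EFinP.
pose f_ := nnsfun_approx measurableT mF.
have cvf x : (f_ n x)%:E @[n --> \oo] --> (f x)%:E.
  by apply: (cvg_nnsfun_approx measurableT mF) => // y _; rewrite lee_fin.
transitivity (limn (fun n => \int[nu]_x (f_ n x)%:E)%E).
  rewrite -monotone_convergence//.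
  - by apply: eq_integral => x _; apply/esym/cvg_lim => //; exact: cvf.
  - by move=> n; exact/measurable_EFinP.
  - by move=> n x _; rewrite lee_fin.
  - by move=> x _ a b ab; rewrite lee_fin; exact/lefP/nd_nnsfun_approx.
rewrite (funext (fun n => integral_weighted_nnsfun (f_ n))) -monotone_convergence//.
- apply: eq_integral => x _; apply/cvg_lim => //.
  under eq_fun do rewrite EFinM; rewrite EFinM.
  by apply: cvgeZl => //; exact: cvf.
- by move=> n; apply/measurable_EFinP; exact: measurable_funM.
- by move=> n x _; rewrite lee_fin mulr_ge0.
- by move=> x _ a b ab; rewrite lee_fin ler_wpM2l//; exact/lefP/nd_nnsfun_approx.
Qed.

Lemma L1_weighted (f : T -> R) : measurable_fun setT f ->
  L1 nu f <-> L1 mu (fun x => w x * f x).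
Proof.
move=> mf.
have e : (\int[nu]_x (`|f x|)%:E = \int[mu]_x (`|w x * f x|)%:E)%E.
  rewrite ge0_integral_weighted//; last exact: measurableT_comp.
  by apply: eq_integral => x _; rewrite normrM (ger0_norm (w0 x)).
split=> [/integrableP[_ h]|/integrableP[_ h]]; apply: L1_lty => //.
- exact: measurable_funM.
- by rewrite -e.
- by rewrite e.
Qed.

Lemma ge0_Int_weighted (f : T -> R) : measurable_fun setT f -> (forall x, 0 <= f x) ->
  \int[nu]_x f x = \int[mu]_x (w x * f x).
Proof. by move=> mf f0; rewrite /Rintegral ge0_integral_weighted. Qed.

(** Follows from the nonnegative case for |f| and for |f| + f, by subtraction. *)
Lemma Int_weighted (f : T -> R) : L1 nu f -> \int[nu]_x f x = \int[mu]_x (w x * f x).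
Proof.
move=> i1; have mf := L1_measurable i1; have mn := L1_norm i1.
have i2 := L1D mn i1.
have e : \int[nu]_x (`|f x| + f x) = \int[mu]_x (w x * (`|f x| + f x)).
  apply: ge0_Int_weighted; first exact: L1_measurable i2.
  by move=> x; rewrite -[f x]opprK subr_ge0 normrN ler_norm.
have e' := ge0_Int_weighted (L1_measurable mn) (fun x => normr_ge0 (f x)).
have j := (L1_weighted mf).1 i1; have j' := (L1_weighted (L1_measurable mn)).1 mn.
move: e; under [X in _ = X -> _]eq_Int do rewrite mulrDr.
by rewrite !IntD// e' => /addrI.
Qed.

End weighted.

Section double_integral_sym.
Context d1 d2 (T1 : measurableType d1) (T2 : measurableType d2) (R : realType).
Variables (m1 : {sigma_finite_measure set T1 -> \bar R})
          (m2 : {sigma_finite_measure set T2 -> \bar R}).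

Lemma L1_prod_sym (F : T1 * T2 -> R) (G : T2 -> R) : measurable_fun setT F ->
  (forall y, L1 m1 (fun x => F (x, y))) ->
  L1 m2 G -> (forall y, \int[m1]_x `|F (x, y)| <= G y) ->
  L1 (m1 \x m2)%E F.
Proof.
move=> mF iF iG FG; apply/integrable21ltyP; first exact/measurable_EFinP.
apply: (@le_lt_trans _ _ (\int[m2]_x (G x)%:E)%E); last by rewrite IntE ?ltry.
apply: ge0_le_integral => //.
- by move=> x _; exact: integral_ge0.
- apply: (measurable_fun_fubini_tonelli_G (fun z => (`|F z|)%:E)) => //.
  by apply/measurable_EFinP; exact: measurableT_comp.
- by apply/measurable_EFinP; exact: L1_measurable iG.
- move=> y _; rewrite /= IntE; last exact: L1_norm (iF y).
  by rewrite lee_fin.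
Qed.

End double_integral_sym.

Section energy.
Variables (R : realType) (m : nat).
Local Notation CR := (clifford R m).
Local Notation lam := (lebesgue_rV R m).
Local Notation w := (@gauss_weight R).
Implicit Types (gam eta : 'rV[R]_m -> CR) (p x : 'rV[R]_m) (s t : R)
  (C : {set 'I_m}).

Lemma gauss_weight_ge0 t : 0 <= w t.
Proof. by rewrite mulr_ge0 ?invr_ge0 ?sqrtr_ge0 ?expR_ge0. Qed.

Lemma measurable_gauss_weight : measurable_fun setT w.
Proof. by apply: measurable_funM => //; exact: measurable_gauss_fun. Qed.

(** Completing the square. For k = 2|p| and -2|p| the value is e^{|p|^2}; the factor 1/sqrt(pi) of
    the weight makes it 1 at k = 0. *)
Lemma gauss_weight_exp k : L1 (leb R) (fun t => w t * expR (k * t)) /\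
  \int[leb R]_t (w t * expR (k * t)) = expR (k ^+ 2 / 4).
Proof.
pose f (t : R) := expR (- (1 * t ^+ 2)).
have [i1 e1] := @L1_gauss R 1 ltr01; rewrite divr1 in e1.
have E t : (Num.sqrt pi)^-1 * expR (k ^+ 2 / 4) * f (- (k / 2) + 1 * t) = w t * expR (k * t).
  by rewrite /f /gauss_weight -!mulrA -!expRD; congr (_ * expR _); field.
have i2 := L1_affine (- (k / 2)) (oner_neq0 R) i1.
have e2 := Int_affine (- (k / 2)) (oner_neq0 R) i1.
split; first exact: (@eq_L1 _ _ _ (leb R) _ _ E (L1Z _ i2)).
rewrite -(@eq_Int _ _ _ (leb R) _ _ E) IntZ// -[X in _ * X]mul1r -[X in _ * (X * _)]normr1 -e2 e1.
by rewrite mulrAC mulVf ?mul1r// sqrtr_eq0 -ltNge pi_gt0.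
Qed.

Let E p := expR (enorm p ^+ 2).

(* With q = |p|, the cross term is a multiple of sinh (2tq), odd in t, and
   \int w(t) cosh (2tq) dt = e^{q^2}. *)
Lemma hyp_energy gam p :
  L1 (leb R) (fun t => w t * cinner (hyp t gam p) (hyp t gam p)) /\
  \int[leb R]_t (w t * cinner (hyp t gam p) (hyp t gam p)) =
  2^-1 * (E p + 1) * cinner (gam p) (gam p) +
  2^-1 * (E p - 1) * cinner (gam (- p)) (gam (- p)).
Proof.
set q := enorm p; set a := cinner (gam p) (gam p).
set b := cinner (gam (- p)) (gam (- p)).
set c := 2 * cinner (gam p) (vecR p * gam (- p)).
have [i1 e1] := gauss_weight_exp (2 * q).
have [i2 e2] := gauss_weight_exp (- (2 * q)).
have [i0 e0] := gauss_weight_exp 0.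
pose k1 := 4^-1 * (a + b + c / q); pose k2 := 4^-1 * (a + b - c / q).
pose k0 := 2^-1 * (a - b).
have eqt t : k1 * (w t * expR (2 * q * t)) + k2 * (w t * expR (- (2 * q) * t)) +
   k0 * (w t * expR (0 * t)) = w t * cinner (hyp t gam p) (hyp t gam p).
  rewrite cinner_hyp -/a -/b -/c -/q mul0r expR0.
  have -> : expR (2 * q * t) = expR (t * q) ^+ 2.
    by rewrite expr2 -expRD; congr expR; ring.
  have -> : expR (- (2 * q) * t) = expR (- (t * q)) ^+ 2.
    by rewrite expr2 -expRD; congr expR; ring.
  have h : expR (t * q) * expR (- (t * q)) = 1 by rewrite -expRD subrr expR0.
  rewrite /ch /sh -/q /k1 /k2 /k0; set u := expR (t * q) in h *; set v := expR _ in h *.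
  have [q0|q0] := eqVneq q 0.
    have -> : u = 1 by rewrite /u q0 mulr0 expR0.
    have -> : v = 1 by rewrite /v q0 mulr0 oppr0 expR0.
    by rewrite q0 invr0 expr0n; field.
  have -> : 2^-1 * (a - b) * (w t * 1) = 2^-1 * (a - b) * (w t * (u * v)) by rewrite h.
  by field.
have i3 := L1D (L1D (L1Z k1 i1) (L1Z k2 i2)) (L1Z k0 i0).
split; first exact: (@eq_L1 _ _ _ (leb R) _ _ eqt i3).
rewrite -(@eq_Int _ _ _ (leb R) _ _ eqt) IntD//; [|exact: L1D (L1Z k1 i1) (L1Z k2 i2)|exact: L1Z].
rewrite IntD; [|exact: L1Z|exact: L1Z].
rewrite !IntZ// e1 e2 e0 sqrrN expr0n mul0r expR0.
have -> : (2 * q) ^+ 2 / 4 = q ^+ 2 by field.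
by rewrite /E -/q /k1 /k2 /k0; move: (c / q) => r; field.
Qed.

Definition L2c gam := forall C, L2 lam (fun p => gam p C).

(** Multiplication by e^{-|p|^2/2}, the action of the heat semigroup at time 1 on the frequency
    side. *)
Definition gaussc gam p : CR := gaussV 2^-1 p *: gam p.

Lemma gauss_half_sqr p : gaussV 2^-1 p ^+ 2 = (E p)^-1.
Proof.
by rewrite /E /gaussV expr2 -expRD -expRN enorm_sqr; congr expR; field.
Qed.

Lemma hyp_energy_gauss gam p :
  L1 (leb R) (fun t => w t * cinner (hyp t (gaussc gam) p) (hyp t (gaussc gam) p)) /\
  \int[leb R]_t (w t * cinner (hyp t (gaussc gam) p) (hyp t (gaussc gam) p)) =
  2^-1 * (1 + (E p)^-1) * cinner (gam p) (gam p) +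
  2^-1 * (1 - (E p)^-1) * cinner (gam (- p)) (gam (- p)).
Proof.
have [i e] := hyp_energy (gaussc gam) p; split; rewrite // e.
rewrite /gaussc !cinnerZl !cinnerZr gaussVN !mulrA -!(mulrA _ (gaussV _ _) (gaussV _ _)).
rewrite -expr2 gauss_half_sqr.
have : E p != 0 by rewrite gt_eqF ?expR_gt0.
by move: (E p) => e0 h; field.
Qed.

Lemma measurable_expRt_enorm s :
  measurable_fun setT (fun z : R * 'rV[R]_m => expR (s * z.1 * enorm z.2)).
Proof.
apply: measurableT_comp => //; apply: measurable_funM.
  by apply: measurable_funM => //; exact: measurable_fst.
exact: measurableT_comp (@measurable_enorm R m) measurable_snd.
Qed.

Lemma measurable_chip gam C : measc gam -> measurable_fun setT (fun p => chip gam p C).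
Proof.
move=> mg; rewrite (_ : (fun p => chip gam p C) = fun p => 2^-1 * (gam p C + flip gam p C)).
  by apply: measurable_funM => //; apply: measurable_funD => //; exact: measc_flip.
by apply/funext => p; rewrite !cE.
Qed.

Lemma measurable_chim gam C : measc gam -> measurable_fun setT (fun p => chim gam p C).
Proof.
move=> mg; rewrite (_ : (fun p => chim gam p C) = fun p => 2^-1 * (gam p C - flip gam p C)).
  by apply: measurable_funM => //; apply: measurable_funB => //; exact: measc_flip.
by apply/funext => p; rewrite !cE.
Qed.

Lemma measurable_hyp gam C : measc gam ->
  measurable_fun setT (fun z : R * 'rV[R]_m => hyp z.1 gam z.2 C).
Proof.
move=> mg; rewrite (_ : (fun z => _) = fun z : R * 'rV[R]_m =>
    expR (1 * z.1 * enorm z.2) * chip gam z.2 C + expR (-1 * z.1 * enorm z.2) * chim gam z.2 C).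
  apply: measurable_funD; apply: measurable_funM; try exact: measurable_expRt_enorm.
    exact: measurableT_comp (measurable_chip C mg) measurable_snd.
  exact: measurableT_comp (measurable_chim C mg) measurable_snd.
by apply/funext => z; rewrite hypE !cE !mulNr !mul1r.
Qed.

Lemma measc_gauss gam : measc gam -> measc (gaussc gam).
Proof.
move=> mg C; rewrite (_ : (fun p => _) = fun p => gaussV 2^-1 p * gam p C).
  by apply: measurable_funM => //; exact: measurable_gaussV.
by apply/funext => p; rewrite cE.
Qed.

Lemma L2_rVN (f : 'rV[R]_m -> R) : L2 lam f -> L2 lam (fun p => f (- p)).
Proof. by move=> [mf i]; split; [exact: measurable_comp_oppV|exact: (L1_rVN i)]. Qed.

Lemma L2c_meas gam : L2c gam -> measc gam.
Proof. by move=> h C; exact: L2_measurable (h C). Qed.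

Lemma L2c_flip gam : L2c gam -> L2c (flip gam).
Proof.
move=> g2 C; rewrite (funext (fun p => flipE gam p C)); apply: L2_sum => j.
apply: (@L2_bM _ _ _ lam 1); [exact: measurable_flip_coef|exact: flip_coef_le1|].
exact: (L2_rVN (g2 _)).
Qed.

Lemma L2c_chip gam : L2c gam -> L2c (chip gam).
Proof.
move=> g2 C; rewrite (_ : (fun p => chip gam p C) = fun p => 2^-1 * (gam p C + flip gam p C)).
  by apply: L2Z; apply: L2D => //; exact: L2c_flip.
by apply/funext => p; rewrite !cE.
Qed.

Lemma L2c_chim gam : L2c gam -> L2c (chim gam).
Proof.
move=> g2 C; rewrite (_ : (fun p => chim gam p C) = fun p => 2^-1 * (gam p C - flip gam p C)).
  by apply: L2Z; apply: L2B => //; exact: L2c_flip.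
by apply/funext => p; rewrite !cE.
Qed.

Lemma gauss_exp_le s p : `|expR (s * enorm p) * gaussV 2^-1 p| <= expR (s ^+ 2 / 2).
Proof.
rewrite ger0_norm ?mulr_ge0 ?expR_ge0// /gaussV -expRD ler_expR -enorm_sqr.
have := sqr_ge0 (s - enorm p); rewrite sqrrB; set q := enorm p => h; nra.
Qed.

Lemma hyp_gauss t gam p : hyp t (gaussc gam) p = gaussV 2^-1 p *: hyp t gam p.
Proof. by rewrite /gaussc hyp_even// gaussVN. Qed.

Lemma measurable_exp_gauss s :
  measurable_fun setT (fun p => expR (s * @enorm R m p) * gaussV 2^-1 p).
Proof. by apply: measurable_funM; [exact: measurable_expnorm|exact: measurable_gaussV]. Qed.

Lemma L2c_hyp_gauss t gam : L2c gam -> L2c (hyp t (gaussc gam)).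
Proof.
move=> g2 C; rewrite (_ : (fun p => _) = fun p =>
    expR (t * enorm p) * gaussV 2^-1 p * chip gam p C +
    expR (- t * enorm p) * gaussV 2^-1 p * chim gam p C); last first.
  by apply/funext => p; rewrite hyp_gauss hypE !cE !mulNr; ring.
apply: L2D.
  apply: (@L2_bM _ _ _ lam (expR (t ^+ 2 / 2))); last exact: L2c_chip.
    exact: measurable_exp_gauss.
  exact: gauss_exp_le.
apply: (@L2_bM _ _ _ lam (expR ((- t) ^+ 2 / 2))); last exact: L2c_chim.
  exact: measurable_exp_gauss.
exact: gauss_exp_le.
Qed.

Lemma exp_intc_gauss gam : L2c gam -> exp_intc (gaussc gam).
Proof.
move=> g2 C; have i2 : (0 : R) < 2^-1 by rewrite invr_gt0.
apply: eq_exp_int (exp_int_gaussM i2 (g2 C)) => p; by rewrite cE.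
Qed.

Let G gam (z : R * 'rV[R]_m) :=
  w z.1 * cinner (hyp z.1 (gaussc gam) z.2) (hyp z.1 (gaussc gam) z.2).

Lemma measurable_energy gam : measc gam -> measurable_fun setT (G gam).
Proof.
move=> mg; apply: measurable_funM.
  exact: measurableT_comp measurable_gauss_weight measurable_fst.
apply: measurable_sum => C; apply: measurable_funM;
  exact: measurable_hyp (measc_gauss mg).
Qed.

Let a gam p := cinner (gam p) (gam p).

Lemma energy_ge0 gam z : 0 <= G gam z.
Proof. by rewrite mulr_ge0 ?gauss_weight_ge0 ?cinner_ge0. Qed.

Lemma Einv_bound p : 0 < (E p)^-1 <= 1.
Proof. by rewrite invr_gt0 expR_gt0/= invf_le1 ?expR_gt0// -[leLHS]expR0 ler_expR sqr_ge0. Qed.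

Lemma measurable_E : measurable_fun setT (fun p => (E p)^-1).
Proof.
rewrite (_ : (fun p => _) = fun p => gaussV 1 p); first exact: measurable_gaussV.
by apply/funext => p; rewrite /E -expRN enorm_sqr /gaussV mul1r.
Qed.

(** Tonelli with the time integral inside. The terms in e^{-|p|^2} come with opposite signs at p and
    at -p, and cancel in the integral over p because that factor is even. *)
Lemma energy_L1 gam : measc gam -> L1 lam (a gam) ->
  L1 (leb R \x lam)%E (G gam) /\
  \int[(leb R \x lam)%E]_z G gam z = \int[lam]_p a gam p.
Proof.
move=> mg ia; have ia' := L1_rVN ia.
pose c p := 2^-1 * (E p)^-1.
have cb p : `|c p| <= 1.
  have /andP[h1 h2] := Einv_bound p; rewrite ger0_norm /c; last by lra.
  lra.
have mc : measurable_fun setT c by apply: measurable_funM => //; exact: measurable_E.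
have j1 := @L1_bM _ _ _ lam 1 c _ mc cb ia.
have j2 := @L1_bM _ _ _ lam 1 c _ mc cb ia'.
pose B p := 2^-1 * a gam p + c p * a gam p + (2^-1 * a gam (- p) - c p * a gam (- p)).
have iB : L1 lam B by apply: L1D; [apply: L1D => //; exact: L1Z|apply: L1B => //; exact: L1Z].
have BE p : \int[leb R]_t G gam (t, p) = B p.
  rewrite (hyp_energy_gauss gam p).2 /B /c /a; ring.
have iG : L1 (leb R \x lam)%E (G gam).
  apply: (@L1_prod_sym _ _ _ _ _ (leb R) lam _ B) => //.
  - exact: measurable_energy.
  - by move=> p; exact: (hyp_energy_gauss gam p).1.
  - move=> p; rewrite -BE; under eq_Int do rewrite ger0_norm ?energy_ge0//.
    exact: lexx.
split=> //; have [_ ->] := Fubini2 iG (fun p => (hyp_energy_gauss gam p).1).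
rewrite (eq_Int _ BE) /B IntD; [|by apply: L1D => //; exact: L1Z|by apply: L1B => //; exact: L1Z].
rewrite IntD//; last exact: L1Z.
rewrite IntB//; last exact: L1Z.
have e1 : \int[lam]_p (c p * a gam (- p)) = \int[lam]_p (c p * a gam p).
  rewrite -(Int_rVN j1); apply: eq_Int => p; congr (_ * _).
  by rewrite /c /E enormN.
rewrite !IntZ// e1 (Int_rVN ia); lra.
Qed.

(** As 0 < e^{-|p|^2} <= 1, the time integral is at least half of |gam(p)|^2. In the surjectivity
    proof this is what makes the reconstructed datum square integrable. *)
Lemma energy_L1_inv gam : measc gam -> L1 (leb R \x lam)%E (G gam) -> L1 lam (a gam).
Proof.
move=> mg iG; have [iB _] := Fubini2 iG (fun p => (hyp_energy_gauss gam p).1).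
apply: (L1_le _ (L1Z 2 iB)).
  by apply: measurable_sum => C; apply: measurable_funM; exact: mg.
move=> p; rewrite ger0_norm ?cinner_ge0// (hyp_energy_gauss gam p).2.
have := cinner_ge0 (gam p); have := cinner_ge0 (gam (- p)).
have /andP[] := Einv_bound p; rewrite -/(a gam p) -/(a gam (- p)).
by move: (E p)^-1 (a gam p) (a gam (- p)) => e u v *; nra.
Qed.

End energy.

Section transform_energy.
Variables (R : realType) (m : nat).
Local Notation CR := (clifford R m).
Local Notation lam := (lebesgue_rV R m).
Local Notation w := (@gauss_weight R).
Implicit Types (gam eta : 'rV[R]_m -> CR) (p x : 'rV[R]_m) (s t : R)
  (C : {set 'I_m}).

Lemma normr1_le1 : `|1 : R| <= 1. Proof. by rewrite normr1. Qed.

Definition Wgauss gam := Wext 1 (gaussc gam).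

Lemma Wgauss_hartley gam t C : L2c gam ->
  is_hartley (fun p => hyp t (gaussc gam) p C) (fun x => Wgauss gam (t, x) C).
Proof.
move=> g2; have ie := exp_intc_gauss g2.
have -> : (fun x => Wgauss gam (t, x) C) = hartley (fun p => hyp t (gaussc gam) p C).
  by apply/funext => x; have := @hartley_hyp R m 1 _ t x C ie; rewrite [1 * t]mul1r; exact.
apply: is_hartley_L1; first exact: exp_int_L1 (exp_intc_hyp t ie C).
exact: L2c_hyp_gauss.
Qed.

Lemma Wgauss_continuous gam C : L2c gam -> continuous (fun z => Wgauss gam z C).
Proof.
move=> g2 z; apply: differentiable_continuous.
exact: (Wext_C1 C normr1_le1 (exp_intc_gauss g2)).1.
Qed.

Lemma weight_space_time (f : R * 'rV[R]_m -> R) : measurable_fun setT f ->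
  measurable_fun setT (fun z : R * 'rV[R]_m => w z.1 * f z).
Proof.
move=> mf; apply: measurable_funM => //.
exact: measurableT_comp (@measurable_gauss_weight R) measurable_fst.
Qed.

Lemma sqr_cinner_le (u : CR) C : u C ^+ 2 <= cinner u u.
Proof.
rewrite /cinner (bigD1 C)//= expr2 lerDl; apply: sumr_ge0 => D _.
by rewrite -expr2 sqr_ge0.
Qed.

(** Plancherel's identity on each slice, integrated against the weight in time. *)
Lemma Wgauss_energy gam C : L2c gam ->
  [/\ L1 (leb R \x lam)%E (fun z => w z.1 * hyp z.1 (gaussc gam) z.2 C ^+ 2),
      L1 (leb R \x lam)%E (fun z => w z.1 * Wgauss gam z C ^+ 2) &
      \int[(leb R \x lam)%E]_z (w z.1 * Wgauss gam z C ^+ 2) =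
      (2 * pi) ^+ m *
      \int[(leb R \x lam)%E]_z (w z.1 * hyp z.1 (gaussc gam) z.2 C ^+ 2)].
Proof.
move=> g2; have mg := L2c_meas g2.
have ia : L1 lam (fun p => cinner (gam p) (gam p)).
  by apply: L1_sum => D; apply: L2M.
have [iG _] := energy_L1 mg ia.
pose H z : R := w z.1 * hyp z.1 (gaussc gam) z.2 C ^+ 2.
have iH : L1 (leb R \x lam)%E H.
  apply: (@L1_le _ _ _ (leb R \x lam)%E _ _ _ iG) => [|z].
    apply: weight_space_time; apply: measurable_funX.
    exact: measurable_hyp (measc_gauss mg).
  rewrite /H normrM (ger0_norm (gauss_weight_ge0 _)) (ger0_norm (sqr_ge0 _)).
  by rewrite ler_wpM2l ?gauss_weight_ge0// sqr_cinner_le.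
have sH t : L1 lam (fun p => H (t, p)).
  exact: (@L1Z _ _ _ lam (w t) _ (L2_sqr (L2c_hyp_gauss t g2 C))).
have [iH1 eH] := Fubini1 iH sH.
have hW t := Wgauss_hartley t C g2.
have W2 t : L2 lam (fun x => Wgauss gam (t, x) C) by case: (hW t).
have sW t : L1 lam (fun x => w t * Wgauss gam (t, x) C ^+ 2).
  by exact: (@L1Z _ _ _ lam (w t) _ (L2_sqr (W2 t))).
have WE t : \int[lam]_x (w t * Wgauss gam (t, x) C ^+ 2) =
    (2 * pi) ^+ m * \int[lam]_p H (t, p).
  rewrite (@IntZ _ _ _ lam (w t) _ (L2_sqr (W2 t))) (is_hartley_norm (hW t)).
  rewrite (@IntZ _ _ _ lam (w t) _ (L2_sqr (L2c_hyp_gauss t g2 C))).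
  by rewrite mulrCA.
have iW : L1 (leb R \x lam)%E (fun z => w z.1 * Wgauss gam z C ^+ 2).
  apply: (@L1_prod _ _ _ _ _ (leb R) lam _ _ _ sW (L1Z ((2 * pi) ^+ m) iH1)).
    apply: weight_space_time; apply: measurable_funX.
    by apply: continuous_measurable_space_time; exact: Wgauss_continuous.
  move=> t; rewrite -WE le_eqVlt; apply/orP; left; apply/eqP/eq_Int => x.
  by rewrite ger0_norm//= mulr_ge0 ?gauss_weight_ge0 ?sqr_ge0.
split=> //; have [_ ->] := Fubini1 iW sW.
by rewrite (@eq_Int _ _ _ (leb R) _ _ WE) IntZ// -/H eH.
Qed.

Lemma Wgauss_isometry gam : L2c gam ->
  \sum_C \int[(leb R \x lam)%E]_z (w z.1 * Wgauss gam z C ^+ 2) =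
  (2 * pi) ^+ m * \sum_C \int[lam]_p (gam p C ^+ 2).
Proof.
move=> g2; have mg := L2c_meas g2.
have ia : L1 lam (fun p => cinner (gam p) (gam p)).
  by apply: L1_sum => D; apply: L2M.
have [iG eG] := energy_L1 mg ia.
have eW C : _ := let: And3 _ _ e := Wgauss_energy C g2 in e.
rewrite (eq_bigr _ (fun C _ => eW C)).
rewrite -mulr_sumr; congr (_ * _).
rewrite -(@Int_sum _ _ _ (leb R \x lam)%E _ _ xpredT
  (fun C z => w z.1 * hyp z.1 (gaussc gam) z.2 C ^+ 2)); last first.
  by move=> C; have [h _ _] := Wgauss_energy C g2; exact: h.
rewrite -(@Int_sum _ _ _ lam _ _ xpredT (fun C p => gam p C ^+ 2)); last first.
  by move=> C; exact: L2_sqr (g2 C).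
transitivity (\int[lam]_p cinner (gam p) (gam p)).
  rewrite -eG; apply: eq_Int => z; rewrite -mulr_sumr; congr (_ * _).
by apply: eq_Int => p.
Qed.

Lemma gauss_measureE A : measurable A ->
  gauss_measure R m A = (\int[(leb R \x lam)%E]_(z in A) (w z.1)%:E)%E.
Proof. by []. Qed.

Lemma L2_gauss_measure (f : R * 'rV[R]_m -> R) : measurable_fun setT f ->
  L2 (gauss_measure R m) f <-> L1 (leb R \x lam)%E (fun z => w z.1 * f z ^+ 2).
Proof.
move=> mf; have mw : measurable_fun setT (fun z : R * 'rV[R]_m => w z.1).
  exact: measurableT_comp (@measurable_gauss_weight R) measurable_fst.
have h := @L1_weighted _ _ _ (leb R \x lam)%E (gauss_measure R m) (fun z => w z.1)
  (fun z => gauss_weight_ge0 z.1) mw gauss_measureE _ (measurable_funX 2 mf).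
by split=> [[_ /h]//|i]; split=> //; exact/h.
Qed.

Lemma Int_gauss_measure (f : R * 'rV[R]_m -> R) : L1 (gauss_measure R m) f ->
  \int[gauss_measure R m]_z f z = \int[(leb R \x lam)%E]_z (w z.1 * f z).
Proof.
have mw : measurable_fun setT (fun z : R * 'rV[R]_m => w z.1).
  exact: measurableT_comp (@measurable_gauss_weight R) measurable_fst.
exact: (@Int_weighted _ _ _ (leb R \x lam)%E (gauss_measure R m) (fun z => w z.1)
  (fun z => gauss_weight_ge0 z.1) mw gauss_measureE).
Qed.

End transform_energy.

(** * The kernel of V *)

Section kernel.
Variables (R : realType) (m : nat).
Local Notation CR := (clifford R m).
Local Notation lam := (lebesgue_rV R m).
Implicit Types (gam phi : 'rV[R]_m -> CR) (p x y : 'rV[R]_m) (s t : R)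
  (A C : {set 'I_m}) (z : R * 'rV[R]_m).

Let hb s p : R := expR (s * enorm p) * gaussV 2^-1 p.

Let hbN s p : hb s (- p) = hb s p.
Proof. by rewrite /hb enormN gaussVN. Qed.

Let hb_le s p : `|hb s p| <= expR (s ^+ 2 / 2).
Proof. exact: gauss_exp_le. Qed.

Let L1_hb s : L1 lam (hb s).
Proof.
have i2 : (0 : R) < 2^-1 by rewrite invr_gt0.
have := @exp_int_gauss R m (fun=> 1) 2^-1 1 i2 (measurable_cst _).
move=> /(_ (fun p => normr1_le1 R)) h.
by apply: eq_L1 _ (h s) => p; rewrite mulr1.
Qed.

(** Together with [ker_odd], e^{-|p|^2/2} e^{-itp} = [ker_even] - i [ker_odd], where the parities
    are those in p. Times e^{i(p, x - y)}, this has an imaginary part that is odd in p, so the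
    kernel of the transform is real. *)
Definition ker_even t p : CR := (2^-1 * (hb t p + hb (- t) p)) *: 1.
Definition ker_odd t p : CR :=
  (2^-1 * (hb t p - hb (- t) p)) *: flip (fun=> 1) p.

Lemma ker_evenN t p : ker_even t (- p) = ker_even t p.
Proof. by rewrite /ker_even !hbN. Qed.

Lemma ker_oddN t p : ker_odd t (- p) = - ker_odd t p.
Proof. by rewrite /ker_odd !hbN /flip enormN vecRN mulNr !scalerN. Qed.

Lemma ker_evenE t p : ker_even t p = (gaussV 2^-1 p * ch t p) *: 1.
Proof. by rewrite /ker_even /hb /ch mulNr; congr (_ *: _); field. Qed.

Lemma ker_oddE t p : ker_odd t p = (gaussV 2^-1 p * sh t p) *: vecR p.
Proof.
rewrite /ker_odd /hb /flip /sh mulNr mulr1 scalerA; congr (_ *: _).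
by move: (enorm p)^-1 => q; field.
Qed.

Lemma ker_hyp t gam p :
  ker_even t p * gam p + ker_odd t p * gam (- p) = hyp t (gaussc gam) p.
Proof.
rewrite hyp_gauss ker_evenE ker_oddE /hyp -!scalerAl mul1r scalerDr !scalerA //.
Qed.

Lemma L2_bounded (f : 'rV[R]_m -> R) k : (forall p, `|f p| <= k) -> L1 lam f -> L2 lam f.
Proof.
move=> fk i1; have mf := L1_measurable i1; split=> //.
apply: (L1_le _ (L1Z k (L1_norm i1))); first exact: measurable_funX.
by move=> p; rewrite normrX expr2 ler_wpM2r.
Qed.

Lemma one_coord_le1 C : `|(1 : CR) C| <= 1.
Proof. by rewrite ffunE normr_nat; case: (C == _). Qed.

Lemma flip1_le p C : `|flip (fun=> (1 : CR)) p C| <= m%:R.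
Proof.
rewrite flipE; apply: le_trans (ler_norm_sum _ _ _) _.
rewrite -[X in _ <= X%:R]card_ord -sum1_card natr_sum; apply: ler_sum => j _.
by rewrite normrM mulr_ile1// ?flip_coef_le1// one_coord_le1.
Qed.

Let L1_hbD t : L1 lam (fun p => 2^-1 * (hb t p + hb (- t) p)).
Proof. by apply: L1Z; apply: L1D; exact: L1_hb. Qed.

Let L1_hbB t : L1 lam (fun p => 2^-1 * (hb t p - hb (- t) p)).
Proof. by apply: L1Z; apply: L1B; exact: L1_hb. Qed.

Let B t : R := expR (t ^+ 2 / 2).

Let hbD_le t p : `|2^-1 * (hb t p + hb (- t) p)| <= B t.
Proof.
rewrite normrM ger0_norm ?invr_ge0//.
have := ler_normD (hb t p) (hb (- t) p); have := hb_le t p; have := hb_le (- t) p.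
rewrite sqrrN -/(B t); lra.
Qed.

Let hbB_le t p : `|2^-1 * (hb t p - hb (- t) p)| <= B t.
Proof.
rewrite normrM ger0_norm ?invr_ge0//.
have := ler_normB (hb t p) (hb (- t) p); have := hb_le t p; have := hb_le (- t) p.
rewrite sqrrN -/(B t); lra.
Qed.

Lemma L1_ker_even t C : L1 lam (fun p => ker_even t p C).
Proof.
rewrite (_ : (fun p => _) = fun p => (1 : CR) C * (2^-1 * (hb t p + hb (- t) p))).
  exact: L1Z.
by apply/funext => p; rewrite clifford_scaleE mulrC.
Qed.

Lemma measc_flip1 : measc (flip (fun=> (1 : CR))).
Proof. by apply: measc_flip => C; exact: measurable_cst. Qed.

Lemma L1_ker_odd t C : L1 lam (fun p => ker_odd t p C).
Proof.
rewrite (_ : (fun p => _) = fun p => flip (fun=> (1 : CR)) p C *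
    (2^-1 * (hb t p - hb (- t) p))); last first.
  by apply/funext => p; rewrite clifford_scaleE mulrC.
apply: (@L1_bM _ _ _ lam m%:R); [exact: measc_flip1|move=> p; exact: flip1_le|].
exact: L1_hbB.
Qed.

Lemma L2_ker_even t : L2c (ker_even t).
Proof.
move=> C; apply: (@L2_bounded _ (B t)); last exact: L1_ker_even.
move=> p; rewrite clifford_scaleE normrM -[leRHS]mulr1.
by apply: ler_pM => //; exact: one_coord_le1.
Qed.

Lemma L2_ker_odd t : L2c (ker_odd t).
Proof.
move=> C; apply: (@L2_bounded _ (B t * m%:R)); last exact: L1_ker_odd.
move=> p; rewrite clifford_scaleE normrM.
by apply: ler_pM => //; exact: flip1_le.
Qed.

Definition real_kernel z y : CR := [ffun C => \int[lam]_p
  (cos (dotp p (z.2 - y)) * ker_even z.1 p C +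
   sin (dotp p (z.2 - y)) * ker_odd z.1 p C)].

(** The function of [p] whose Hartley transform is the kernel as a function of [y]; [hartley_mul]
    can then move the transform onto the other factor. *)
Definition kernel_hartley z p : CR :=
  cas (dotp p z.2) *: ker_even z.1 p - cas (- dotp p z.2) *: ker_odd z.1 p.

Lemma kernel_hartleyE z p C : kernel_hartley z p C =
  cas (dotp p z.2) * ker_even z.1 p C - cas (- dotp p z.2) * ker_odd z.1 p C.
Proof.
rewrite /kernel_hartley clifford_addE clifford_oppE.
by rewrite (clifford_scaleE (cas (dotp p z.2))) (clifford_scaleE (cas (- dotp p z.2))).
Qed.

Lemma measurable_dotpc x : measurable_fun setT (fun p => dotp p x).
Proof. by apply: measurable_dotp => //; exact: measurable_id. Qed.

Lemma L1_cos_dotp (f : 'rV[R]_m -> R) x : L1 lam f ->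
  L1 lam (fun p => cos (dotp p x) * f p).
Proof.
move=> i1; apply: (@L1_bM _ _ _ lam 1) => // [|p].
  by apply: measurableT_comp; [exact: measurable_cos|exact: measurable_dotpc].
by rewrite ler_norml cos_geN1 cos_le1.
Qed.

Lemma L1_sin_dotp (f : 'rV[R]_m -> R) x : L1 lam f ->
  L1 lam (fun p => sin (dotp p x) * f p).
Proof.
move=> i1; apply: (@L1_bM _ _ _ lam 1) => // [|p].
  by apply: measurableT_comp; [exact: measurable_sin|exact: measurable_dotpc].
by rewrite ler_norml sin_geN1 sin_le1.
Qed.

(** Adding [g], which is odd in p and has integral 0, completes the cosines and sines of (p, x - y)
    into products of [cas]. *)
Lemma real_kernelE z y C :
  real_kernel z y C = hartley (fun p => kernel_hartley z p C) y.
Proof.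
have ie := L1_ker_even z.1 C; have io := L1_ker_odd z.1 C.
pose f p := cos (dotp p (z.2 - y)) * ker_even z.1 p C +
  sin (dotp p (z.2 - y)) * ker_odd z.1 p C.
pose g p := sin (dotp p (z.2 + y)) * ker_even z.1 p C -
  cos (dotp p (z.2 + y)) * ker_odd z.1 p C.
have if_ : L1 lam f by apply: L1D; [exact: L1_cos_dotp|exact: L1_sin_dotp].
have ig : L1 lam g by apply: L1B; [exact: L1_sin_dotp|exact: L1_cos_dotp].
have g0 : \int[lam]_p g p = 0.
  apply: Int_rV_odd => // p.
  by rewrite /g dotpNl sinN cosN ker_evenN ker_oddN !cE; ring.
rewrite ffunE -/f /hartley; transitivity (\int[lam]_p (f p + g p)).
  by rewrite (IntD if_ ig) g0 addr0.
apply: eq_Int => p; rewrite /f /g kernel_hartleyE dotpBr dotpDr (dotpC y).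
transitivity (cas (dotp p y) * cas (dotp p z.2) * ker_even z.1 p C -
    cas (dotp p y) * cas (- dotp p z.2) * ker_odd z.1 p C); last by ring.
rewrite !cas_mul opprK.
have -> : dotp p y - dotp p z.2 = - (dotp p z.2 - dotp p y) by rewrite opprB.
by rewrite cosN sinN [dotp p y + _]addrC; ring.
Qed.

Lemma L1_kernel_hartley z C : L1 lam (fun p => kernel_hartley z p C).
Proof.
rewrite (_ : (fun p => _) = fun p => cas (1 * dotp p z.2) * ker_even z.1 p C -
   cas (-1 * dotp p z.2) * ker_odd z.1 p C); last first.
  by apply/funext => p; rewrite kernel_hartleyE mul1r mulN1r.
apply: L1B; (apply: (@L1_bM _ _ _ lam 2); [exact: measurable_cas_dotpc|
  by move=> p; exact: cas_le|]).
  exact: L1_ker_even.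
exact: L1_ker_odd.
Qed.

Lemma L2_kernel_hartley z : L2c (kernel_hartley z).
Proof.
move=> C; rewrite (_ : (fun p => _) = fun p => cas (1 * dotp p z.2) * ker_even z.1 p C -
   cas (-1 * dotp p z.2) * ker_odd z.1 p C); last first.
  by apply/funext => p; rewrite kernel_hartleyE mul1r mulN1r.
apply: L2B; (apply: (@L2_bM _ _ _ lam 2); [exact: measurable_cas_dotpc|
  by move=> p; exact: cas_le|]).
  exact: L2_ker_even.
exact: L2_ker_odd.
Qed.

Lemma L2_real_kernel z : L2c (real_kernel z).
Proof.
move=> C; rewrite (funext (fun y => real_kernelE z y C)).
by case: (hartley_L2 (L1_kernel_hartley z C) (L2_kernel_hartley z C)).
Qed.

Lemma L1_cmul phi gam C : L2c phi -> L2c gam -> L1 lam (fun p => (phi p * gam p) C).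
Proof.
move=> f2 g2; rewrite (funext (fun p => clifford_mulE (phi p) (gam p) C)).
by apply: L1_sum => A; apply: L1Z; apply: L2M.
Qed.

Lemma Int_cmul phi gam C : L2c phi -> L2c gam -> \int[lam]_p (phi p * gam p) C =
  \sum_A (-1) ^+ swaps A (symdiff A C) * \int[lam]_p (phi p A * gam p (symdiff A C)).
Proof.
move=> f2 g2; rewrite (eq_Int _ (fun p => clifford_mulE (phi p) (gam p) C)).
have i A : L1 lam (fun p => phi p A * gam p (symdiff A C)) by exact: L2M.
rewrite (@Int_sum _ _ _ lam _ _ xpredT (fun A p => (-1) ^+ swaps A (symdiff A C) *
  (phi p A * gam p (symdiff A C))) (fun A => L1Z _ (i A))).
by apply: eq_bigr => A _; rewrite IntZ.
Qed.

(** Duality moves the kernel to the frequency side. Reflecting p in the odd part alone aligns both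
    [cas] factors and leaves [ker_even] gam(p) + [ker_odd] gam(-p), which is [hyp] of the Gaussian
    datum by [ker_hyp]. *)
Lemma real_kernel_transform phi gam z C : (forall A, is_hartley (phi^~ A) (gam^~ A)) ->
  \int[lam]_y (real_kernel z y * phi y) C = Wgauss gam z C.
Proof.
move=> h.
have f2 : L2c phi by move=> A; case: (h A).
have g2 : L2c gam by move=> A; case: (h A).
transitivity (\int[lam]_p (kernel_hartley z p * gam p) C).
  rewrite (Int_cmul C (L2_real_kernel z) f2) (Int_cmul C (L2_kernel_hartley z) g2).
  apply: eq_bigr => A _; congr (_ * _); have [_ _ hA] := h (symdiff A C).
  rewrite -(hA _ (L1_kernel_hartley z A) (L2_kernel_hartley z A)).
  by apply: eq_Int => y; rewrite real_kernelE.
have i1 := L1_cmul C (L2_ker_even z.1) g2.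
have i2 := L1_cmul C (L2_ker_odd z.1) g2.
have c1 (f : 'rV[R]_m -> R) tau : L1 lam f -> L1 lam (fun p => cas (tau * dotp p z.2) * f p).
  move=> i; apply: (@L1_bM _ _ _ lam 2) => // [|p]; first exact: measurable_cas_dotpc.
  exact: cas_le.
transitivity (\int[lam]_p (cas (1 * dotp p z.2) * (ker_even z.1 p * gam p) C) -
    \int[lam]_p (cas (-1 * dotp p z.2) * (ker_odd z.1 p * gam p) C)).
  rewrite -IntB; [|exact: c1|exact: c1]; apply: eq_Int => p.
  by rewrite /kernel_hartley mulrBl -!scalerAl !cE mul1r mulN1r.
rewrite -(Int_rVN (c1 _ (-1) i2)).
have i3 := L1_rVN (c1 _ (-1) i2).
rewrite -IntB//; last exact: c1.
have ie := exp_intc_gauss g2.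
have -> : Wgauss gam z C = hartley (fun p => hyp z.1 (gaussc gam) p C) z.2.
  case: z {i1 i2 c1 i3} => t x /=.
  by have := @hartley_hyp R m 1 _ t x C ie; rewrite [1 * t]mul1r.
apply: eq_Int => p; rewrite ker_oddN (mulNr (ker_odd _ _)) -ker_hyp (clifford_addE (_ * _)).
by rewrite (clifford_oppE (_ * _)) mul1r dotpNl mulN1r opprK dotpC; ring.
Qed.

End kernel.

(** * Surjectivity *)

Section C1_algebra.
Variables (R : realType) (m : nat).
Implicit Types f g : R * 'rV[R]_m -> R.

Lemma deriveD_C1 f g v z : C1 f -> C1 g ->
  'D_v (fun z => f z + g z) z = 'D_v f z + 'D_v g z.
Proof.
move=> [df _] [dg _].
have Df : derivable f z v by exact: diff_derivable.
have Dg : derivable g z v by exact: diff_derivable.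
exact: (deriveD Df Dg).
Qed.

Lemma deriveM_C1 f g v z : C1 f -> C1 g ->
  'D_v (fun z => f z * g z) z = 'D_v f z * g z + f z * 'D_v g z.
Proof.
move=> [df _] [dg _].
have Df : derivable f z v by exact: diff_derivable.
have Dg : derivable g z v by exact: diff_derivable.
have e := deriveM Df Dg.
rewrite (_ : 'D_v _ z = 'D_v (f * g) z)// e addrC; congr (_ + _).
exact: mulrC.
Qed.

Lemma C1M f g : C1 f -> C1 g -> C1 (fun z => f z * g z).
Proof.
move=> Cf Cg; have [df cf] := Cf; have [dg cg] := Cg.
split=> [z|v]; first exact: differentiableM.
rewrite (funext (fun z => deriveM_C1 v z Cf Cg)) => z.
apply: cvgD; apply: cvgM; [exact: cf| |  |exact: cg];
  exact: differentiable_continuous.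
Qed.

Lemma C1_cst (k : R) : C1 (fun _ : R * 'rV[R]_m => k).
Proof.
split=> [z|v]; first exact: differentiable_cst.
by rewrite (funext (fun z => derive_cst k z v)) => z; exact: cvg_cst.
Qed.

Lemma deriveZ_C1 (k : R) f v z : C1 f -> 'D_v (fun z => k * f z) z = k * 'D_v f z.
Proof. by move=> Cf; rewrite (deriveM_C1 v z (C1_cst k) Cf) derive_cst mul0r add0r. Qed.

Lemma C1_sum (I : Type) (r : seq I) (F : I -> R * 'rV[R]_m -> R) :
  (forall i, C1 (F i)) -> C1 (fun z => \sum_(i <- r) F i z) /\
  forall v z, 'D_v (fun z => \sum_(i <- r) F i z) z = \sum_(i <- r) 'D_v (F i) z.
Proof.
move=> CF; elim: r => [|i r [C e]].
  rewrite (_ : (fun z => _) = fun=> 0); last by apply/funext => z; rewrite big_nil.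
  by split=> [|v z]; [exact: C1_cst|rewrite derive_cst big_nil].
rewrite (_ : (fun z => \sum_(j <- i :: r) F j z) = fun z => F i z + \sum_(j <- r) F j z).
  by split=> [|v z]; [exact: C1D|rewrite deriveD_C1// e big_cons].
by apply/funext => z; rewrite big_cons.
Qed.

End C1_algebra.

Section divergence.
Variables (R : realType) (m : nat).
Local Notation CR := (clifford R m).
Local Notation Z := (R * 'rV[R]_m)%type.
Implicit Types (f h : Z -> CR) (v z : Z).

Definition C1c f := forall C, C1 (fun z => f z C).

Lemma cinner_C1 f h : C1c f -> C1c h -> C1 (fun z => cinner (f z) (h z)) /\
  forall v z, 'D_v (fun z => cinner (f z) (h z)) z =
    cinner (derivc v f z) (h z) + cinner (f z) (derivc v h z).
Proof.
move=> Cf Ch; have [C e] := C1_sum (index_enum {set 'I_m}) (fun C => C1M (Cf C) (Ch C)).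
split=> // v z; rewrite e -big_split; apply: eq_bigr => D _.
by rewrite (deriveM_C1 v z (Cf D) (Ch D)) !ffunE.
Qed.

Lemma C1c_gen j f : C1c f -> C1c (fun z => clifford_gen R j * f z).
Proof.
move=> Cf C; rewrite (funext (fun z => gen_mulE (f z) j C)).
exact: C1M (C1_cst _ _) (Cf _).
Qed.

Lemma derivc_gen j f v z : C1c f ->
  derivc v (fun z => clifford_gen R j * f z) z = clifford_gen R j * derivc v f z.
Proof.
move=> Cf; apply/ffunP => C; rewrite ffunE gen_mulE ffunE.
by rewrite (funext (fun z => gen_mulE (f z) j C)) deriveZ_C1.
Qed.

(** By skew-adjointness of e_j the divergence of the flux is <Df, h> - <f, Dh>; the two equations
    make it cancel the time derivative of <f, h>. *)
Lemma dirac_divergence f h z : C1c f -> C1c h ->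
  derivc (1, 0) f z + \sum_j clifford_gen R j * derivc (0, delta_mx ord0 j) f z = 0 ->
  derivc (1, 0) h z + -1 *: \sum_j clifford_gen R j * derivc (0, delta_mx ord0 j) h z = 0 ->
  'D_(1, 0) (fun z => cinner (f z) (h z)) z +
  \sum_j 'D_(0, delta_mx ord0 j) (fun z => cinner (clifford_gen R j * f z) (h z)) z = 0.
Proof.
move=> Cf Ch ef eh; rewrite (cinner_C1 Cf Ch).2.
under eq_bigr => j _ do rewrite (cinner_C1 (C1c_gen j Cf) Ch).2 derivc_gen// [cinner (_ * f z) _]cinner_gen.
rewrite big_split /= sumrN -cinner_suml -cinner_sumr.
have := congr1 (fun u => cinner u (h z)) ef; rewrite cinnerDl.
have -> : cinner 0 (h z) = 0 by rewrite /cinner big1// => C _; rewrite ffunE mul0r.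
have := congr1 (fun u => cinner (f z) u) eh; rewrite cinnerDr cinnerZr mulN1r.
have -> : cinner (f z) 0 = 0 by rewrite /cinner big1// => C _; rewrite ffunE mulr0.
lra.
Qed.

End divergence.

Section ae_double_integrals.
Context d1 d2 (T1 : measurableType d1) (T2 : measurableType d2) (R : realType).
Variables (m1 : {sigma_finite_measure set T1 -> \bar R})
          (m2 : {sigma_finite_measure set T2 -> \bar R}).

(** A bound on almost every slice, since only almost every slice of a monogenic square integrable
    function is itself square integrable. *)
Lemma L1_prod_ae (F : T1 * T2 -> R) (G : T1 -> \bar R) : measurable_fun setT F ->
  m1.-integrable setT G -> (forall x, 0 <= G x)%E ->
  {ae m1, forall x, (\int[m2]_y `|F (x, y)|%:E <= G x)%E} ->
  L1 (m1 \x m2)%E F.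
Proof.
move=> mF iG G0 FG; apply/integrable12ltyP; first exact/measurable_EFinP.
apply: (@le_lt_trans _ _ (\int[m1]_x G x)%E).
  apply: ae_ge0_le_integral => //.
  - by move=> x _; exact: integral_ge0.
  - apply: (measurable_fun_fubini_tonelli_F (fun z => (`|F z|)%:E)) => //.
    by apply/measurable_EFinP; exact: measurableT_comp.
  - exact: measurable_int iG.
  - by apply: filterS FG => x h _.
have /integrableP[_] := iG; apply: le_lt_trans.
apply: ge0_le_integral => //; [exact: measurable_int iG| |].
  by apply: measurableT_comp => //; exact: measurable_int iG.
by move=> x _; exact: lee_abs.
Qed.

End ae_double_integrals.

Section hartley_scale.
Variables (R : realType) (n : nat).
Local Notation lam := (lebesgue_rV R n).
Implicit Types f g : 'rV[R]_n -> R.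

Lemma is_hartleyZ k f g : is_hartley f g ->
  is_hartley (fun x => k * f x) (fun x => k * g x).
Proof.
move=> [f2 g2 h]; split; [exact: L2Z|exact: L2Z|] => psi p1 p2.
have [H2 _] := hartley_L2 p1 p2.
rewrite (eq_Int _ (g := fun x => k * (hartley psi x * f x))) => [|x]; last by rewrite mulrCA.
rewrite (eq_Int _ (f := fun x => psi x * (k * g x)) (g := fun x => k * (psi x * g x))) => [|x]; last by rewrite mulrCA.
by rewrite !IntZ ?h//; exact: L2M.
Qed.

Lemma is_hartley_ae f f' g : L2 lam f' -> {ae lam, forall x, f x = f' x} ->
  is_hartley f g -> is_hartley f' g.
Proof.
move=> f2' ff' [f2 g2 h]; split=> // psi p1 p2; rewrite -h//.
have mH := L2_measurable (hartley_L2 p1 p2).1.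
apply: ae_eq_Int; [exact: measurable_funM (L2_measurable f2')|
  exact: measurable_funM (L2_measurable f2)|].
by apply: filterS ff' => x ->.
Qed.

End hartley_scale.

(** * Evolution of the slices of a monogenic function *)

Section evolution.
Variables (R : realType) (m : nat).
Local Notation CR := (clifford R m).
Local Notation lam := (lebesgue_rV R m).
Local Notation Z := (R * 'rV[R]_m)%type.
Implicit Types (gam eta beta : 'rV[R]_m -> CR) (p x : 'rV[R]_m) (s t a b : R)
  (C : {set 'I_m}).

Lemma cinnerNl (u v : CR) : cinner (- u) v = - cinner u v.
Proof. by rewrite -scaleN1r cinnerZl mulN1r. Qed.

Lemma cinnerNr (u v : CR) : cinner u (- v) = - cinner u v.
Proof. by rewrite cinnerC cinnerNl cinnerC. Qed.

Lemma L1_cinner gam beta : L2c gam -> L2c beta -> L1 lam (fun p => cinner (gam p) (beta p)).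
Proof. by move=> g2 b2; apply: L1_sum => C; exact: L2M. Qed.

Lemma Int_cinner gam beta : L2c gam -> L2c beta ->
  \int[lam]_p cinner (gam p) (beta p) = \sum_C \int[lam]_p (gam p C * beta p C).
Proof.
by move=> g2 b2; rewrite -Int_sum// => C; exact: L2M.
Qed.

(** With [hyp_splitB], isolates the two summands of [hyp], so that each is integrable against L^2
    functions once [hyp t gam] and [hyp (- t) gam] are square integrable. *)
Lemma hyp_split t gam p : ch t p *: gam p = 2^-1 *: (hyp t gam p + hyp (- t) gam p).
Proof.
have cN : ch (- t) p = ch t p by rewrite /ch mulNr opprK addrC.
have sN : sh (- t) p = - sh t p by rewrite /sh mulNr opprK -!mulNr opprB.
by apply/ffunP => C; rewrite /hyp cN sN !cE; field.
Qed.

Lemma hyp_splitB t gam p :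
  sh t p *: (vecR p * gam (- p)) = 2^-1 *: (hyp t gam p - hyp (- t) gam p).
Proof.
have cN : ch (- t) p = ch t p by rewrite /ch mulNr opprK addrC.
have sN : sh (- t) p = - sh t p by rewrite /sh mulNr opprK -!mulNr opprB.
by apply/ffunP => C; rewrite /hyp cN sN !cE; field.
Qed.

(** Self-adjointness: moving [vecR p] across the inner product costs a sign, and the change of
    variable p -> -p costs another. *)
Lemma hyp_sym t eta beta : (forall s, L2c (hyp s eta)) -> L2c beta ->
  \int[lam]_p cinner (hyp t eta p) (beta p) = \int[lam]_p cinner (eta p) (hyp t beta p).
Proof.
move=> e2 b2.
have l1 : L1 lam (fun p => cinner (ch t p *: eta p) (beta p)).
  apply: eq_L1 _ (L1Z 2^-1 (L1D (L1_cinner (e2 t) b2) (L1_cinner (e2 (- t)) b2))) => p.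
  by rewrite hyp_split cinnerZl cinnerDl.
have l2 : L1 lam (fun p => cinner (sh t p *: (vecR p * eta (- p))) (beta p)).
  apply: eq_L1 _ (L1Z 2^-1 (L1B (L1_cinner (e2 t) b2) (L1_cinner (e2 (- t)) b2))) => p.
  by rewrite hyp_splitB cinnerZl cinnerDl cinnerNl.
rewrite (eq_Int _ (fun p => cinnerDl (ch t p *: eta p) _ (beta p))) IntD//.
rewrite -(Int_rVN l2) -IntD//; last exact: (L1_rVN l2).
apply: eq_Int => p; rewrite /hyp cinnerDr !cinnerZl !cinnerZr cinner_vecR.
by rewrite vecRN opprK shN mulNr cinnerNr opprK.
Qed.

(** One Gaussian keeps [hyp s (gaussc eta)] square integrable; the other is the one that the
    conservation law puts on its test data. *)
Definition gauss2 eta := gaussc (gaussc eta).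

Lemma L2c_gaussc eta : L2c eta -> L2c (gaussc eta).
Proof. by move=> e2; have := L2c_hyp_gauss 0 e2; rewrite (funext (hyp0 (gaussc eta))). Qed.

Lemma L2c_hartley_ex beta : L2c beta ->
  exists gam, forall C, is_hartley (fun x => beta x C) (fun p => gam p C).
Proof.
move=> f2; have H C : exists g, is_hartley (fun x => beta x C) g.
  by have [g [_ [h _ _ _]]] := is_hartley_ex (f2 C); exists g.
have [g hg] := choice H; exists (fun p => [ffun C => g C p]) => C.
have e : (fun p => ([ffun C => g C p] : CR) C) = g C by apply/funext => p; rewrite ffunE.
by have := hg C; rewrite -[X in is_hartley _ X -> _]e.
Qed.

End evolution.

Section monogenic_evolution.
Variables (R : realType) (m : nat).
Local Notation CR := (clifford R m).
Local Notation lam := (lebesgue_rV R m).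
Local Notation w := (@gauss_weight R).
Local Notation Z := (R * 'rV[R]_m)%type.
Implicit Types (gam eta beta : 'rV[R]_m -> CR) (p x : 'rV[R]_m) (s t a b : R)
  (C : {set 'I_m}).

Variable f : Z -> CR.
Hypothesis Cf : C1c f.
Hypothesis Df : forall z, derivc (1, 0) f z +
  \sum_j clifford_gen R j * derivc (0, delta_mx ord0 j) f z = 0.
Hypothesis f2 : forall C, L2 (gauss_measure R m) (fun z => f z C).

Let cf C : continuous (fun z => f z C).
Proof. by move=> z; apply: differentiable_continuous; exact: (Cf C).1. Qed.

Let mf C : measurable_fun setT (fun z => f z C).
Proof. exact: continuous_measurable_space_time. Qed.

Let iwf C : L1 (leb R \x lam)%E (fun z => w z.1 * f z C ^+ 2).
Proof. exact: (L2_gauss_measure (mf C)).1. Qed.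

Definition good t := L2c (fun x => f (t, x)).

Lemma gauss_weight_gt0 t : 0 < w t.
Proof. by rewrite mulr_gt0 ?expR_gt0// invr_gt0 sqrtr_gt0 pi_gt0. Qed.

Let F (z : Z) := w z.1 * cinner (f z) (f z).

Lemma L1_weight_cinner : L1 (leb R \x lam)%E F.
Proof.
apply: (@eq_L1 _ _ _ (leb R \x lam)%E (fun z => \sum_C (w z.1 * f z C ^+ 2))).
  by move=> z; rewrite /F /cinner mulr_sumr; apply: eq_bigr => C _; rewrite expr2.
by apply: L1_sum => C; exact: iwf.
Qed.

Lemma good_ae : {ae leb R, forall t, good t}.
Proof.
have := ae_integrable1 L1_weight_cinner; apply: filterS => t it C.
have i1 : L1 lam (fun x => (w t)^-1 * (w t * cinner (f (t, x)) (f (t, x)))).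
  by apply: L1Z; exact: it.
have mft : measurable_fun setT (fun x => f (t, x) C).
  by apply: continuous_measurable_rV; apply: (@continuous_slice R m (fun z => f z C)).
split=> //; apply: (L1_le _ i1); first exact: measurable_funX.
move=> x; rewrite mulKf ?gt_eqF ?gauss_weight_gt0// ger0_norm ?sqr_ge0//.
exact: sqr_cinner_le.
Qed.

Section slab.
Variable eta' : 'rV[R]_m -> CR.
Hypothesis e2 : L2c eta'.
Let eta := gaussc eta'.
Let h := Wext (-1) eta.
Let ie : exp_intc eta := exp_intc_gauss e2.

Let N1 : `|- 1 : R| <= 1. Proof. by rewrite normrN1. Qed.

Let Ch : C1c h. Proof. by move=> C; exact: Wext_C1. Qed.

Let h_hartley t C : is_hartley (fun p => hyp (- t) eta p C) (fun x => h (t, x) C).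
Proof.
have -> : (fun x => h (t, x) C) = hartley (fun p => hyp (- t) eta p C).
  by apply/funext => x; have := @hartley_hyp R m (-1) _ t x C ie; rewrite [-1 * t]mulN1r; exact.
apply: is_hartley_L1; first exact: exp_int_L1 (exp_intc_hyp (- t) ie C).
exact: L2c_hyp_gauss.
Qed.

Let P z := cinner (f z) (h z).

(** The slice of [h] is the Hartley transform of an integrable function, so the definition of
    [is_hartley] carries the pairing to the frequency side. *)
Lemma slice_pairing t beta : good t -> (forall C, is_hartley (fun x => f (t, x) C) (beta^~ C)) ->
  L1 lam (fun x => P (t, x)) /\
  \int[lam]_x P (t, x) = \int[lam]_p cinner (hyp (- t) eta p) (beta p).
Proof.
move=> gt hb; have h2 : L2c (fun x => h (t, x)) by move=> C; case: (h_hartley t C).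
have b2 : L2c beta by move=> C; case: (hb C).
have y2 : L2c (hyp (- t) eta) by exact: L2c_hyp_gauss.
split; first exact: (L1_cinner gt h2).
rewrite (Int_cinner gt h2) (Int_cinner y2 b2); apply: eq_bigr => C _.
have [_ _ H] := hb C.
rewrite -(H _ (exp_int_L1 (exp_intc_hyp (- t) ie C)) (y2 C)).
apply: eq_Int => x; rewrite mulrC; congr (_ * _).
by have := @hartley_hyp R m (-1) _ t x C ie; rewrite [-1 * t]mulN1r.
Qed.

Variables a b : R.
Hypothesis ab : a < b.

Let ind t : R := \1_(`[a, b]%classic) t.

Let indE t : ind t = (a <= t <= b)%R%:R.
Proof. by rewrite /ind indicE; congr (nat_of_bool _)%:R; rewrite mem_setE in_itv. Qed.

Let ind2 t : ind t ^+ 2 = ind t.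
Proof. by rewrite indE; case: (_ <= _ <= _); rewrite ?expr1n ?expr0n. Qed.

Let ind_ge0 t : 0 <= ind t. Proof. by rewrite indE ler0n. Qed.

Let L1_ind : L1 (leb R) ind.
Proof. exact: integrable_indic_itv. Qed.

Let measurable_ind : measurable_fun setT (fun z : Z => ind z.1).
Proof. exact: measurableT_comp (L1_measurable L1_ind) measurable_fst. Qed.

Let slab_sqr t : a <= t <= b -> t ^+ 2 <= a ^+ 2 + b ^+ 2.
Proof. by move=> /andP[at_ tb]; have [t0|t0] := leP 0 t; nra. Qed.

Let slab_f C : L2 (leb R \x lam)%E (fun z => ind z.1 * f z C).
Proof.
have mg : measurable_fun setT (fun z => ind z.1 * f z C) by exact: measurable_funM.
(* On the slab t^2 <= a^2 + b^2, so that 1 <= [K] w(t): the weighted integrability of f^2 becomes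
   plain integrability. *)
split=> //; pose K := Num.sqrt pi * expR (a ^+ 2 + b ^+ 2).
apply: (@L1_le _ _ _ (leb R \x lam)%E _ _ _ (L1Z K (iwf C))).
  exact: measurable_funX.
move=> z; rewrite ger0_norm ?sqr_ge0// exprMn ind2 indE mulrA.
case: (boolP (a <= z.1 <= b)) => [zab|_]; last first.
  by rewrite mul0r mulr_ge0 ?sqr_ge0// mulr_ge0 ?gauss_weight_ge0// mulr_ge0 ?sqrtr_ge0 ?expR_ge0.
apply: ler_wpM2r; first exact: sqr_ge0.
have pi0 : Num.sqrt (pi : R) != 0 by rewrite gt_eqF// sqrtr_gt0 pi_gt0.
have -> : K * w z.1 = expR (a ^+ 2 + b ^+ 2 - z.1 ^+ 2).
  by rewrite /K /gauss_weight (expRD (a ^+ 2 + b ^+ 2) (- z.1 ^+ 2)); field.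
by rewrite -[leLHS]expR0 ler_expR subr_ge0 slab_sqr.
Qed.

(** A bound on the slices of [h] that is uniform over the slab: e^{t|p|} e^{-|p|^2/2} <= e^{t^2/2}
    with t^2 <= a^2 + b^2, followed by Plancherel's identity. *)
Let M C := (2 * pi) ^+ m * (expR (a ^+ 2 + b ^+ 2) *
  \int[lam]_p ((`|chip eta' p C| + `|chim eta' p C|) ^+ 2)).

Let L2_norm (g : 'rV[R]_m -> R) : L2 lam g -> L2 lam (fun p => `|g p|).
Proof.
move=> g2; apply: (L2_le _ g2); last by move=> p; rewrite normr_id.
by apply: measurableT_comp => //; exact: L2_measurable g2.
Qed.

Let hyp_slab t C : a <= t <= b ->
  \int[lam]_x (h (t, x) C ^+ 2) <= M C.
Proof.
move=> tab; rewrite (is_hartley_norm (h_hartley t C)) /M.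
apply: ler_wpM2l; first by rewrite exprn_ge0// mulr_ge0// pi_ge0.
have i1 : L1 lam (fun p => (`|chip eta' p C| + `|chim eta' p C|) ^+ 2).
  by apply: L2_sqr; apply: L2D; apply: L2_norm; [exact: L2c_chip|exact: L2c_chim].
rewrite -IntZ//; apply: Int_le; [apply: L2_sqr; exact: L2c_hyp_gauss|exact: L1Z|move=> p].
have -> : hyp (- t) eta p C = expR (- t * enorm p) * gaussV 2^-1 p * chip eta' p C +
    expR (t * enorm p) * gaussV 2^-1 p * chim eta' p C.
  by rewrite /eta hyp_gauss hypE !cE !mulNr opprK; ring.
have e0 := gauss_exp_le (- t) p; have e1 := gauss_exp_le t p; rewrite sqrrN in e0.
rewrite -real_normK ?num_real//.
have -> : expR (a ^+ 2 + b ^+ 2) * (`|chip eta' p C| + `|chim eta' p C|) ^+ 2 =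
   (expR ((a ^+ 2 + b ^+ 2) / 2) * (`|chip eta' p C| + `|chim eta' p C|)) ^+ 2.
  by rewrite exprMn; congr (_ * _); rewrite [RHS]expr2 -expRD; congr expR; field.
rewrite ler_sqr ?nnegrE ?mulr_ge0 ?expR_ge0 ?addr_ge0//.
have tl : expR (t ^+ 2 / 2) <= expR ((a ^+ 2 + b ^+ 2) / 2).
  by rewrite ler_expR ler_pM2r ?invr_gt0// slab_sqr.
apply: le_trans (ler_normD _ _) _; rewrite mulrDr.
rewrite (normrM (_ * gaussV _ _) (chip _ _ _)) (normrM (_ * gaussV _ _) (chim _ _ _)).
by apply: lerD; apply: ler_wpM2r => //; [exact: le_trans e0 tl|exact: le_trans e1 tl].
Qed.

Let slab_h C : L2 (leb R \x lam)%E (fun z => ind z.1 * h z C).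
Proof.
have mg : measurable_fun setT (fun z => ind z.1 * h z C).
  apply: measurable_funM => //; apply: continuous_measurable_space_time => z.
  by apply: differentiable_continuous; exact: (Ch C).1.
have h2 t : L2 lam (fun x => h (t, x) C) by case: (h_hartley t C).
split=> //; apply: (@L1_prod _ _ _ _ _ (leb R) lam _ _ _ _ (L1Z (M C) L1_ind)).
- exact: measurable_funX.
- by move=> t; apply: eq_L1 _ (L1Z (ind t) (L2_sqr (h2 t))) => x; rewrite exprMn ind2.
- move=> t; rewrite (eq_Int _ (g := fun x => ind t * h (t, x) C ^+ 2)) => [|x].
    rewrite (IntZ _ (L2_sqr (h2 t))) mulrC indE; case: (boolP (a <= t <= b)) => tab.
      by rewrite !mulr1 hyp_slab.
    by rewrite !mulr0.
  by rewrite ger0_norm ?sqr_ge0// exprMn ind2.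
Qed.

(* h solves the adjoint equation (d_0 - D) h = 0, so <f, h> dx is the density of
   a conserved quantity whose flux in direction j is <e_j f, h>. *)
Lemma monogenic_conservation (beta_a beta_b : 'rV[R]_m -> CR) : good a -> good b ->
  (forall C, is_hartley (fun x => f (a, x) C) (beta_a^~ C)) ->
  (forall C, is_hartley (fun x => f (b, x) C) (beta_b^~ C)) ->
  \int[lam]_p cinner (hyp (- a) (gaussc eta') p) (beta_a p) =
  \int[lam]_p cinner (hyp (- b) (gaussc eta') p) (beta_b p).
Proof.
move=> ga gb ha hb; have [ia <-] := slice_pairing ga ha; have [ib <-] := slice_pairing gb hb.
pose Q (j : 'I_m) (z : Z) := cinner (clifford_gen R j * f z) (h z).
apply: (@conservation R m P Q a b ab _ _ _ _ ia ib).
- exact: (cinner_C1 Cf Ch).1.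
- by move=> j; exact: (cinner_C1 (C1c_gen j Cf) Ch).1.
- move=> z; apply: dirac_divergence => //; exact: Wext_dirac.
- move=> j.
  have g2 C : L2 (leb R \x lam)%E (fun z => ind z.1 * (clifford_gen R j * f z) C).
    rewrite (_ : (fun z => _) = fun z : Z =>
      (-1) ^+ swaps [set j]%SET (symdiff [set j]%SET C) *
      (ind z.1 * f z (symdiff [set j]%SET C))); first exact: L2Z.
    by apply/funext => z; rewrite gen_mulE; ring.
  apply: (@eq_L1 _ _ _ (leb R \x lam)%E (fun z => \sum_C
      (ind z.1 * (clifford_gen R j * f z) C) * (ind z.1 * h z C))).
    move=> z; rewrite /Q /cinner mulr_sumr; apply: eq_bigr => C _.
    by rewrite -/(ind z.1) mulrACA -expr2 ind2.
  by apply: L1_sum => C; apply: L2M.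
Qed.

End slab.
End monogenic_evolution.

Section real_surjectivity.
Variables (R : realType) (m : nat).
Local Notation CR := (clifford R m).
Local Notation lam := (lebesgue_rV R m).
Local Notation w := (@gauss_weight R).
Local Notation Z := (R * 'rV[R]_m)%type.
Implicit Types (gam eta beta : 'rV[R]_m -> CR) (p x : 'rV[R]_m) (s t a b : R)
  (C : {set 'I_m}).

Variable f : Z -> CR.
Hypothesis Cf : C1c f.
Hypothesis Df : forall z, derivc (1, 0) f z +
  \sum_j clifford_gen R j * derivc (0, delta_mx ord0 j) f z = 0.
Hypothesis f2 : forall C, L2 (gauss_measure R m) (fun z => f z C).

Let slice_hartley t beta := forall C, is_hartley (fun x => f (t, x) C) (fun p => beta p C).

Lemma slice_conservation eta a b beta_a beta_b : L2c eta -> good f a -> good f b ->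
  slice_hartley a beta_a -> slice_hartley b beta_b ->
  \int[lam]_p cinner (hyp (- a) (gaussc eta) p) (beta_a p) =
  \int[lam]_p cinner (hyp (- b) (gaussc eta) p) (beta_b p).
Proof.
move=> e2 ga gb ha hb; have [ab|ba|e] := ltgtP a b.
- exact: (monogenic_conservation Cf Df f2 e2 ab ga gb ha hb).
- by apply/esym; exact: (monogenic_conservation Cf Df f2 e2 ba gb ga hb ha).
(* Two transforms of the same slice may differ on a null set; both pairings equal the integral over
   the slice itself. *)
- rewrite -e in hb *.
  by rewrite -(slice_pairing e2 ga ha).2 -(slice_pairing e2 ga hb).2.
Qed.

Lemma cinner_blade C (u : CR) : cinner (blade R C) u = u C.
Proof.
rewrite /cinner (bigD1 C)//= big1 => [|D DC].
  by rewrite ffunE eqxx mul1r addr0.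
by rewrite ffunE (negPf DC) mul0r.
Qed.

Lemma gauss_halves p : gaussV 2^-1 p * gaussV 2^-1 p = gaussV 1 p :> R.
Proof. by rewrite -gaussVD; congr (gaussV _ p); field. Qed.

Lemma L2_gauss1 a : 0 < a -> L2 lam (fun p => gaussV a p).
Proof.
move=> a0; apply: (@L2_bounded _ _ _ 1); last exact: L1_gaussV.
by move=> p; rewrite ger0_norm ?gaussV_ge0 ?gaussV_le1.
Qed.

(* The test data hyp s (gaussc (gaussc eta)) are moved to gaussc (gaussc eta) at
   time s, which leaves Gaussians times beta_s, a total family. *)
Lemma slice_evolution a s beta_a beta_s C : good f a -> good f s ->
  slice_hartley a beta_a -> slice_hartley s beta_s ->
  {ae lam, forall p, beta_s p C = hyp (s - a) beta_a p C}.
Proof.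
move=> ga gs ha hs.
have a2 : L2c beta_a by move=> D; case: (ha D).
have s2 : L2c beta_s by move=> D; case: (hs D).
have key eta : L2c eta -> \int[lam]_p cinner (gauss2 eta p) (beta_s p) =
    \int[lam]_p cinner (gauss2 eta p) (hyp (s - a) beta_a p).
  move=> e2; have e2' := L2c_hyp_gauss s e2.
  have := slice_conservation e2' ga gs ha hs.
  have eN t p : hyp (- t) (gaussc (hyp s (gaussc eta))) p = hyp (s - t) (gauss2 eta) p.
    by rewrite /gauss2 (hyp_gauss _ (hyp s _)) (hyp_gauss _ (gaussc eta)) hypD (addrC s).
  rewrite (eq_Int _ (fun p => congr1 (fun u => cinner u (beta_a p)) (eN a p))).
  rewrite (eq_Int _ (fun p => congr1 (fun u => cinner u (beta_s p)) (eN s p))).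
  rewrite (hyp_sym _ _ a2); last by move=> t; apply: L2c_hyp_gauss; exact: L2c_gaussc.
  by move=> ->; apply: eq_Int => p; rewrite subrr hyp0.
pose psi p := gaussV 1 p * beta_s p C - gaussV 1 p * hyp (s - a) beta_a p C.
have i2 : (0 : R) < 2^-1 by rewrite invr_gt0.
have hE p : gaussV 1 p * hyp (s - a) beta_a p C =
    gaussV 2^-1 p * hyp (s - a) (gaussc beta_a) p C.
  by rewrite hyp_gauss (clifford_scaleE (gaussV _ _)) mulrA gauss_halves.
have l1 : L1 lam (fun p => gaussV 1 p * beta_s p C).
  by apply: L2M => //; exact: L2_gauss1.
have l2 : L1 lam (fun p => gaussV 1 p * hyp (s - a) beta_a p C).
  rewrite (funext hE); apply: L2M; [exact: L2_gauss1|exact: L2c_hyp_gauss].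
have psi1 : L1 lam psi by exact: L1B.
have : {ae lam, forall p, psi p = 0}.
  apply: gaussV_total => // b y b0.
  pose eta p : CR := gaussV b (p - y) *: blade R C.
  have e2 : L2c eta.
    move=> D; rewrite (_ : (fun p => _) = fun p => (blade R C : CR) D * gaussV b (p - y)).
      by apply: L2Z; exact: (L2_gaussV_shift y b0).2.
    by apply/funext => p; rewrite cE mulrC.
  have e p (u : CR) : cinner (gauss2 eta p) u = gaussV 1 p * u C * gaussV b (p - y).
    by rewrite /gauss2 /gaussc /eta !cinnerZl cinner_blade -gauss_halves; ring.
  have j1 := L1_cinner (L2c_gaussc (L2c_gaussc e2)) s2.
  have j2 : L1 lam (fun p => cinner (gauss2 eta p) (hyp (s - a) beta_a p)).
    apply: eq_L1 _ (L1_cinner (L2c_gaussc e2) (L2c_hyp_gauss (s - a) a2)) => p.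
    by rewrite hyp_gauss (cinnerZr (gaussV _ _)) -(cinnerZl (gaussV _ _)).
  rewrite (eq_Int _ (g := fun p => cinner (gauss2 eta p) (beta_s p) -
      cinner (gauss2 eta p) (hyp (s - a) beta_a p))) => [|p].
    by rewrite (IntB j1 j2) key// subrr.
  by rewrite !e /psi; ring.
apply: filterS => p /eqP; rewrite subr_eq0 => /eqP h.
have g0 : gaussV 1 p != 0 :> R by rewrite gt_eqF ?expR_gt0.
exact: (mulfI g0).
Qed.

Lemma measc_hyp t gam : measc gam -> measc (hyp t gam).
Proof.
move=> mg C; exact: (measurableT_comp (measurable_hyp C mg) (measurable_pair1 t)).
Qed.

Lemma gauss_unweight gam p : gaussc (fun p => gaussV (- 2^-1) p *: gam p) p = gam p.
Proof.
by rewrite /gaussc scalerA -gaussVD subrr /gaussV mul0r oppr0 expR0 scale1r.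
Qed.

Let F (z : Z) := w z.1 * cinner (f z) (f z).

Let iF : L1 (leb R \x lam)%E F.
Proof. exact: L1_weight_cinner. Qed.

Lemma real_surjective : exists phi gam : 'rV[R]_m -> CR,
  (forall C, is_hartley (fun x => phi x C) (fun p => gam p C)) /\
  forall z C, (2 * pi) ^+ m * f z C = Wgauss gam z C.
Proof.
have ag := good_ae Cf f2.
(* If no slice were good, the constant 1 would vanish almost everywhere on the line. *)
have [a ga] : exists a, good f a.
  apply: contrapT => /forallNP ng.
  have c1 : continuous (fun _ : R => 1 : R) by move=> u; exact: cvg_cst.
  have h1 : {ae leb R, forall u, (1 : R) = 0} by move: ag; apply: (@filterS _ _ (ae_filter_ringOfSetsType (leb R))) => t /ng.
  by have /eqP := @continuous_ae0_line R (fun=> 1) c1 h1 0; rewrite oner_eq0.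
have [beta_a ha] := L2c_hartley_ex ga.
have a2 : L2c beta_a by move=> D; case: (ha D).
(* Transporting a good slice back to time 0 gives the transform that the slice at 0 should have,
   even if 0 is not a good time. *)
pose gam0 := hyp (- a) beta_a.
pose gam p := gaussV (- 2^-1) p *: gam0 p.
have gam0E : gaussc gam = gam0 by apply/funext => p; exact: gauss_unweight.
have mg0 : measc gam0 by apply: measc_hyp; exact: L2c_meas.
have mg : measc gam.
  move=> C; rewrite (_ : (fun p => _) = fun p => gaussV (- 2^-1) p * gam0 p C).
    by apply: measurable_funM => //; exact: measurable_gaussV.
  by apply/funext => p; rewrite (clifford_scaleE (gaussV _ _)).
have ev s beta_s : good f s -> slice_hartley s beta_s -> forall C,
    {ae lam, forall p, beta_s p C = hyp s gam0 p C}.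
  move=> gs hs C; apply: filterS (slice_evolution C ga gs ha hs) => p ->.
  by rewrite /gam0 hypD.
have hyp2 s : good f s -> forall C, is_hartley (fun p => hyp s gam0 p C)
    (fun x => (2 * pi) ^+ m * f (s, x) C).
  move=> gs C; have [beta_s hs] := L2c_hartley_ex gs.
  have e := ev s beta_s gs hs C; have [_ b2 _] := hs C.
  apply: (is_hartley_ae _ e (is_hartley_inv (hs C))).
  by apply: (ae_eq_L2 _ e b2); exact: measc_hyp.
have pi0 : (0 : R) < 2 * pi by rewrite mulr_gt0// pi_gt0.
have c0 : (2 * pi) ^+ m != 0 :> R by rewrite gt_eqF ?exprn_gt0.
pose G (z : Z) := w z.1 * cinner (hyp z.1 (gaussc gam) z.2) (hyp z.1 (gaussc gam) z.2).
(* On good slices Plancherel's identity equates the energy of [hyp s gam0] with (2 pi)^m times that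
   of f; integrability of [F] then controls [G]. *)
have iG : L1 (leb R \x lam)%E G.
  apply: (@L1_prod_ae _ _ _ _ _ (leb R) lam _
    (fun t => ((2 * pi) ^+ m)%:E * \int[lam]_x (F (t, x))%:E)%E).
  - exact: measurable_energy.
  - by apply: integrableZl => //; exact: (integrable_fubini_F iF).
  - move=> t; apply: mule_ge0; first by rewrite lee_fin exprn_ge0// ltW.
    by apply: integral_ge0 => x _; rewrite lee_fin mulr_ge0 ?gauss_weight_ge0 ?cinner_ge0.
  move: ag; apply: (@filterS _ _ (ae_filter_ringOfSetsType (leb R))) => s gs.
  have h2 : L2c (hyp s gam0) by move=> C; case: (hyp2 s gs C).
  have i1 : L1 lam (fun p => G (s, p)).
    by rewrite /G gam0E; exact: (@L1Z _ _ _ lam (w s) _ (L1_cinner h2 h2)).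
  have i2 : L1 lam (fun x => F (s, x)) by exact: (@L1Z _ _ _ lam (w s) _ (L1_cinner gs gs)).
  rewrite (IntE i2) (_ : (fun p => `|G (s, p)|%:E) = EFin \o (fun p => G (s, p))).
    rewrite (IntE i1) -EFinM lee_fin le_eqVlt; apply/orP; left; apply/eqP.
    rewrite /G /F gam0E /= (IntZ _ (L1_cinner h2 h2)) (IntZ _ (L1_cinner gs gs)).
    rewrite mulrCA; congr (_ * _); rewrite (Int_cinner h2 h2) (Int_cinner gs gs) mulr_sumr.
    apply: eq_bigr => C _; have := is_hartley_norm (hyp2 s gs C).
    under eq_Int do rewrite exprMn; rewrite (IntZ _ (L2_sqr (gs C))) expr2 -mulrA.
    by move=> /(mulfI c0) ->.
  apply/funext => p; rewrite /= ger0_norm//.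
  by rewrite mulr_ge0 ?gauss_weight_ge0 ?cinner_ge0.
have g2 : L2c gam.
  move=> C; split; first exact: mg.
  apply: (L1_le _ (energy_L1_inv mg iG)); first exact: measurable_funX.
  by move=> p; rewrite ger0_norm ?sqr_ge0//; exact: sqr_cinner_le.
have [g Hg] := L2c_hartley_ex g2.
(* The transform [g] of [gam] has (2 pi)^m [gam] as its own transform; the division makes [gam] the
   transform of the preimage. *)
exists (fun x => [ffun C => ((2 * pi) ^+ m)^-1 * g x C]), gam; split=> [C|z C].
  have := is_hartleyZ ((2 * pi) ^+ m)^-1 (is_hartley_inv (Hg C)).
  congr is_hartley; apply/funext => x; first by rewrite ffunE.
  by rewrite mulKf.
pose D z := (2 * pi) ^+ m * f z C - Wgauss gam z C.
have cD : continuous D.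
  have cf : continuous (fun z => f z C).
    by move=> u; apply: differentiable_continuous; exact: (Cf C).1.
  move=> u; apply: cvgB; last exact: Wgauss_continuous.
  by apply: cvgMr; exact: cf.
suff : forall s x, D (s, x) = 0.
  by case: z => s x /(_ s x)/eqP; rewrite subr_eq0 => /eqP.
(* Uniqueness of the transform gives D = 0 at almost every x of almost every slice; continuity in x,
   then in time, removes both exceptions. *)
move=> s x; apply: (@continuous_ae0_line R (fun s => D (s, x))).
  move=> u; apply: (@cvg_comp _ _ _ (fun s : R => (s, x)) D (nbhs u) (nbhs (u, x))).
    by apply: (@cvg_pair _ _ _ (nbhs u) (nbhs u) (nbhs x) _ _ _ id (cst x));
      [exact: cvg_id|exact: cvg_cst].
  exact: cD.
move: ag; apply: (@filterS _ _ (ae_filter_ringOfSetsType (leb R))) => t gt; move: x.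
apply: (@continuous_ae0 R m (fun x => D (t, x))); first exact: (@continuous_slice R m D t cD).
have h1 := Wgauss_hartley t C g2; rewrite gam0E in h1.
apply: filterS (is_hartley_uniq (hyp2 t gt C) h1) => x e.
by rewrite /D e subrr.
Qed.

End real_surjectivity.

(** * The transform on real and on complex functions *)

Section real_transform.
Variables (R : realType) (m : nat).
Local Notation CR := (clifford R m).
Local Notation lam := (lebesgue_rV R m).
Local Notation mu := (gauss_measure R m).
Local Notation Z := (R * 'rV[R]_m)%type.
Implicit Types (phi psi gam : 'rV[R]_m -> CR) (x y : 'rV[R]_m) (z : Z)
  (C : {set 'I_m}).

Definition real_transform phi z : CR :=
  [ffun C => (2 * pi) ^- m * \int[lam]_y (real_kernel z y * phi y) C].

Lemma real_transformE phi gam : (forall C, is_hartley (fun x => phi x C) (fun p => gam p C)) ->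
  forall z C, real_transform phi z C = (2 * pi) ^- m * Wgauss gam z C.
Proof. by move=> h z C; rewrite ffunE (real_kernel_transform z C h). Qed.

Lemma L1_kernel_mul phi z C : L2c phi -> L1 lam (fun y => (real_kernel z y * phi y) C).
Proof. by move=> f2; apply: L1_cmul => //; exact: L2_real_kernel. Qed.

Lemma eq_real_transform phi psi : L2c phi -> L2c psi ->
  (forall C, {ae lam, forall y, phi y C = psi y C}) ->
  real_transform phi = real_transform psi.
Proof.
move=> f2 g2 h; apply/funext => z; apply/ffunP => C; rewrite !ffunE; congr (_ * _).
rewrite (Int_cmul C (L2_real_kernel z) f2) (Int_cmul C (L2_real_kernel z) g2).
apply: eq_bigr => A _; congr (_ * _).
have K2 := L2_real_kernel z.
apply: ae_eq_Int; [exact: L1_measurable (L2M (K2 _) (f2 _))|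
  exact: L1_measurable (L2M (K2 _) (g2 _))|].
by apply: filterS (h (symdiff A C)) => y ->.
Qed.

Lemma real_transformD phi psi z : L2c phi -> L2c psi ->
  real_transform (fun y => phi y + psi y) z = real_transform phi z + real_transform psi z.
Proof.
move=> f2 g2; apply/ffunP => C; rewrite clifford_addE !ffunE -mulrDr; congr (_ * _).
rewrite -(IntD (L1_kernel_mul z C f2) (L1_kernel_mul z C g2)).
by apply: eq_Int => y; rewrite mulrDr clifford_addE.
Qed.

Lemma real_transformZ k phi z : L2c phi ->
  real_transform (fun y => k *: phi y) z = k *: real_transform phi z.
Proof.
move=> f2; apply/ffunP => C; rewrite clifford_scaleE !ffunE mulrCA; congr (_ * _).
rewrite -(IntZ k (L1_kernel_mul z C f2)).
by apply: eq_Int => y; rewrite -scalerAr clifford_scaleE.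
Qed.

Lemma L2cD phi psi : L2c phi -> L2c psi -> L2c (fun y => phi y + psi y).
Proof.
move=> f2 g2 C; rewrite (_ : (fun y => _) = fun y => phi y C + psi y C); first exact: L2D.
by apply/funext => y; rewrite clifford_addE.
Qed.

Lemma L2cZ k phi : L2c phi -> L2c (fun y => k *: phi y).
Proof.
move=> f2 C; rewrite (_ : (fun y => _) = fun y => k * phi y C); first exact: L2Z.
by apply/funext => y; rewrite clifford_scaleE.
Qed.

Lemma real_transform_C1 phi : L2c phi -> C1c (real_transform phi).
Proof.
move=> f2 C; have [gam h] := L2c_hartley_ex f2.
have g2 : L2c gam by move=> D; case: (h D).
rewrite (funext (fun z => real_transformE h z C)).
exact: C1M (C1_cst _ _) (Wext_C1 C (normr1_le1 R) (exp_intc_gauss g2)).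
Qed.

Lemma real_transform_dirac phi z : L2c phi -> derivc (1, 0) (real_transform phi) z +
  \sum_j clifford_gen R j * derivc (0, delta_mx ord0 j) (real_transform phi) z = 0.
Proof.
move=> f2; have [gam h] := L2c_hartley_ex f2.
have g2 : L2c gam by move=> D; case: (h D).
have CW C := Wext_C1 C (normr1_le1 R) (exp_intc_gauss g2).
have dE v : derivc v (real_transform phi) z = (2 * pi) ^- m *: derivc v (Wgauss gam) z.
  apply/ffunP => C; rewrite clifford_scaleE !ffunE.
  rewrite -(deriveZ_C1 _ v z (CW C)); congr ('D_v _ z).
  by apply/funext => u; rewrite (real_transformE h).
rewrite dE; under eq_bigr => j _ do rewrite dE -scalerAr.
rewrite -scaler_sumr -scalerDr -[X in _ *: (_ + X)]scale1r.
by rewrite (Wext_dirac z (normr1_le1 R) (exp_intc_gauss g2)) scaler0.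
Qed.

Lemma real_transform_L2 phi C : L2c phi -> L2 mu (fun z => real_transform phi z C).
Proof.
move=> f2; have [gam h] := L2c_hartley_ex f2.
have g2 : L2c gam by move=> D; case: (h D).
rewrite (funext (fun z => real_transformE h z C)); apply: L2Z.
apply/L2_gauss_measure; last by case: (Wgauss_energy C g2).
by apply: continuous_measurable_space_time; exact: Wgauss_continuous.
Qed.

Lemma L1_gauss_cinner (f g : Z -> CR) : (forall C, L2 mu (fun z => f z C)) ->
  (forall C, L2 mu (fun z => g z C)) -> L1 mu (fun z => cinner (f z) (g z)).
Proof. by move=> f2 g2; apply: L1_sum => C; exact: L2M. Qed.

(** Plancherel's identity is used twice, in passing from [phi] to [gam] and on the slices of
    [Wgauss]; its two factors (2 pi)^m cancel the squared normalization (2 pi)^{-2m}. *)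
Lemma real_transform_norm phi : L2c phi ->
  \int[mu]_z cinner (real_transform phi z) (real_transform phi z) =
  \int[lam]_y cinner (phi y) (phi y).
Proof.
move=> f2; have [gam h] := L2c_hartley_ex f2.
have g2 : L2c gam by move=> D; case: (h D).
have W2 C : L2 mu (fun z => Wgauss gam z C).
  apply/L2_gauss_measure; last by case: (Wgauss_energy C g2).
  by apply: continuous_measurable_space_time; exact: Wgauss_continuous.
set c : R := (2 * pi) ^- m.
have c0 : (2 * pi) ^+ m != 0 :> R.
  by rewrite gt_eqF ?exprn_gt0// mulr_gt0// pi_gt0.
rewrite (@eq_Int _ _ _ mu _ (fun z => c ^+ 2 * \sum_C Wgauss gam z C ^+ 2)); last first.
  move=> z; rewrite /cinner mulr_sumr; apply: eq_bigr => C _.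
  by rewrite (real_transformE h) -expr2 exprMn.
have i1 C : L1 mu (fun z => Wgauss gam z C ^+ 2) by exact: L2_sqr.
rewrite IntZ; last exact: L1_sum.
rewrite (@Int_sum _ _ _ mu _ _ xpredT (fun C z => Wgauss gam z C ^+ 2) i1).
under eq_bigr => C _ do rewrite (Int_gauss_measure (i1 C)).
rewrite (Wgauss_isometry g2) (Int_cinner f2 f2) /c.
have e C : \int[lam]_p (gam p C ^+ 2) = (2 * pi) ^+ m * \int[lam]_y (phi y C * phi y C).
  by rewrite (is_hartley_norm (h C)).
rewrite (eq_bigr _ (fun C _ => e C)) -mulr_sumr.
by move: (\sum_C _) ((2 * pi) ^+ m) c0 => S k k0; field.
Qed.

(** Polarization: the norm identity for phi + psi, minus those for phi and psi. *)
Lemma real_transform_inner phi psi : L2c phi -> L2c psi ->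
  \int[mu]_z cinner (real_transform phi z) (real_transform psi z) =
  \int[lam]_y cinner (phi y) (psi y).
Proof.
move=> f2 g2; have n1 := real_transform_norm f2; have n2 := real_transform_norm g2.
have := real_transform_norm (L2cD f2 g2).
have F2 C := real_transform_L2 C f2; have G2 C := real_transform_L2 C g2.
have expand (T : Type) (u v : T -> CR) t : cinner (u t + v t) (u t + v t) =
    cinner (u t) (u t) + cinner (v t) (v t) + 2 * cinner (u t) (v t).
  rewrite cinnerDl !cinnerDr (cinnerC (v t) (u t)); ring.
rewrite (@eq_Int _ _ _ mu _ (fun z => cinner (real_transform phi z) (real_transform phi z) +
  cinner (real_transform psi z) (real_transform psi z) +
  2 * cinner (real_transform phi z) (real_transform psi z))); last first.
  by move=> z; rewrite real_transformD// expand.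
rewrite (eq_Int _ (expand _ phi psi)).
have a1 := L1_gauss_cinner F2 F2; have a2 := L1_gauss_cinner G2 G2.
have a3 := L1_gauss_cinner F2 G2.
have b1 := L1_cinner f2 f2; have b2 := L1_cinner g2 g2; have b3 := L1_cinner f2 g2.
rewrite (IntD (L1D a1 a2) (L1Z 2 a3)) (IntD a1 a2) (IntZ 2 a3).
rewrite (IntD (L1D b1 b2) (L1Z 2 b3)) (IntD b1 b2) (IntZ 2 b3) n1 n2.
by move=> /addrI /(mulfI _); apply; rewrite pnatr_eq0.
Qed.

Lemma real_transform_inj phi psi : L2c phi -> L2c psi ->
  real_transform phi = real_transform psi ->
  forall C, {ae lam, forall y, phi y C = psi y C}.
Proof.
move=> f2 g2 e C; have n2 := L2cZ (-1) g2; pose d y := phi y + -1 *: psi y.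
have d2 : L2c d := L2cD f2 n2.
have T0 z : real_transform d z = 0.
  by rewrite /d real_transformD// real_transformZ// e scaleN1r subrr.
have : \int[lam]_y cinner (d y) (d y) = 0.
  rewrite -real_transform_norm// (eq_Int _ (g := fun=> 0)) ?Int0// => z.
  by rewrite T0 /cinner big1// => D _; rewrite ffunE mul0r.
rewrite (Int_cinner d2 d2) => /eqP; rewrite psumr_eq0; last first.
  by move=> D _; apply: Int_ge0 => y; rewrite -expr2 sqr_ge0.
move=> /allP /(_ C (mem_index_enum _)) /eqP h.
apply: filterS (L2_Int0 (d2 C) h) => y; rewrite /d !cE mulN1r => /eqP.
by rewrite subr_eq0 => /eqP.
Qed.

Lemma real_transform_surj (f : Z -> CR) : C1c f ->
  (forall z, derivc (1, 0) f z +
    \sum_j clifford_gen R j * derivc (0, delta_mx ord0 j) f z = 0) ->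
  (forall C, L2 mu (fun z => f z C)) ->
  exists2 phi, L2c phi & real_transform phi = f.
Proof.
move=> Cf Df f2; have [phi [gam [h e]]] := real_surjective Cf Df f2.
exists phi; first by move=> C; case: (h C).
apply/funext => z; apply/ffunP => C; rewrite (real_transformE h) -e mulKf//.
by rewrite gt_eqF ?exprn_gt0// mulr_gt0// pi_gt0.
Qed.

End real_transform.

Section complex_coordinates.
Variables (R : realType) (m : nat).
Local Notation CR := (clifford R m).
Local Notation CC := (clifford R[i] m).
Local Notation lam := (lebesgue_rV R m).
Implicit Types (u v : CC) (a : CR) (p x y : 'rV[R]_m) (A C : {set 'I_m})
  (z : R * 'rV[R]_m).

Definition reC u : CR := [ffun A => complex.Re (u A)].
Definition imC u : CR := [ffun A => complex.Im (u A)].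
Definition realC a : CC := [ffun A => (a A)%:C%C].

Lemma reCE u C : reC u C = complex.Re (u C). Proof. by rewrite ffunE. Qed.
Lemma imCE u C : imC u C = complex.Im (u C). Proof. by rewrite ffunE. Qed.

Lemma reimC_inj u v : reC u = reC v -> imC u = imC v -> u = v.
Proof.
move=> /ffunP er /ffunP ei; apply/ffunP => A; have := er A; have := ei A.
by rewrite !ffunE; case: (u A) (v A) => [? ?] [? ?] /= -> ->.
Qed.

Lemma ReD (b c : R[i]) : complex.Re (b + c) = complex.Re b + complex.Re c.
Proof. by case: b c => [? ?] [? ?]. Qed.

Lemma ImD (b c : R[i]) : complex.Im (b + c) = complex.Im b + complex.Im c.
Proof. by case: b c => [? ?] [? ?]. Qed.

Lemma Re_realM (k : R) (b : R[i]) : complex.Re (k%:C%C * b) = k * complex.Re b.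
Proof. by case: b => c d /=; rewrite mul0r subr0. Qed.

Lemma Im_realM (k : R) (b : R[i]) : complex.Im (k%:C%C * b) = k * complex.Im b.
Proof. by case: b => c d /=; rewrite mul0r addr0. Qed.

Lemma signC k : (-1 : R[i]) ^+ k = ((-1) ^+ k)%:C%C.
Proof. by rewrite rmorphXn rmorphN1. Qed.

Lemma reC_mul a u : reC (realC a * u) = a * reC u.
Proof.
apply/ffunP => C; rewrite ffunE !clifford_mulE (big_morph (@complex.Re R) ReD (erefl _)).
by apply: eq_bigr => A _; rewrite signC Re_realM !ffunE Re_realM.
Qed.

Lemma imC_mul a u : imC (realC a * u) = a * imC u.
Proof.
apply/ffunP => C; rewrite ffunE !clifford_mulE (big_morph (@complex.Im R) ImD (erefl _)).
by apply: eq_bigr => A _; rewrite signC Im_realM !ffunE Im_realM.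
Qed.

Lemma reCD u v : reC (u + v) = reC u + reC v.
Proof. by apply/ffunP => C; rewrite !ffunE ReD. Qed.

Lemma imCD u v : imC (u + v) = imC u + imC v.
Proof. by apply/ffunP => C; rewrite !ffunE ImD. Qed.

Lemma reCZ (k : R[i]) u :
  reC (k *: u) = complex.Re k *: reC u + - complex.Im k *: imC u.
Proof.
by apply/ffunP => C; rewrite !cE !reCE imCE clifford_scaleE; case: k (u C) => ? ? [? ?] /=; ring.
Qed.

Lemma imCZ (k : R[i]) u : imC (k *: u) = complex.Re k *: imC u + complex.Im k *: reC u.
Proof.
by apply/ffunP => C; rewrite !cE !imCE reCE clifford_scaleE; case: k (u C) => ? ? [? ?] /=; ring.
Qed.

Lemma reC0 : reC 0 = 0. Proof. by apply/ffunP => C; rewrite !ffunE. Qed.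
Lemma imC0 : imC 0 = 0. Proof. by apply/ffunP => C; rewrite !ffunE. Qed.

Lemma reC_sum (I : Type) (r : seq I) (F : I -> CC) :
  reC (\sum_(i <- r) F i) = \sum_(i <- r) reC (F i).
Proof. exact: (big_morph reC reCD reC0). Qed.

Lemma imC_sum (I : Type) (r : seq I) (F : I -> CC) :
  imC (\sum_(i <- r) F i) = \sum_(i <- r) imC (F i).
Proof. exact: (big_morph imC imCD imC0). Qed.

Lemma genC j : clifford_gen R[i] j = realC (clifford_gen R j).
Proof. by apply/ffunP => C; rewrite !ffunE; case: (_ == _). Qed.

Lemma oneC C : (1 : CC) C = ((1 : CR) C)%:C%C.
Proof. by rewrite !ffunE; case: (_ == _). Qed.

Lemma vectC p C : vect p C = (vecR p C)%:C%C.
Proof.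
rewrite /vect /vecR !sum_ffunE rmorph_sum; apply: eq_bigr => j _.
by rewrite !clifford_scaleE genC ffunE rmorphM.
Qed.

Lemma coordD u v C : (u + v) C = u C + v C. Proof. by rewrite ffunE. Qed.
Lemma coordN u C : (- u) C = - u C. Proof. by rewrite ffunE. Qed.

Lemma halfC : (2^-1 : R[i]) = (2^-1)%:C%C.
Proof. by rewrite fmorphV rmorph_nat. Qed.

(** That is, e^{-itp} = cosh(t|p|) - i sinh(t|p|) p / |p|; at p = 0 the values [ch] = 1 and [sh] = 0
    agree with the separate case of [exp_vect]. *)
Lemma exp_vectC t p C : exp_vect t p C =
  ((ch t p * (1 : CR) C) +i* (- (sh t p * vecR p C)))%C.
Proof.
rewrite /exp_vect; case: ifPn => [/eqP p0|p0].
  have q0 : enorm p = 0 by apply/eqP; rewrite enorm_eq0 p0.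
  rewrite oneC /ch /sh q0 mulr0 oppr0 expR0 subrr !mul0r oppr0.
  by rewrite -[1 + 1](natrD _ 1 1) divff ?mul1r// pnatr_eq0.
have cp : chi_plus p C = (2^-1 * (1 : CR) C +i* (2^-1 * ((enorm p)^-1 * vecR p C)))%C.
  rewrite /chi_plus (clifford_scaleE 2^-1) coordD (clifford_scaleE (0 +i* _)%C) oneC vectC halfC.
  by apply/eqP; rewrite eq_complex /=; apply/andP; split; apply/eqP; ring.
have cm : chi_minus p C = (2^-1 * (1 : CR) C +i* (- (2^-1 * ((enorm p)^-1 * vecR p C))))%C.
  rewrite /chi_minus (clifford_scaleE 2^-1) coordD coordN (clifford_scaleE (0 +i* _)%C).
  rewrite oneC vectC halfC.
  by apply/eqP; rewrite eq_complex /=; apply/andP; split; apply/eqP; ring.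
move: (chi_plus p) (chi_minus p) cp cm => a b ca cb.
rewrite coordD (clifford_scaleE _ a) (clifford_scaleE _ b) ca cb.
rewrite /ch /sh mulNr.
move: ((1 : CR) C) (vecR p C) (expR _) (expR _) (enorm p)^-1 => o v e e' q.
by apply/eqP; rewrite eq_complex /=; apply/andP; split; apply/eqP; field.
Qed.

Lemma V_integrandC z y p C : V_integrand z y p C =
  ((cos (dotp p (z.2 - y)) * ker_even z.1 p C + sin (dotp p (z.2 - y)) * ker_odd z.1 p C) +i*
   (sin (dotp p (z.2 - y)) * ker_even z.1 p C - cos (dotp p (z.2 - y)) * ker_odd z.1 p C))%C.
Proof.
rewrite clifford_scaleE exp_vectC ker_evenE ker_oddE !(clifford_scaleE (_ * _)).
have -> : expR (- (enorm p ^+ 2 / 2)) = gaussV 2^-1 p.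
  by rewrite enorm_sqr mulrC.
rewrite /cis; move: (ch _ _) (sh _ _) ((1 : CR) C) (vecR p C) (cos _) (sin _) (gaussV _ _).
move=> c s o v k l g.
by apply/eqP; rewrite eq_complex /=; apply/andP; split; apply/eqP; ring.
Qed.

Lemma V_integrand_integrable z y : clifford_integrable lam (V_integrand z y).
Proof.
move=> C; have ie := L1_ker_even z.1 C; have io := L1_ker_odd z.1 C.
split.
  apply: (@eq_L1 _ _ _ lam _ _ _ (L1D (L1_cos_dotp (z.2 - y) ie) (L1_sin_dotp (z.2 - y) io))).
  by move=> p; rewrite V_integrandC.
apply: (@eq_L1 _ _ _ lam _ _ _ (L1B (L1_sin_dotp (z.2 - y) ie) (L1_cos_dotp (z.2 - y) io))).
by move=> p; rewrite V_integrandC.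
Qed.

(** The imaginary part of the integrand is odd in p. Hence the transform acts on the real and the
    imaginary coordinates separately. *)
Lemma V_kernelC z y : V_kernel z y = realC (real_kernel z y).
Proof.
have ie C := L1_ker_even z.1 C; have io C := L1_ker_odd z.1 C.
apply/ffunP => C; rewrite !ffunE /cplx_integral; congr (_ +i* _)%C.
  by apply: eq_Int => p; rewrite V_integrandC.
rewrite (eq_Int _ (fun p => congr1 (@complex.Im R) (V_integrandC z y p C))) /=.
apply: Int_rV_odd; first by apply: L1B; [exact: L1_sin_dotp|exact: L1_cos_dotp].
by move=> p; rewrite dotpNl sinN cosN ker_evenN ker_oddN clifford_oppE; ring.
Qed.

Lemma V_transform_re phi z : reC (V_transform phi z) = real_transform (fun y => reC (phi y)) z.
Proof.
apply/ffunP => C; rewrite !ffunE Re_realM /=; congr (_ * _).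
by apply: eq_Int => y; rewrite V_kernelC -reC_mul reCE.
Qed.

Lemma V_transform_im phi z : imC (V_transform phi z) = real_transform (fun y => imC (phi y)) z.
Proof.
apply/ffunP => C; rewrite !ffunE Im_realM /=; congr (_ * _).
by apply: eq_Int => y; rewrite V_kernelC -imC_mul imCE.
Qed.

Lemma clifford_L2E d (T : measurableType d) (mu : {measure set T -> \bar R}) (f : T -> CC) :
  clifford_L2 mu f <-> (forall C, L2 mu (fun t => reC (f t) C)) /\
    (forall C, L2 mu (fun t => imC (f t) C)).
Proof.
have re C : (fun t => reC (f t) C) = (fun t => complex.Re (f t C)).
  by apply/funext => t; rewrite ffunE.
have im C : (fun t => imC (f t) C) = (fun t => complex.Im (f t C)).
  by apply/funext => t; rewrite ffunE.
split=> [h|[hr hi] C]; last first.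
  by split; apply/Lfun2P; [rewrite -re|rewrite -im].
by split=> C; [rewrite re|rewrite im]; apply/Lfun2P; case: (h C).
Qed.

Lemma clifford_deriveE (v : R * 'rV[R]_m) (f : R * 'rV[R]_m -> CC) z :
  reC (clifford_derive v f z) = derivc v (fun z => reC (f z)) z /\
  imC (clifford_derive v f z) = derivc v (fun z => imC (f z)) z.
Proof.
split; apply/ffunP => C; rewrite !ffunE /=; congr ('D_v _ z);
  by apply/funext => u; rewrite ffunE.
Qed.

Lemma monogenicE (f : R * 'rV[R]_m -> CC) : monogenic f <->
  [/\ C1c (fun z => reC (f z)), C1c (fun z => imC (f z)),
    forall z, derivc (1, 0) (fun z => reC (f z)) z + \sum_j clifford_gen R j *
      derivc (0, delta_mx ord0 j) (fun z => reC (f z)) z = 0 &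
    forall z, derivc (1, 0) (fun z => imC (f z)) z + \sum_j clifford_gen R j *
      derivc (0, delta_mx ord0 j) (fun z => imC (f z)) z = 0].
Proof.
have re C : (fun t => reC (f t) C) = (fun t => complex.Re (f t C)).
  by apply/funext => t; rewrite ffunE.
have im C : (fun t => imC (f t) C) = (fun t => complex.Im (f t C)).
  by apply/funext => t; rewrite ffunE.
have eR z : reC (partial0 f z + dirac_op f z) =
    derivc (1, 0) (fun z => reC (f z)) z + \sum_j clifford_gen R j *
      derivc (0, delta_mx ord0 j) (fun z => reC (f z)) z.
  rewrite reCD /partial0 (clifford_deriveE (1, 0) f z).1; congr (_ + _).
  rewrite reC_sum; apply: eq_bigr => j _.
  by rewrite genC reC_mul (clifford_deriveE (0, delta_mx ord0 j) f z).1.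
have eI z : imC (partial0 f z + dirac_op f z) =
    derivc (1, 0) (fun z => imC (f z)) z + \sum_j clifford_gen R j *
      derivc (0, delta_mx ord0 j) (fun z => imC (f z)) z.
  rewrite imCD /partial0 (clifford_deriveE (1, 0) f z).2; congr (_ + _).
  rewrite imC_sum; apply: eq_bigr => j _.
  by rewrite genC imC_mul (clifford_deriveE (0, delta_mx ord0 j) f z).2.
split=> [[Cf Df]|[Cr Ci Dr Di]].
  split=> [C|C|z|z]; [rewrite re; exact: (Cf C).1|rewrite im; exact: (Cf C).2| |].
    by rewrite -eR Df reC0.
  by rewrite -eI Df imC0.
split=> [C|z].
  by split; [rewrite -re; exact: Cr|rewrite -im; exact: Ci].
by apply: reimC_inj; rewrite ?eR ?eI ?reC0 ?imC0.
Qed.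

Lemma clifford_innerC u v : clifford_inner u v =
  ((cinner (reC u) (reC v) + cinner (imC u) (imC v)) +i*
   (cinner (imC u) (reC v) - cinner (reC u) (imC v)))%C.
Proof.
apply/eqP; rewrite eq_complex /=; apply/andP; split; apply/eqP.
  rewrite (big_morph (@complex.Re R) ReD (erefl _)) -big_split; apply: eq_bigr => A _.
  by rewrite !ffunE; case: (u A) (v A) => [? ?] [? ?] /=; ring.
rewrite (big_morph (@complex.Im R) ImD (erefl _)) -sumrB; apply: eq_bigr => A _.
by rewrite !ffunE; case: (u A) (v A) => [? ?] [? ?] /=; ring.
Qed.

Lemma L2_innerC d (T : measurableType d) (mu : {measure set T -> \bar R}) (f g : T -> CC) :
  clifford_L2 mu f -> clifford_L2 mu g -> L2_inner mu f g =
  ((\int[mu]_t cinner (reC (f t)) (reC (g t)) + \int[mu]_t cinner (imC (f t)) (imC (g t))) +i*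
   (\int[mu]_t cinner (imC (f t)) (reC (g t)) - \int[mu]_t cinner (reC (f t)) (imC (g t))))%C.
Proof.
move=> /clifford_L2E[fr fi] /clifford_L2E[gr gi].
have i (a b : T -> CR) : (forall C, L2 mu (fun t => a t C)) ->
    (forall C, L2 mu (fun t => b t C)) -> L1 mu (fun t => cinner (a t) (b t)).
  by move=> a2 b2; apply: L1_sum => C; exact: L2M.
rewrite -(IntD (i _ _ fr gr) (i _ _ fi gi)) -(IntB (i _ _ fi gr) (i _ _ fr gi)).
by rewrite /L2_inner /cplx_integral; congr (_ +i* _)%C; apply: eq_Int => t;
  rewrite clifford_innerC.
Qed.

End complex_coordinates.

(** The first two clauses certify that the integrals in [V_transform] converge, since the integral
    is a total operation that assigns a value even to functions that are not integrable. *)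
Theorem theorem3p1 (R : realType) (m : nat) (hm : (1 <= m)%N) :
  [/\ forall z y, clifford_integrable (lebesgue_rV R m) (@V_integrand R m z y),
      forall (phi : 'rV[R]_m -> clifford R[i] m) z,
        clifford_L2 (lebesgue_rV R m) phi ->
        clifford_integrable (lebesgue_rV R m) (fun y => V_kernel z y * phi y) &
      unitary_iso
        (@clifford_L2 _ _ R m (lebesgue_rV R m)) (L2_eq (lebesgue_rV R m))
        (L2_inner (lebesgue_rV R m))
        (@monogenic_L2 R m) (L2_inner (gauss_measure R m))
        (@V_transform R m)].
Proof.
split; first exact: V_integrand_integrable.
  move=> phi z /clifford_L2E[fr fi] C; split.
    apply: (@eq_L1 _ _ _ (lebesgue_rV R m) _ _ _ (L1_kernel_mul z C fr)) => y.
    by rewrite V_kernelC -reC_mul reCE.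
  apply: (@eq_L1 _ _ _ (lebesgue_rV R m) _ _ _ (L1_kernel_mul z C fi)) => y.
  by rewrite V_kernelC -imC_mul imCE.
have vr (u : 'rV[R]_m -> clifford R[i] m) :
    (fun z => reC (V_transform u z)) = real_transform (fun y => reC (u y)).
  by apply/funext => z; rewrite V_transform_re.
have vi (u : 'rV[R]_m -> clifford R[i] m) :
    (fun z => imC (V_transform u z)) = real_transform (fun y => imC (u y)).
  by apply/funext => z; rewrite V_transform_im.
have V_L2 u : clifford_L2 (lebesgue_rV R m) u ->
    clifford_L2 (gauss_measure R m) (V_transform u).
  move=> /clifford_L2E[ur ui]; apply/clifford_L2E; split=> C.
    have := real_transform_L2 C ur; rewrite -vr; exact.
  have := real_transform_L2 C ui; rewrite -vi; exact.
split.
- move=> u u2; split; last exact: V_L2.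
  move: u2 => /clifford_L2E[ur ui]; apply/monogenicE; rewrite vr vi; split.
  + exact: real_transform_C1.
  + exact: real_transform_C1.
  + by move=> z; exact: real_transform_dirac.
  + by move=> z; exact: real_transform_dirac.
- move=> a u v /clifford_L2E[ur ui] /clifford_L2E[v_r v_i]; apply/funext => z.
  apply: reimC_inj.
    rewrite V_transform_re.
    have -> : (fun y => reC ((a *: u + v) y)) = fun y =>
        (complex.Re a *: reC (u y) + - complex.Im a *: imC (u y)) + reC (v y).
      by apply/funext => y; rewrite reCD reCZ.
    rewrite real_transformD//; last by apply: L2cD; exact: L2cZ.
    rewrite real_transformD; [|exact: L2cZ|exact: L2cZ].
    rewrite !real_transformZ//.
    have -> : (a *: V_transform u + V_transform v) z =
      a *: V_transform u z + V_transform v z by [].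
    have := V_transform_re v z; have := V_transform_re u z; have := V_transform_im u z.
    by move: (V_transform u z) (V_transform v z) => b c <- <- <-; rewrite reCD reCZ.
  rewrite V_transform_im.
  have -> : (fun y => imC ((a *: u + v) y)) = fun y =>
      (complex.Re a *: imC (u y) + complex.Im a *: reC (u y)) + imC (v y).
    by apply/funext => y; rewrite imCD imCZ.
  rewrite real_transformD//; last by apply: L2cD; exact: L2cZ.
  rewrite real_transformD; [|exact: L2cZ|exact: L2cZ].
  rewrite !real_transformZ//.
  have -> : (a *: V_transform u + V_transform v) z =
    a *: V_transform u z + V_transform v z by [].
  have := V_transform_im v z; have := V_transform_re u z; have := V_transform_im u z.
  by move: (V_transform u z) (V_transform v z) => b c <- <- <-; rewrite imCD imCZ.
- move=> u v u2 v2; rewrite (L2_innerC (V_L2 u u2) (V_L2 v v2)) (L2_innerC u2 v2).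
  move: u2 v2 => /clifford_L2E[ur ui] /clifford_L2E[v_r v_i].
  have inner (f g : R * 'rV[R]_m -> clifford R m) phi psi : L2c phi -> L2c psi ->
      f = real_transform phi -> g = real_transform psi ->
      \int[gauss_measure R m]_z cinner (f z) (g z) =
      \int[lebesgue_rV R m]_y cinner (phi y) (psi y).
    by move=> ? ? -> ->; exact: real_transform_inner.
  congr ((_ + _) +i* (_ - _))%C.
  + exact: (inner _ _ _ _ ur v_r (vr u) (vr v)).
  + exact: (inner _ _ _ _ ui v_i (vi u) (vi v)).
  + exact: (inner _ _ _ _ ui v_r (vi u) (vr v)).
  + exact: (inner _ _ _ _ ur v_i (vr u) (vi v)).
- move=> u v /clifford_L2E[ur ui] /clifford_L2E[v_r v_i]; split=> [e|e].
    have er := etrans (esym (vr u)) (etrans (congr1 (fun T z => reC (T z)) e) (vr v)).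
    have ei := etrans (esym (vi u)) (etrans (congr1 (fun T z => imC (T z)) e) (vi v)).
    (* Injectivity is known coordinate by coordinate; the finitely many exceptional null sets are
       merged to compare whole multivectors. *)
    have hr := @filter_forall _ _ (fun C y => reC (u y) C = reC (v y) C) _
      (ae_filter_ringOfSetsType (lebesgue_rV R m)) (real_transform_inj ur v_r er).
    have hi := @filter_forall _ _ (fun C y => imC (u y) C = imC (v y) C) _
      (ae_filter_ringOfSetsType (lebesgue_rV R m)) (real_transform_inj ui v_i ei).
    apply: filterS2 hr hi => y yr yi.
    by apply: reimC_inj; apply/ffunP.
  apply/funext => z; apply: reimC_inj.
    apply: (etrans (V_transform_re u z)); apply: (etrans _ (esym (V_transform_re v z))).
    congr (_ z); apply: eq_real_transform => // C.
    by apply: filterS e => y ->.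
  apply: (etrans (V_transform_im u z)); apply: (etrans _ (esym (V_transform_im v z))).
  congr (_ z); apply: eq_real_transform => // C.
  by apply: filterS e => y ->.
- move=> f [/monogenicE[Cr Ci Dr Di] /clifford_L2E[fr fi]].
  have [pr pr2 er] := real_transform_surj Cr Dr fr.
  have [pi_ pi2 ei] := real_transform_surj Ci Di fi.
  pose phi y : clifford R[i] m := [ffun C => (pr y C +i* pi_ y C)%C].
  have pre : (fun y => reC (phi y)) = pr.
    by apply/funext => y; apply/ffunP => C; rewrite !ffunE.
  have pie : (fun y => imC (phi y)) = pi_.
    by apply/funext => y; apply/ffunP => C; rewrite !ffunE.
  exists phi.
    apply/clifford_L2E; split=> C.
      by have := pr2 C; rewrite -pre.
    by have := pi2 C; rewrite -pie.
  apply/funext => z; apply: reimC_inj.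
    by rewrite V_transform_re pre er.
  by rewrite V_transform_im pie ei.
Qed.
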